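(* Let $\{\varepsilon_n\}_{n\ge 1}$ be a sequence of positive numbers with $\varepsilon_n\to 0$ as $n\to\infty$. Then there exist a uniformly discrete sequence of (nonzero) real numbers $\Lambda=\{\lambda_n\}_{n\ge1}$ satisfying $\lambda_{n+1}/\lambda_n>1+\varepsilon_n$ for all $n\ge1$, and a function $g\in L^2(\mathbb{R})$ which is infinitely smooth, and even the restriction to $\mathbb{R}$ of an entire function, such that the system of translates $\{g(t-\lambda)\}_{\lambda\in\Lambda}$ is a $(QF)$-system for $L^2(\mathbb{R})$. (In particular, there exist a uniformly discrete $\Lambda$ and a $g\in L^2(\mathbb{R})$ that is the restriction to $\mathbb{R}$ of an entire function such that $\{g(t-\lambda)\}_{\lambda\in\Lambda}$ is a $(QF)$-system for $L^2(\mathbb{R})$.)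
   Context: A set (sequence) $\Lambda$ of real numbers is uniformly discrete if $\inf_{\lambda\neq\lambda',\ \lambda,\lambda'\in\Lambda}|\lambda-\lambda'|>0$. A system of vectors $\{u_n\}$ in a Hilbert space $H$ is called a $(QF)$-system if the following two conditions hold: (i) for every $q>2$ there is a constant $C(q)$ such that, for every $f\in H$ and every $\epsilon>0$, there is a (finite) linear combination $Q=\sum c_n u_n$ with $\|f-Q\|<\epsilon$ and $\|\{c_n\}\|_{l_q}\le C(q)\|f\|$; (ii) (Bessel inequality) there is a constant $C'$, not depending on $f$, such that $\left(\sum|\langle f,u_n\rangle|^2\right)^{1/2}\le C'\|f\|$ for all $f\in H$. *)

(* Defs.v *)
From HB Require Import structures.
From mathcomp Require Import all_boot all_order all_algebra.
From mathcomp Require Import complex.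
From mathcomp Require Import all_classical all_reals all_analysis.
Import Order.TTheory GRing.Theory Num.Theory.
Import numFieldNormedType.Exports.
Set Implicit Arguments.
Unset Strict Implicit.
Unset Printing Implicit Defensive.

Local Open Scope classical_set_scope.
Local Open Scope ring_scope.
Local Open Scope complex_scope.

Definition cmod {R : realType} (z : R[i]) : R := ComplexField.Normc.normc z.

(* Elements of the complex Hilbert space L^2(R) are handled through (Borel)
   representatives R -> R[i]: L2norm, L2dot and hence QF_system depend only on
   the classes modulo a.e. equality. *)

Definition L2norm {R : realType} (f : R -> R[i]) : \bar R :=
  Lnorm (@lebesgue_measure R) 2%:E (fun t => (cmod (f t))%:E).

Definition inL2 {R : realType} (f : R -> R[i]) : Prop :=
  [/\ measurable_fun setT (fun t => complex.Re (f t)),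
      measurable_fun setT (fun t => complex.Im (f t)) &
      (L2norm f < +oo)%E].

(* The Lebesgue integral is only available for real-valued integrands, hence
   the separate integration of the two parts of f(t) * conj(g(t)). *)
Definition L2dot {R : realType} (f g : R -> R[i]) : R[i] :=
  (\int[@lebesgue_measure R]_t complex.Re (f t * (g t)^*)) +i*
  (\int[@lebesgue_measure R]_t complex.Im (f t * (g t)^*)).

Definition lq_norm {R : realType} (q : R) (N : nat) (c : 'I_N -> R[i]) : R :=
  (\sum_(i < N) cmod (c i) `^ q) `^ q^-1.

Definition lincomb {R : realType} (u : nat -> R -> R[i]) (N : nat)
    (c : 'I_N -> R[i]) : R -> R[i] :=
  fun t => \sum_(i < N) c i * u i t.

Definition QF_approximation {R : realType} (u : nat -> R -> R[i]) : Prop :=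
  forall q : R, 2 < q ->
  exists C : R, forall f : R -> R[i], inL2 f -> forall e : R, 0 < e ->
  exists (N : nat) (c : 'I_N -> R[i]),
    (L2norm (fun t => f t - lincomb u c t)%R < e%:E)%E /\
    ((lq_norm q c)%:E <= C%:E * L2norm f)%E.

Definition Bessel {R : realType} (u : nat -> R -> R[i]) : Prop :=
  exists C : R, forall f : R -> R[i], inL2 f ->
    ((\sum_(0 <= n <oo) (cmod (L2dot f (u n)) ^+ 2)%:E) `^ 2^-1
       <= C%:E * L2norm f)%E.

Definition QF_system {R : realType} (u : nat -> R -> R[i]) : Prop :=
  [/\ forall n, inL2 (u n), QF_approximation u & Bessel u].

(* Sequences are indexed from 0: lam n and eps n stand for lambda_(n+1) and
   varepsilon_(n+1). The infimum runs over pairs of distinct indices, so a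
   uniformly discrete sequence has pairwise distinct terms. *)
Definition uniformly_discrete {R : realType} (lam : nat -> R) : Prop :=
  0 < inf [set x | exists n m : nat, n != m /\ x = `|lam n - lam m|].

Definition translates {R : realType} (g : R -> R[i]) (lam : nat -> R) :
    nat -> R -> R[i] :=
  fun n t => g (t - lam n).

(* Complex differentiability at every point: R[i]^o is R[i] as a normed space
   over itself. *)
Definition entire {R : realType} (G : R[i] -> R[i]) : Prop :=
  forall z : R[i], derivable (G : R[i]^o -> R[i]^o) z 1.

Definition entire_on_reals {R : realType} (g : R -> R[i]) : Prop :=
  exists G : R[i] -> R[i], entire G /\ forall t : R, g t = G t%:C.

Definition smooth {R : realType} (g : R -> R[i]) : Prop :=
  forall (n : nat) (t : R),
    derivable (derive1n n (fun s => complex.Re (g s))) t 1 /\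
    derivable (derive1n n (fun s => complex.Im (g s))) t 1.

(* Main.v *)
(** Finite combinations of point masses x = sum_j a_j delta_(s_j), encoded as
    lists of pairs (a_j, s_j), act on functions by translation. The function g
    is the limit of x_k * gamma, where gamma(t) = exp(-t^2), for which the Gram
    form of the translates is explicit.

    In step k one takes a trigonometric polynomial Q with positive frequencies
    that is close to 1 off a set of small measure and whose l^q norm is tiny for
    q >= 2 + 1/(k+1), and puts x_(k+1) = psi * x_k with the filter
    psi = (1 - |1-Q|^2/M)^r in the frequencies d Z. For large d the frequencies
    of Q decouple from x_k, so that (1-Q) psi x_k gamma and (1-psi) x_k gamma
    are both small. Hence g(. - s) is close to the sum of the q_n g(. - s - d n),
    with tiny l^q norm, and the points s + d n (1 <= n <= K) are appended to
    Lambda; their ratios exceed 1 + 1/(2K), hence 1 + eps once enough lacunary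
    points have been inserted before the block. Here s runs infinitely often
    through every rational.

    Each psi is approximately invertible by a Neumann series, so gamma and its
    rational translates, which are total in L^2, are limits of combinations of
    rational translates of g. As the filters are contractions, the Bessel
    inequality for g follows, by duality, from that for the 1-separated
    translates of gamma. Rapid convergence of the Taylor coefficients of
    x_k * gamma / gamma makes g entire. *)
Require Import Defs.
From HB Require Import structures.
From mathcomp Require Import all_boot all_order all_algebra.
From mathcomp Require Import complex.
From mathcomp Require Import all_classical all_reals all_analysis.
From mathcomp Require Import separable cyclic cyclotomic measurable_realfun.
From mathcomp Require Import ring lra zify.
Import Order.TTheory GRing.Theory Num.Theory.
Import numFieldNormedType.Exports.
Set Implicit Arguments.
Unset Strict Implicit.
Unset Printing Implicit Defensive.

Local Open Scope classical_set_scope.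
Local Open Scope ring_scope.

(** * Finite combinations of point masses and trigonometric polynomials *)

(** A polynomial Q with positive frequencies has mean zero, so 1 - Q is never small in L^2 of the
    circle; it can be small only off a set of small measure. Hence g(. - s) is close to a
    combination of far translates only if g has almost no spectrum where 1 - Q is large, and the
    filter removes that part. Since Q is close to 1 on most of the circle, its l^2 norm is not small
    either: only for q > 2 does spreading the coefficients help.

    A filter is a polynomial in translations, so positivity of the Gram kernel can stand in for the
    Fourier transform on the line. Filters commute and contract, so an estimate for (1 - Q) x_(k+1)
    gamma obtained at step k survives every later filter. Invertibility is not inherited in this
    way: an approximate inverse S of x_(k+1) is fixed at step k, and later filters must move S x_m
    very little. This is why the accuracy of each step depends on the l^1 norms of all earlier
    inverses. *)

Section lists.
Variables (R : realFieldType) (V : zmodType).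
Implicit Types (p q : seq (R * V)) (a : R) (s : V).

Definition lscale a p : seq (R * V) := [seq (a * x.1, x.2) | x <- p].
Definition lmul p q : seq (R * V) := [seq (x.1 * y.1, x.2 + y.2) | x <- p, y <- q].
Definition ladj p : seq (R * V) := [seq (x.1, - x.2) | x <- p].
Definition lone : seq (R * V) := [:: (1, 0)].
Fixpoint lpow p n := if n is m.+1 then lmul p (lpow p m) else lone.
Definition lnorm1 p : R := \sum_(x <- p) `|x.1|.

(* The pairing of sum_i a_i delta_(s_i) with sum_j b_j delta_(t_j) through a
   translation invariant kernel. *)
Definition lform (k : V -> R) p q : R :=
  \sum_(x <- p) \sum_(y <- q) x.1 * y.1 * k (x.2 - y.2).

Lemma big_ladj (W : nmodType) (F : R -> V -> W) p :
  \sum_(x <- ladj p) F x.1 x.2 = \sum_(x <- p) F x.1 (- x.2).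
Proof. by rewrite big_map. Qed.

Lemma big_lmul (W : nmodType) (F : R -> V -> W) p q :
  \sum_(x <- lmul p q) F x.1 x.2 =
  \sum_(x <- p) \sum_(y <- q) F (x.1 * y.1) (x.2 + y.2).
Proof. by rewrite big_allpairs_dep. Qed.

Lemma lnorm1_ge0 p : 0 <= lnorm1 p.
Proof. exact: sumr_ge0. Qed.

Lemma lnorm1_cat p q : lnorm1 (p ++ q) = lnorm1 p + lnorm1 q.
Proof. by rewrite /lnorm1 big_cat. Qed.

Lemma lnorm1_scale a p : lnorm1 (lscale a p) = `|a| * lnorm1 p.
Proof.
by rewrite /lnorm1 big_map mulr_sumr; apply: eq_bigr => x _; rewrite normrM.
Qed.

Lemma lnorm1_mul p q : lnorm1 (lmul p q) = lnorm1 p * lnorm1 q.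
Proof.
rewrite /lnorm1 (big_lmul (fun a _ => `|a|)) mulr_suml.
apply: eq_bigr => x _; rewrite mulr_sumr; apply: eq_bigr => y _.
by rewrite normrM.
Qed.

Lemma lnorm1_adj p : lnorm1 (ladj p) = lnorm1 p.
Proof. by rewrite /lnorm1 (big_ladj (fun a _ => `|a|)). Qed.

End lists.
Arguments lone {R V}.

(** * Trigonometric polynomials on the unit circle and Parseval's identity *)

Section trigonometric.
Local Open Scope complex_scope.
Variable R : rcfType.
Implicit Types (p q : seq (R * int)) (z w : R[i]).

Definition sqmod z : R := complex.Re z ^+ 2 + complex.Im z ^+ 2.

Lemma sqmodE z : (sqmod z)%:C = z * conjc z.
Proof.
by case: z => a b; apply/eqP; rewrite eq_complex /sqmod /=; apply/andP; split;
   apply/eqP; ring.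
Qed.

Lemma sqmod_ge0 z : 0 <= sqmod z.
Proof. by rewrite addr_ge0 ?sqr_ge0. Qed.

Lemma sqmodM z w : sqmod (z * w) = sqmod z * sqmod w.
Proof. by case: z w => [a b] [c d]; rewrite /sqmod /=; ring. Qed.

Lemma sqmod1 : sqmod 1 = 1. Proof. by rewrite /sqmod /= expr0n addr0 expr1n. Qed.

Lemma sqmodX z n : sqmod (z ^+ n) = sqmod z ^+ n.
Proof. by elim: n => [|n IH]; rewrite ?expr0 ?sqmod1// !exprS sqmodM IH. Qed.

Lemma sqmodC (a : R) : sqmod a%:C = a ^+ 2.
Proof. by rewrite /sqmod /= expr0n addr0. Qed.

Lemma sqmod0 : sqmod 0 = 0. Proof. by rewrite /sqmod /= expr0n addr0. Qed.

Lemma sqmod_normc z : sqmod z = ComplexField.Normc.normc z ^+ 2.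
Proof. by case: z => a b; rewrite /= sqr_sqrtr// addr_ge0 ?sqr_ge0. Qed.

Lemma sqmodD z w : sqmod (z + w) <= 2 * sqmod z + 2 * sqmod w.
Proof. case: z w => [a b] [c d]; rewrite /sqmod /=.
have := sqr_ge0 (a - c); have := sqr_ge0 (b - d); nra.
Qed.

Lemma sqmodN z : sqmod (- z) = sqmod z.
Proof. by case: z => [a b]; rewrite /sqmod /= !sqrrN. Qed.

Lemma normc_sum (I : Type) (s : seq I) (F : I -> R[i]) :
  ComplexField.Normc.normc (\sum_(i <- s) F i) <=
  \sum_(i <- s) ComplexField.Normc.normc (F i).
Proof.
elim: s => [|x s IH]; first by rewrite !big_nil /= expr0n addr0 sqrtr0.
by rewrite !big_cons (le_trans (le_normcD _ _))// lerD2l.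
Qed.

Definition unimod z := sqmod z = 1.

Lemma unimod_neq0 z : unimod z -> z != 0.
Proof.
move=> z1; apply/eqP => z0; move: z1; rewrite z0 /unimod sqmod0 => /eqP.
by rewrite eq_sym oner_eq0.
Qed.

Lemma unimod_conj z : unimod z -> conjc z = z^-1.
Proof.
move=> z1; have z0 := unimod_neq0 z1.
by apply: (mulfI z0); rewrite -sqmodE z1 mulfV.
Qed.

Lemma unimodX z n : unimod z -> unimod (z ^+ n).
Proof. by rewrite /unimod sqmodX => ->; rewrite expr1n. Qed.

Definition ev p z : R[i] := \sum_(x <- p) x.1%:C * z ^ x.2.

Lemma ev_cat p q z : ev (p ++ q) z = ev p z + ev q z.
Proof. by rewrite /ev big_cat. Qed.

Lemma ev_scale a p z : ev (lscale a p) z = a%:C * ev p z.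
Proof.
rewrite /ev big_map mulr_sumr; apply: eq_bigr => x _.
by rewrite rmorphM mulrA.
Qed.

Lemma ev_one z : ev lone z = 1.
Proof. by rewrite /ev big_seq1 /= expr0z mulr1. Qed.

Lemma ev_mul p q z : z != 0 -> ev (lmul p q) z = ev p z * ev q z.
Proof.
move=> z0; rewrite /ev (big_lmul (fun a n => a%:C * z ^ n)) mulr_suml.
apply: eq_bigr => x _; rewrite mulr_sumr; apply: eq_bigr => y _ /=.
by rewrite expfzDr// rmorphM /= mulrACA.
Qed.

Lemma ev_pow p n z : z != 0 -> ev (lpow p n) z = ev p z ^+ n.
Proof.
by move=> z0; elim: n => [|n IH] /=; rewrite ?ev_one// ev_mul// IH exprS.
Qed.

Lemma conjcXz (w : R[i]) (n : int) : conjc (w ^ n) = conjc w ^ n.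
Proof.
by case: n => n; rewrite ?NegzE -?exprnP -?exprnN ?conjc_inv rmorphXn.
Qed.

Lemma conjc_ev p z : unimod z -> conjc (ev p z) = ev (ladj p) z.
Proof.
move=> z1; rewrite /ev (big_ladj (fun a n => a%:C * z ^ n)) rmorph_sum /=.
apply: eq_bigr => x _.
rewrite rmorphM /= oppr0 conjcXz.
rewrite (unimod_conj z1) exprz_inv.
by [].
Qed.

Lemma sqmod_ev p z : unimod z -> (sqmod (ev p z))%:C = ev (lmul p (ladj p)) z.
Proof. by move=> z1; rewrite sqmodE conjc_ev// ev_mul// unimod_neq0. Qed.

Definition kron (n : int) : R := (n == 0)%:R.
(** The kernel [kron] pairs equal frequencies, so repeated entries are merged and this is the
    squared L^2 norm on the circle. *)
Definition norm2c p : R := lform kron p p.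

(** X^N - 1 splits over R[i] and is separable in characteristic 0, so it has enough distinct roots
    for [has_prim_root]. *)
Lemma prim_root_exists (N : nat) : (0 < N)%N -> {w : R[i] | N.-primitive_root w}.
Proof.
pose p : {poly R[i]} := 'X^N - 1; have [r Dp] := closed_field_poly_normal p.
move=> N_gt0; apply/sigW; rewrite (monicP _) ?monicXnsubC // scale1r in Dp.
have rn1: all N.-unity_root r by apply/allP=> z; rewrite -root_prod_XsubC -Dp.
have sz_r: (N < (size r).+1)%N.
  by rewrite -(size_prod_XsubC r id) -Dp size_XnsubC.
have [|z] := hasP (has_prim_root N_gt0 rn1 _ sz_r); last by exists z.
by rewrite -separable_prod_XsubC -Dp separable_Xn_sub_1 // pnatr_eq0 -lt0n.
Qed.

Lemma prim_unimod N (w : R[i]) : (0 < N)%N -> N.-primitive_root w -> unimod w.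
Proof.
move=> N0 /prim_expr_order w1.
have : sqmod w ^+ N = 1 by rewrite -sqmodX w1 sqmod1.
by move=> /eqP; rewrite pexpr_eq1 ?sqmod_ge0// => /eqP.
Qed.

(** Averages over the N-th roots of unity replace integrals over the circle; for trigonometric
    polynomials and large N the two agree. *)
Definition avg N w (F : R[i] -> R) : R := N%:R^-1 * \sum_(j < N) F (w ^+ j).

Lemma avg_le N w F G : (forall z, unimod z -> F z <= G z) -> unimod w ->
  avg N w F <= avg N w G.
Proof.
move=> FG w1; rewrite ler_wpM2l ?invr_ge0 ?ler0n// ler_sum// => j _.
exact/FG/unimodX.
Qed.

Lemma avgD N w F G : avg N w (fun z => F z + G z) = avg N w F + avg N w G.
Proof. by rewrite /avg big_split mulrDr. Qed.

Lemma avgZ N w a F : avg N w (fun z => a * F z) = a * avg N w F.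
Proof. by rewrite /avg -mulr_sumr mulrCA. Qed.

Lemma avg_ge0 N w F : (forall z, 0 <= F z) -> 0 <= avg N w F.
Proof.
by move=> F0; rewrite mulr_ge0 ?invr_ge0 ?ler0n// sumr_ge0.
Qed.

Lemma avg_cst N w a : (0 < N)%N -> avg N w (fun=> a) = a.
Proof.
move=> N0; rewrite /avg sumr_const card_ord -[a *+ N]mulr_natl mulrA mulVf ?mul1r//.
by rewrite pnatr_eq0 -lt0n.
Qed.

Lemma sum_prim_root N (w : R[i]) (n : int) : (0 < N)%N -> N.-primitive_root w ->
  (`|n| < N)%N -> \sum_(j < N) (w ^+ j) ^ n = (N%:R * kron n)%:C.
Proof.
move=> N0 Nw nN; rewrite /kron; have [->|n0] /= := eqVneq n 0.
  rewrite mulr1 (eq_bigr (fun=> 1)) => [|j _]; last by rewrite expr0z.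
  by rewrite sumr_const card_ord rmorph_nat.
rewrite mulr0 (_ : 0%:C = 0)//.
have w0 : w != 0 by exact/unimod_neq0/(prim_unimod N0).
have wn1 : w ^ n - 1 != 0.
  rewrite subr_eq0; apply/negP => /eqP wn1.
  have : w ^+ `|n| = 1.
    case: n wn1 {nN n0} => m //= wm.
    by apply: invr_inj; rewrite invr1.
  move=> /eqP; rewrite -(prim_order_dvd Nw) => /dvdn_leq.
  by rewrite absz_gt0 leqNgt nN => /(_ n0).
apply: (mulfI wn1); rewrite mulr0.
rewrite (eq_bigr (fun j : 'I_N => (w ^ n) ^+ j)) => [|j _]; last first.
  by rewrite !exprnP !exprz_exp mulrC.
by rewrite -subrX1 exprnP exprz_exp mulrC -exprz_exp -exprnP
  (prim_expr_order Nw) exp1rz subrr.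
Qed.

(** After expansion of the square, only frequencies congruent modulo N interact; the last hypothesis
    makes these equal. *)
Lemma parseval p N w : (0 < N)%N -> N.-primitive_root w ->
  (forall x y, x \in p -> y \in p -> (`|x.2 - y.2| < N)%N) ->
  norm2c p = avg N w (fun z => sqmod (ev p z)).
Proof.
move=> N0 Nw pN; have w1 := prim_unimod N0 Nw.
have N0R : N%:R != 0 :> R by rewrite pnatr_eq0 -lt0n.
apply: (mulfI N0R); rewrite /avg mulrA mulfV// mul1r.
apply: complexI; rewrite (rmorph_sum (real_complex R)).
have E z : unimod z -> (sqmod (ev p z))%:C =
    \sum_(x <- p) \sum_(y <- p) (x.1 * y.1)%:C * z ^ (x.2 - y.2).
  move=> z1; rewrite sqmod_ev //.
  rewrite [LHS](big_lmul (fun a n => a%:C * z ^ n)); apply: eq_bigr => x _.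
  exact: (big_ladj (fun a n => (x.1 * a)%:C * z ^ (x.2 + n))).
rewrite (eq_bigr _ (fun (j : 'I_N) _ => E _ (unimodX j w1))).
rewrite exchange_big rmorphM /= /norm2c /lform (rmorph_sum (real_complex R)).
rewrite mulr_sumr big_seq [RHS]big_seq; apply: eq_bigr => x xp /=.
rewrite exchange_big /= (rmorph_sum (real_complex R)) mulr_sumr.
rewrite big_seq [RHS]big_seq; apply: eq_bigr => y yp /=.
rewrite -mulr_sumr sum_prim_root ?pN// -!rmorphM /=.
by congr _%:C; ring.
Qed.

End trigonometric.

(** * Dirichlet kernels away from the point 1 *)

Section geometric_sums.
Local Open Scope complex_scope.
Variable R : realType.
Implicit Types (p q : seq (R * int)) (z w u : R[i]).
Local Notation normc := ComplexField.Normc.normc.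

(** Induction on (1 - y) (1 + (n + 1) y) <= 1 + n y. This bound is useful when n y is large,
    [bernoulli] when n y is small. *)
Lemma bernoulli_inv (y : R) n : 0 <= y <= 1 -> (1 - y) ^+ n * (1 + n%:R * y) <= 1.
Proof.
move=> /andP[y0 y1]; elim: n => [|n IH]; first by rewrite expr0 mul0r addr0 mulr1.
apply: le_trans IH; rewrite exprS mulrAC mulrC ler_wpM2l ?exprn_ge0 ?subr_ge0//.
rewrite -natr1; have := ler0n R n; nra.
Qed.

Lemma bernoulli (y : R) n : 0 <= y <= 1 -> 1 - n%:R * y <= (1 - y) ^+ n.
Proof.
move=> /andP[y0 y1]; elim: n => [|n IH]; first by rewrite expr0 mul0r subr0.
rewrite exprS; apply: le_trans (ler_wpM2l _ IH); last lra.
rewrite -natr1; have := ler0n R n; nra.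
Qed.

Lemma large_nat (x : R) : exists n : nat, (0 < n)%N /\ x <= n%:R.
Proof.
by exists (Num.trunc x).+1; split=> //; exact/ltW/truncnS_gt.
Qed.

Lemma small_pow (y e : R) : 0 < y <= 1 -> 0 < e -> exists n, (1 - y) ^+ n <= e.
Proof.
move=> /andP[y0 y1] e0; have [n [n0 nP]] := large_nat ((e * y)^-1).
exists n; have := @bernoulli_inv y n _; rewrite (ltW y0) y1 => /(_ isT) h.
have ny : e^-1 <= n%:R * y by rewrite -ler_pdivrMr// -invfM.
have h0 : 0 <= (1 - y) ^+ n by rewrite exprn_ge0// subr_ge0.
have e1 : (1 - y) ^+ n * e^-1 <= 1.
  by apply: le_trans h; rewrite ler_wpM2l//; lra.
by move: e1; rewrite ler_pdivrMr// mul1r.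
Qed.

(** The Dirichlet kernel; [sqmod (geo m u)] divided by m is the Fejer kernel. *)
Definition geo (j : nat) u : R[i] := \sum_(0 <= a < j) u ^+ a.

Lemma geoM j u : (1 - u) * geo j u = 1 - u ^+ j.
Proof. by rewrite /geo big_mkord -[RHS]opprB subrX1 -mulNr opprB. Qed.

Lemma geoS j u : geo j.+1 u = geo j u + u ^+ j.
Proof. by rewrite /geo big_nat_recr. Qed.

Lemma geo_pairs j u : unimod u -> (sqmod (geo j u))%:C =
  \sum_(0 <= a < j) \sum_(0 <= b < j) u ^ (a%:Z - b%:Z).
Proof.
move=> u1; rewrite sqmodE /geo rmorph_sum /= mulr_suml; apply: eq_bigr => a _.
rewrite mulr_sumr; apply: eq_bigr => b _.
by rewrite rmorphXn /= (unimod_conj u1) expfzDr ?unimod_neq0// -exprnN exprVn.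
Qed.

Lemma normc_unimod u : unimod u -> normc u = 1.
Proof.
rewrite /unimod sqmod_normc => /eqP; rewrite sqrf_eq1 => /orP[/eqP//|/eqP h].
have : 0 <= normc u by case: (u) => a b; exact: sqrtr_ge0.
by rewrite h oppr_ge0 ler10.
Qed.

Lemma normc_ge0 u : 0 <= normc u.
Proof. by case: u => a b; exact: sqrtr_ge0. Qed.

Lemma normc_real (a : R) : normc a%:C = `|a|.
Proof. by rewrite /= expr0n addr0 sqrtr_sqr. Qed.

Lemma normc_sub1X u j : unimod u -> normc (1 - u ^+ j) <= j%:R * normc (1 - u).
Proof.
move=> u1; rewrite -geoM ComplexField.Normc.normcM mulrC ler_wpM2r ?normc_ge0//.
rewrite (le_trans (normc_sum _ _))// (eq_bigr (fun=> 1)).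
  by rewrite sumr_const_nat subn0.
by move=> i _; rewrite normc_unimod//; exact: unimodX.
Qed.

Lemma sqmod_sub1X u j : unimod u -> sqmod (1 - u ^+ j) <= 4.
Proof.
move=> u1; apply: (le_trans (sqmodD _ _)).
by rewrite sqmodN sqmod1 (unimodX j u1); lra.
Qed.

(** The condition [sqmod (geo K u) <= K%:R ^+ 2 / 4] says that u is off an arc of length about 1/K
    around 1, without arguments of complex numbers. Its failure is rare because the mean of
    [sqmod (geo K u)] is K. *)
Lemma far_from_geo K u : (0 < K)%N -> sqmod (geo K u) <= K%:R ^+ 2 / 4 ->
  K%:R / 2 <= normc (\sum_(0 <= j < K) (1 - u ^+ j)).
Proof.
move=> K0 h; have K0R : 0 < K%:R :> R by rewrite ltr0n.
have g : normc (geo K u) <= K%:R / 2.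
  rewrite -(@ler_pXn2r _ 2%N)// ?nnegrE ?normc_ge0 ?divr_ge0//.
  by rewrite -sqmod_normc (le_trans h)//; lra.
rewrite big_split /= sumrN -/(geo K u) sumr_const_nat subn0.
have -> : (1 : R[i]) *+ K = K%:R%:C by rewrite rmorph_nat.
have : normc (K%:R%:C : R[i]) <= normc (K%:R%:C - geo K u) + normc (geo K u).
  by rewrite -{1}[K%:R%:C](subrK (geo K u)) le_normcD.
rewrite normc_real ger0_norm ?ler0n//; lra.
Qed.

(** Off the arc |1 - u| >= 1/(2K), so |geo m u|^2 <= 4 / |1 - u|^2 <= 16 K^2, which is at most
    m/2. *)
Lemma geo_small1 K m u : unimod u -> (0 < K)%N -> (32 * K ^ 2 <= m)%N ->
  sqmod (geo K u) <= K%:R ^+ 2 / 4 -> m%:R^-1 * sqmod (geo m u) <= 2^-1.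
Proof.
move=> u1 K0 Km /(far_from_geo K0) h; have K0R : 0 < K%:R :> R by rewrite ltr0n.
have m0 : 0 < m%:R :> R.
  by rewrite ltr0n (leq_trans _ Km)// muln_gt0 expn_gt0 K0.
have h1 : K%:R / 2 <= K%:R ^+ 2 * normc (1 - u).
  apply: (le_trans h); apply: (le_trans (normc_sum _ _)).
  apply: (@le_trans _ _ (\sum_(0 <= j < K) K%:R * normc (1 - u))).
    rewrite big_nat [X in _ <= X]big_nat; apply: ler_sum => j /andP[_ jK].
    apply: (le_trans (normc_sub1X _ u1)); rewrite ler_wpM2r ?normc_ge0//.
    by rewrite ler_nat ltnW.
  by rewrite sumr_const_nat subn0 -[X in X <= _]mulr_natl expr2 mulrA.
have h2 : 1 <= 2 * K%:R * normc (1 - u).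
  by rewrite -(@ler_pM2l _ K%:R)// mulr1; move: h1; rewrite expr2 -mulrA; lra.
have h3 : 1 <= 4 * K%:R ^+ 2 * sqmod (1 - u).
  have := @ler_pM _ 1 _ 1 _ ler01 ler01 h2 h2.
  by rewrite sqmod_normc mulr1 => /le_trans; apply; rewrite le_eqVlt; apply/orP; left; apply/eqP; ring.
have h4 : sqmod (geo m u) <= 16 * K%:R ^+ 2.
  have e : sqmod (1 - u) * sqmod (geo m u) <= 4.
    by rewrite -sqmodM geoM sqmod_sub1X.
  have := ler_wpM2l (sqmod_ge0 (geo m u)) h3.
  have := ler_wpM2l (sqr_ge0 K%:R) e; lra.
rewrite mulrC ler_pdivrMr// (le_trans h4)//.
have : (32 * K ^ 2)%:R <= m%:R :> R by rewrite ler_nat.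
by rewrite natrM natrX; lra.
Qed.

Lemma sqr_sum_le (n : nat) (F : nat -> R) :
  (\sum_(0 <= j < n) F j) ^+ 2 <= n%:R * \sum_(0 <= j < n) F j ^+ 2.
Proof.
elim: n => [|n IH]; first by rewrite !big_nil expr0n mul0r.
rewrite !big_nat_recr//= -natr1.
set A := \sum_(_ <= _ < _) _ in IH *; set B := \sum_(_ <= _ < _) _ in IH *.
have h : 2 * A * F n <= B + n%:R * F n ^+ 2.
  have [n0|n0] := eqVneq n 0%N.
    by rewrite /A /B n0 !big_nil; lra.
  have n0' : 0 < n%:R :> R by rewrite ltr0n lt0n.
  rewrite -(@ler_pM2l _ n%:R)//; have := sqr_ge0 (A - n%:R * F n); nra.
nra.
Qed.

(** The identity (1 - u^j) geo m = (1 - u^m) geo j is averaged over j < K. The right side has mean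
    at most 16 K, against the pointwise bound 16 K^2 behind [geo_small1]. So m may be taken linear
    in K, and the flatness estimate needs this: with m of order K^2 the l^1 norm would outgrow the
    gain. *)
Lemma geo_small2 K m u : unimod u -> (0 < K)%N ->
  sqmod (geo K u) <= K%:R ^+ 2 / 4 ->
  sqmod (geo m u) <= 16 / K%:R * \sum_(0 <= j < K) sqmod (geo j u).
Proof.
move=> u1 K0 /(far_from_geo K0) h; have K0R : 0 < K%:R :> R by rewrite ltr0n.
have h1 : K%:R ^+ 2 / 4 <= K%:R * \sum_(0 <= j < K) sqmod (1 - u ^+ j).
  have -> : \sum_(0 <= j < K) sqmod (1 - u ^+ j) =
     \sum_(0 <= j < K) normc (1 - u ^+ j) ^+ 2.
    by apply: eq_bigr => j _; rewrite sqmod_normc.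
  apply: le_trans (sqr_sum_le _ _).
  have -> : K%:R ^+ 2 / 4 = (K%:R / 2) ^+ 2 :> R by field.
  rewrite ler_pXn2r ?nnegrE ?divr_ge0//; first exact: le_trans (normc_sum _ _).
  by rewrite sumr_ge0// => i _; exact: normc_ge0.
have h2 : K%:R / 4 <= \sum_(0 <= j < K) sqmod (1 - u ^+ j).
  by rewrite -(@ler_pM2l _ K%:R)//; move: h1; rewrite expr2; lra.
have h3 : K%:R / 4 * sqmod (geo m u) <= 4 * \sum_(0 <= j < K) sqmod (geo j u).
  apply: (le_trans (ler_wpM2r (sqmod_ge0 _) h2)).
  rewrite mulr_suml mulr_sumr; apply: ler_sum => j _.
  rewrite -sqmodM.
  have -> : (1 - u ^+ j) * geo m u = (1 - u ^+ m) * geo j u.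
    by rewrite -!geoM; ring.
  by rewrite sqmodM ler_wpM2r ?sqmod_ge0// sqmod_sub1X.
rewrite mulrAC ler_pdivlMr//; lra.
Qed.

Lemma lnorm1_bound p : exists N0 : nat, forall x, x \in p -> (`|x.2| <= N0)%N.
Proof.
exists (\max_(x <- p) `|x.2|%N) => x xp.
by rewrite (big_rem x xp) /= leq_maxl.
Qed.

Lemma parseval_large p : exists N0 : nat, forall N w, (N0 <= N)%N ->
  N.-primitive_root w -> norm2c p = avg N w (fun z => sqmod (ev p z)).
Proof.
have [M MP] := lnorm1_bound p; exists (M + M).+1 => N w NM Nw.
apply: parseval => //; first exact: leq_trans NM.
have h (a b : int) : (`|a| <= M -> `|b| <= M -> `|(a - b)%R| < N)%N by lia.
by move=> x y /MP xM /MP yM; exact: h.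
Qed.

Lemma avg_geo j D : (0 < D)%N -> exists N0 : nat, forall N w, (N0 <= N)%N ->
  N.-primitive_root w -> avg N w (fun z => sqmod (geo j (z ^+ D))) = j%:R.
Proof.
move=> D0; pose p : seq (R * int) := [seq (1, (D * a)%:Z) | a <- iota 0 j].
have [N0 NP] := parseval_large p; exists N0 => N w /NP /[apply].
have -> : norm2c p = j%:R.
  rewrite /norm2c /lform big_map (eq_big_seq (fun=> 1)).
    by rewrite big_const_seq count_predT size_iota iter_addr_0.
  move=> a aj; rewrite big_map (bigD1_seq a) ?iota_uniq//= big1 ?addr0.
    by rewrite subrr /kron eqxx !mulr1.
  move=> b ba; rewrite /kron subr_eq0 eqz_nat eqn_pmul2l// eq_sym (negPf ba).
  by rewrite mulr0.
move=> ->; apply: eq_bigr => i _ || congr (_ * _); apply: eq_bigr => i _.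
congr sqmod; rewrite /ev big_map /geo /index_iota subn0.
by apply: eq_bigr => a _; rewrite /= mul1r -exprM.
Qed.

End geometric_sums.

(** * One-sided and flat trigonometric polynomials *)

Section one_sided_polynomials.
Local Open Scope complex_scope.
Variable R : realType.
Implicit Types (p q : seq (R * int)) (z w u : R[i]).
Local Notation normc := ComplexField.Normc.normc.

(** Stands for an upper bound on the integral of F over the circle. It is also applied to indicator
    functions, for which no single N gives the exact mean. *)
Definition mean_le (F : R[i] -> R) (c : R) := exists N0 : nat, forall N w,
  (N0 <= N)%N -> N.-primitive_root w -> avg N w F <= c.

Lemma mean_le_mono F G c d : (forall z, unimod z -> F z <= G z) -> c <= d ->
  mean_le G c -> mean_le F d.
Proof.
move=> FG cd [N0 h]; exists N0 => N w NN Nw.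
apply: le_trans (le_trans (h N w NN Nw) cd); apply: avg_le => //.
exact: prim_unimod (prim_order_gt0 Nw) Nw.
Qed.

Lemma mean_leD F G c d : mean_le F c -> mean_le G d ->
  mean_le (fun z => F z + G z) (c + d).
Proof.
move=> [N0 h] [N1 k]; exists (N0 + N1)%N => N w NN Nw.
rewrite avgD lerD// ?h ?k//; [exact: leq_trans (leq_addr _ _) NN|].
exact: leq_trans (leq_addl _ _) NN.
Qed.

Lemma mean_leZ F c a : 0 <= a -> mean_le F c -> mean_le (fun z => a * F z) (a * c).
Proof.
by move=> a0 [N0 h]; exists N0 => N w NN Nw; rewrite avgZ ler_wpM2l// h.
Qed.

Lemma mean_le_cst a : mean_le (fun=> a) a.
Proof. by exists 0%N => N w _ Nw; rewrite avg_cst// (prim_order_gt0 Nw). Qed.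

Lemma mean_le_sum (n : nat) (F : nat -> R[i] -> R) (c : nat -> R) :
  (forall i, mean_le (F i) (c i)) ->
  mean_le (fun z => \sum_(0 <= i < n) F i z) (\sum_(0 <= i < n) c i).
Proof.
move=> h; elim: n => [|n IH].
  apply: mean_le_mono (mean_le_cst 0); first by move=> z _; rewrite big_nil.
  by rewrite big_nil.
apply: mean_le_mono (mean_leD IH (h n)); last by rewrite big_nat_recr.
by move=> z _; rewrite big_nat_recr.
Qed.

Lemma mean_le_geo j D : (0 < D)%N ->
  mean_le (fun z => sqmod (geo j (z ^+ D))) j%:R.
Proof.
by move=> D0; have [N0 h] := @avg_geo R j D D0; exists N0 => N w NN Nw; rewrite h.
Qed.

Lemma norm2c_le p F c : (forall z, unimod z -> sqmod (ev p z) <= F z) ->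
  mean_le F c -> norm2c p <= c.
Proof.
move=> pF [N0 h]; have [N1 k] := @parseval_large R p.
have [w Nw] := @prim_root_exists R (N0 + N1).+1 isT.
rewrite (k _ w _ Nw); last by rewrite -addnS; lia.
apply: le_trans (h _ _ _ Nw); last lia.
by apply: avg_le => //; exact: prim_unimod Nw.
Qed.

Lemma norm2c_ge0 p : 0 <= norm2c p.
Proof.
have [N1 k] := @parseval_large R p.
have [w Nw] := @prim_root_exists R N1.+1 isT.
by rewrite (k _ w _ Nw)// avg_ge0// => z; exact: sqmod_ge0.
Qed.

Definition ldil (D : nat) p : seq (R * int) := [seq (x.1, D%:Z * x.2) | x <- p].

Lemma ev_dil D p z : ev (ldil D p) z = ev p (z ^+ D).
Proof.
by rewrite /ev big_map; apply: eq_bigr => x _; rewrite /= exprnP exprz_exp.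
Qed.

Lemma lnorm1_dil D p : lnorm1 (ldil D p) = lnorm1 p.
Proof. by rewrite /lnorm1 big_map. Qed.

Section one_sided.
Variable m : nat.
Hypothesis m0 : (0 < m)%N.

(** Twice the positive-frequency half of the Fejer kernel, so that on the circle 1 plus its real
    part is that kernel. *)
Definition fejer_analytic : seq (R * int) :=
  [seq (2 / m%:R, (a - b)%N%:Z) | a <- index_iota 0 m, b <- index_iota 0 a].

Lemma fejer_analytic_pos x : x \in fejer_analytic -> 0 < x.2.
Proof.
move=> /allpairsPdep[a [b [_]]]; rewrite mem_index_iota => /andP[_ ba] -> /=.
by rewrite ltz_nat subn_gt0.
Qed.

Lemma ev_fejer_analytic u : ev fejer_analytic u =
  (2 / m%:R)%:C * \sum_(0 <= a < m) \sum_(0 <= b < a) u ^+ (a - b).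
Proof.
rewrite /ev big_allpairs_dep mulr_sumr; apply: eq_bigr => a _.
by rewrite mulr_sumr.
Qed.

Lemma sqmod_add z w : sqmod (z + w) = sqmod z + sqmod w + 2 * complex.Re (z * conjc w).
Proof. by case: z w => [a b] [c d]; rewrite /sqmod /=; ring. Qed.

Lemma Re_scale (a : R) z : complex.Re (a%:C * z) = a * complex.Re z.
Proof. by case: z => c d /=; rewrite mul0r subr0. Qed.

Lemma sqmod_geo_Re n u : unimod u -> sqmod (geo n u) =
  n%:R + 2 * complex.Re (\sum_(0 <= a < n) \sum_(0 <= b < a) u ^+ (a - b)).
Proof.
move=> u1; elim: n => [|n IH].
  by rewrite /geo !big_nil sqmod0 /= mulr0 addr0.
rewrite geoS addrC sqmod_add IH big_nat_recr//= (unimodX n u1).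
have -> : u ^+ n * conjc (geo n u) = \sum_(0 <= b < n) u ^+ (n - b).
  rewrite /geo rmorph_sum /= mulr_sumr.
  apply: eq_big_nat => b /andP[_ bn].
  rewrite rmorphXn /= (unimod_conj u1) exprVn.
  have ub : u ^+ b != 0 by rewrite expf_neq0// unimod_neq0.
  by apply: (mulIf ub); rewrite mulfVK// -exprD subnK// ltnW.
set S := \sum_(0 <= _ < n) \sum_(0 <= b < _) _.
set T := \sum_(0 <= _ < n) _.
have -> : complex.Re (S + T) = complex.Re S + complex.Re T.
  by case: S T => [a b] [c d].
by rewrite -natr1; ring.
Qed.

Lemma Re_fejer_analytic u : unimod u ->
  1 + complex.Re (ev fejer_analytic u) = m%:R^-1 * sqmod (geo m u).
Proof.
move=> u1; rewrite ev_fejer_analytic Re_scale sqmod_geo_Re//.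
have m0R : m%:R != 0 :> R by rewrite pnatr_eq0 -lt0n.
by field.
Qed.

Lemma sqmod_fejer_analytic u : unimod u ->
  sqmod (ev fejer_analytic u) <= 4 * m%:R ^+ 2.
Proof.
move=> u1; have m0R : 0 < m%:R :> R by rewrite ltr0n.
have h : normc (\sum_(0 <= a < m) \sum_(0 <= b < a) u ^+ (a - b)) <= m%:R * m%:R.
  apply: (le_trans (normc_sum _ _)).
  apply: (@le_trans _ _ (\sum_(0 <= a < m) m%:R)); last first.
    by rewrite sumr_const_nat subn0 mulr_natl.
  rewrite big_nat [X in _ <= X]big_nat; apply: ler_sum => a /andP[_ am].
  apply: (le_trans (normc_sum _ _)); rewrite (eq_bigr (fun=> 1)).
    by rewrite sumr_const_nat subn0 ler_nat ltnW.
  by move=> b _; rewrite normc_unimod//; exact: unimodX.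
rewrite ev_fejer_analytic sqmodM sqmodC sqmod_normc.
have -> : 4 * m%:R ^+ 2 = (2 / m%:R) ^+ 2 * (m%:R * m%:R) ^+ 2 :> R.
  by field; rewrite gt_eqF.
rewrite ler_wpM2l ?sqr_ge0// ler_pXn2r ?nnegrE ?normc_ge0// mulr_ge0// ltW//.
Qed.

End one_sided.

(** This is 1 - (1 + e y)^n, expanded so that no constant term is ever created: positivity of the
    frequencies is checked on list entries, where cancellation is invisible. *)
Fixpoint one_sided_approx (e : R) (y : seq (R * int)) (n : nat) : seq (R * int) :=
  if n is k.+1 then one_sided_approx e y k ++ lscale (- e) y ++
    lscale e (lmul (one_sided_approx e y k) y) else [::].

Lemma one_sided_approx_pos e y n : (forall x, x \in y -> 0 < x.2) ->
  forall x, x \in one_sided_approx e y n -> 0 < x.2.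
Proof.
move=> y0; elim: n => [//|n IH] x /=; rewrite !mem_cat => /or3P[/IH//| |].
  by move=> /mapP[a /y0 a0 ->].
move=> /mapP[a /allpairsP[[b c] /= [/IH b0 /y0 c0 ->] ->]] /=.
exact: addr_gt0.
Qed.

Lemma ev_one_sided_approx e y n z : z != 0 ->
  1 - ev (one_sided_approx e y n) z = (1 + e%:C * ev y z) ^+ n.
Proof.
move=> z0; elim: n => [|n IH] /=; first by rewrite /ev big_nil subr0 expr0.
rewrite exprS -IH !ev_cat !ev_scale ev_mul// rmorphN /=; ring.
Qed.

(* The Fejer kernel |geo m|^2 / m = 1 + Re y is at most 1/2 off a small arc,
   so |1 + e y| < 1 there for small e, and 1 - (1 + e y)^n tends to 1. *)
Lemma one_sided (eta d : R) : 0 < eta -> 0 < d -> exists P : seq (R * int),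
  (forall x, x \in P -> 0 < x.2) /\
  forall D, (0 < D)%N ->
    mean_le (fun z => (d < sqmod (1 - ev P (z ^+ D)))%R%:R) eta.
Proof.
move=> eta0 d0; have [K [K0 KP]] := large_nat (4 / eta).
have K0R : 0 < K%:R :> R by rewrite ltr0n.
pose m := (32 * K ^ 2)%N.
have m0 : (0 < m)%N by rewrite muln_gt0 expn_gt0 K0.
have m1 : 1 <= m%:R :> R by rewrite ler1n.
(* |1 + e y|^2 = 1 + 2 e Re y + e^2 |y|^2, where Re y <= -1/2 off the arc and |y|^2 <= 4 m^2. This e
   makes the last term at most e/2, hence the sum at most 1 - e/2. *)
pose e : R := (8 * m%:R ^+ 2)^-1.
have e0 : 0 < e by rewrite invr_gt0 mulr_gt0// exprn_gt0// ltr0n.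
have e8 : e * (8 * m%:R ^+ 2) = 1.
  by rewrite mulVf// mulf_neq0 ?expf_neq0 ?gt_eqF// ltr0n.
have m2 : 1 <= m%:R ^+ 2 :> R by rewrite exprn_ege1.
have e1 : 0 < e / 2 <= 1 by apply/andP; split; nra.
have [n nP] := small_pow e1 d0.
exists (one_sided_approx e (fejer_analytic m) n); split.
  exact/one_sided_approx_pos/fejer_analytic_pos.
move=> D D0.
(* Chebyshev: on the exceptional arc [sqmod (geo K u)] exceeds K^2/4, while its mean is K. *)
apply: (@mean_le_mono _ (fun z => 4 / K%:R ^+ 2 * sqmod (geo K (z ^+ D)))
   (4 / K%:R ^+ 2 * K%:R)); last first.
- by apply: mean_leZ (mean_le_geo K D0); rewrite divr_ge0// sqr_ge0.
- have -> : 4 / K%:R ^+ 2 * K%:R = 4 / K%:R :> R by field; rewrite gt_eqF.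
  by rewrite ler_pdivrMr// mulrC -ler_pdivrMr.
move=> z z1; set u := z ^+ D; have u1 : unimod u by exact: unimodX.
have [far|near] := leP (sqmod (geo K u)) (K%:R ^+ 2 / 4); last first.
  apply: (@le_trans _ _ 1); first by case: (_ < _).
  by rewrite mulrAC ler_pdivlMr ?exprn_gt0// mul1r; lra.
rewrite ltNge; suff -> : sqmod (1 - ev (one_sided_approx e (fejer_analytic m) n) u) <= d.
  by rewrite mulr_ge0 ?sqmod_ge0// divr_ge0// sqr_ge0.
rewrite ev_one_sided_approx ?unimod_neq0// sqmodX (le_trans _ nP)//.
apply: lerXn2r; rewrite ?nnegrE ?sqmod_ge0//.
  by have /andP[_ ?] := e1; rewrite subr_ge0.
rewrite addrC sqmod_add sqmod1 rmorph1 mulr1 Re_scale sqmodM sqmodC.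
have := geo_small1 u1 K0 (leqnn _) far; rewrite -Re_fejer_analytic// => F2.
have := sqmod_fejer_analytic m0 u1.
set y := complex.Re _ in F2 *; set s := sqmod _ => sm.
have : e ^+ 2 * s <= e / 2.
  have -> : e / 2 = e ^+ 2 * (4 * m%:R ^+ 2).
    by rewrite -[e / 2]mulr1 -{2}e8; field.
  by rewrite ler_wpM2l// sqr_ge0.
nra.
Qed.

End one_sided_polynomials.

(** * Averages of Fejer kernels over lacunary scales, and flat one-sided polynomials *)

Section flat_polynomials.
Local Open Scope complex_scope.
Variable R : realType.
Implicit Types (p q : seq (R * int)) (z w u : R[i]).
Local Notation normc := ComplexField.Normc.normc.

(* Frequencies may occur several times in a list, so the size of a coefficient
   is the total mass at its frequency. *)
Definition coef_le p (s : R) :=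
  forall n : int, \sum_(x <- p | x.2 == n) `|x.1| <= s.

Lemma coef_le_mul p q s : coef_le q s -> coef_le (lmul p q) (lnorm1 p * s).
Proof.
move=> qs n; rewrite big_mkcond /=.
rewrite [X in X <= _](big_lmul (fun a k => if k == n then `|a| else 0)).
rewrite /lnorm1 mulr_suml; apply: ler_sum => x _.
apply: le_trans (ler_wpM2l (normr_ge0 _) (qs (n - x.2))).
rewrite mulr_sumr [X in _ <= X]big_mkcond /=; apply: ler_sum => y _.
rewrite [y.2 == _]eq_sym subr_eq eq_sym [y.2 + _]addrC.
by case: eqP => // _; rewrite normrM.
Qed.

Lemma sum_unique_le (T : eqType) (s : seq T) (P : pred T) (c : R) : 0 <= c ->
  uniq s -> (forall x y, x \in s -> y \in s -> P x -> P y -> x = y) ->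
  \sum_(x <- s | P x) c <= c.
Proof.
move=> c0 us uP; have [/hasP[x xs Px]|/hasPn h] := boolP (has P s); last first.
  rewrite big_seq_cond big1// => x /andP[xs Px]; by have := h x xs; rewrite Px.
rewrite -big_filter (bigD1_seq x) ?mem_filter ?Px ?filter_uniq//=.
rewrite big_seq_cond big1 ?addr0// => y.
by rewrite mem_filter => /andP[/andP[Py ys]] /eqP[]; exact: uP.
Qed.

Section averaged.
Variables (m B : nat).
Hypotheses (m1 : (1 < m)%N) (B0 : (0 < B)%N).

Definition off_diag : seq (nat * nat) :=
  [seq ab <- [seq (a, b) | a <- index_iota 0 m, b <- index_iota 0 m] | ab.1 != ab.2].

(** One minus the average of the Fejer kernels in z^(m^i), i < B; the constant terms cancel.
    Averaging over B scales with disjoint frequencies divides the coefficients by B. *)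
Definition fejer_average : seq (R * int) :=
  [seq (- (B%:R * m%:R)^-1, (ab.1%:Z - ab.2%:Z) * (m ^ i)%N%:Z) |
     i <- index_iota 0 B, ab <- off_diag].

Lemma fejer_average_bound x : x \in fejer_average -> (`|x.2| < m ^ B)%N.
Proof.
move=> /allpairsP[[i [a b]] /= [+ + ->]] /=.
rewrite mem_index_iota mem_filter => /= iB /andP[_ /allpairsP[[c d] /= [+ + [-> ->]]]].
rewrite !mem_index_iota => /= cm dm.
rewrite abszM absz_nat.
have h : (`|(c%:Z - d%:Z)%R| < m)%N by lia.
have mi : (0 < m ^ i)%N by rewrite expn_gt0 (ltnW m1).
apply: (@leq_trans (m * m ^ i)); first by rewrite ltn_pmul2r.
by rewrite -expnS leq_pexp2l// ltnW.
Qed.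

Lemma big_off_diag (W : nmodType) (F : nat -> nat -> W) :
  \sum_(ab <- off_diag) F ab.1 ab.2 =
  \sum_(0 <= a < m) \sum_(0 <= b < m | a != b) F a b.
Proof.
rewrite big_filter big_mkcond big_allpairs_dep; apply: eq_bigr => a _.
by rewrite [RHS]big_mkcond.
Qed.

Let mR : 0 < m%:R :> R. Proof. by rewrite ltr0n ltnW. Qed.
Let BR : 0 < B%:R :> R. Proof. by rewrite ltr0n. Qed.

Lemma lnorm1_fejer_average : lnorm1 fejer_average <= m%:R.
Proof.
rewrite /lnorm1 big_allpairs_dep.
apply: (@le_trans _ _ (\sum_(0 <= i < B) \sum_(0 <= a < m) \sum_(0 <= b < m)
   (B%:R * m%:R)^-1)).
  apply: ler_sum => i _ /=.
  rewrite (big_off_diag (fun _ _ => `|- (B%:R * m%:R)^-1|)).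
  apply: ler_sum => a _; rewrite big_mkcond /=; apply: ler_sum => b _.
  by rewrite normrN ger0_norm ?invr_ge0 ?mulr_ge0 ?(ltW mR) ?(ltW BR)//; case: (_ != _); rewrite // invr_ge0 mulr_ge0 ?(ltW mR) ?(ltW BR).
rewrite !sumr_const_nat !subn0 -!mulrnA -[X in X <= _]mulr_natl !natrM.
rewrite le_eqVlt; apply/orP; left; apply/eqP; field.
by rewrite !gt_eqF.
Qed.

(** If i < i', then |a - b| would be a nonzero multiple of m, although it is below m. *)
Lemma separated_digits (a b b' i i' : nat) : (a < m)%N -> (b < m)%N -> (b' < m)%N ->
  a != b -> a != b' ->
  (a%:Z - b%:Z) * (m ^ i)%N%:Z = (a%:Z - b'%:Z) * (m ^ i')%N%:Z ->
  i = i' /\ b = b'.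
Proof.
wlog ii' : b b' i i' / (i <= i')%N.
  move=> hw am bm b'm ab ab' e; have [?|/ltnW ?] := leqP i i'; first exact: hw.
  by have [] := hw b' b i' i _ am b'm bm ab' ab (esym e).
move=> am bm b'm ab ab'; rewrite -(subnK ii') expnD PoszM mulrA.
have mi : (m ^ i)%N%:Z != 0 by rewrite eqz_nat -lt0n expn_gt0 (ltnW m1).
move=> /(mulIf mi); case: (i' - i)%N => [|k].
  by rewrite mulr1 => /addrI /oppr_inj [->].
rewrite expnS; move=> e; exfalso.
have : `|(a%:Z - b%:Z)%R|%N = (`|(a%:Z - b'%:Z)%R| * (m * m ^ k))%N.
  by rewrite e abszM absz_nat.
have h1 : (`|(a%:Z - b%:Z)%R| < m)%N by lia.
have h2 : (0 < `|(a%:Z - b'%:Z)%R|)%N by lia.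
have h3 : (0 < m ^ k)%N by rewrite expn_gt0 (ltnW m1).
move=> e2; move: h1; rewrite e2 ltnNge => /negP; apply.
by rewrite mulnCA leq_pmulr// muln_gt0 h2.
Qed.

(** For each of the m values of a, at most one pair (i, b) yields the frequency n, and each entry
    has size 1/(B m). *)
Lemma coef_fejer_average : coef_le fejer_average B%:R^-1.
Proof.
move=> n; rewrite big_mkcond /= big_allpairs_dep /=.
pose c : R := (B%:R * m%:R)^-1.
have c0 : 0 <= c by rewrite invr_ge0 mulr_ge0 ?(ltW mR) ?(ltW BR).
under eq_bigr => i _ do rewrite (big_off_diag (fun a b =>
   if (a%:Z - b%:Z) * (m ^ i)%N%:Z == n then `|- c| else 0)).
rewrite exchange_big /=.
apply: (@le_trans _ _ (\sum_(0 <= a < m) c)); last first.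
  rewrite sumr_const_nat subn0 -mulr_natl /c le_eqVlt; apply/orP; left; apply/eqP.
  by field; rewrite !gt_eqF.
rewrite big_nat [X in _ <= X]big_nat; apply: ler_sum => a /andP[_ am].
pose P (x : nat * nat) := (a != x.2) && ((a%:Z - x.2%:Z) * (m ^ x.1)%N%:Z == n).
have -> : \sum_(0 <= i < B) \sum_(0 <= b < m | a != b)
    (if (a%:Z - b%:Z) * (m ^ i)%N%:Z == n then `|- c| else 0) =
  \sum_(x <- [seq (i, b) | i <- index_iota 0 B, b <- index_iota 0 m] | P x) c.
  rewrite [RHS]big_mkcond big_allpairs_dep; apply: eq_bigr => i _.
  rewrite [LHS]big_mkcond /=; apply: eq_bigr => b _; rewrite /P /= normrN ger0_norm//.
  by case: (a != b).
apply: sum_unique_le => //.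
  by apply: allpairs_uniq; rewrite ?iota_uniq// => -[? ?] [? ?] _ _ [-> ->].
move=> x y /allpairsP[[i b] /= [_ + ->]] /allpairsP[[i' b'] /= [_ + ->]].
rewrite !mem_index_iota /P /= => bm b'm /andP[ab /eqP e] /andP[ab' /eqP e'].
by have [-> ->] := separated_digits am bm b'm ab ab' (etrans e (esym e')).
Qed.

Lemma geo_off_diag u : unimod u ->
  \sum_(0 <= a < m) \sum_(0 <= b < m | a != b) u ^ (a%:Z - b%:Z) =
  (sqmod (geo m u) - m%:R)%:C.
Proof.
move=> u1; rewrite rmorphB /= geo_pairs//.
have -> : m%:R%:C = \sum_(0 <= a < m) (1 : R[i]).
  by rewrite sumr_const_nat subn0 rmorph_nat.
rewrite -sumrB; apply: eq_big_nat => a am.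
rewrite [in RHS](bigD1_seq a) ?mem_index_iota ?iota_uniq//=.
rewrite subrr expr0z addrAC subrr add0r; apply: eq_bigl => b.
by rewrite eq_sym.
Qed.

Lemma ev_fejer_average z : unimod z -> 1 - ev fejer_average z =
  (\sum_(0 <= i < B) (B%:R * m%:R)^-1 * sqmod (geo m (z ^+ (m ^ i))))%:C.
Proof.
move=> z1; rewrite /ev big_allpairs_dep /=.
pose c : R := (B%:R * m%:R)^-1.
have -> : \sum_(0 <= i < B) \sum_(ab <- off_diag)
   (- c)%:C * z ^ ((ab.1%:Z - ab.2%:Z) * (m ^ i)%N%:Z) =
   \sum_(0 <= i < B) (- c * (sqmod (geo m (z ^+ (m ^ i))) - m%:R))%:C.
  apply: eq_bigr => i _; rewrite -mulr_sumr rmorphM /=; congr (_ * _).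
  rewrite (big_off_diag (fun a b => z ^ ((a%:Z - b%:Z) * (m ^ i)%N%:Z))).
  rewrite -(geo_off_diag (unimodX _ z1)); apply: eq_bigr => a _.
  by apply: eq_bigr => b _; rewrite exprnP exprz_exp mulrC.
rewrite -rmorph_sum -(rmorph1 (real_complex R)) -rmorphB /=; congr _%:C.
have -> : \sum_(0 <= i < B) - c * (sqmod (geo m (z ^+ (m ^ i))) - m%:R) =
   \sum_(0 <= i < B) (c * m%:R - c * sqmod (geo m (z ^+ (m ^ i)))).
  by apply: eq_bigr => i _; ring.
rewrite sumrB sumr_const_nat subn0 -[_ *+ B]mulr_natl opprB addrC -addrA.
rewrite [X in _ + X](_ : _ = 0) ?addr0// /c addrC; apply/eqP; rewrite subr_eq0.
by apply/eqP; field; rewrite !gt_eqF.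
Qed.

(** Either [geo K] is large at one of the B scales, which by Chebyshev has measure at most 4 B / K,
    or [geo_small2] applies at every scale and Markov's inequality gives the second term. *)
Lemma fejer_average_mean K (d : R) : (0 < K)%N -> 0 < d ->
  mean_le (fun z => (d ^+ 2 < sqmod (1 - ev fejer_average z))%R%:R)
    (4 * B%:R / K%:R + 16 * K%:R / (d * m%:R)).
Proof.
move=> K0 d0; have K0R : 0 < K%:R :> R by rewrite ltr0n.
pose c1 : R := 4 / K%:R ^+ 2; pose c2 : R := 16 / (d * B%:R * m%:R * K%:R).
have c10 : 0 <= c1 by rewrite divr_ge0// sqr_ge0.
have c20 : 0 <= c2.
  by rewrite divr_ge0// !mulr_ge0// ?(ltW d0) ?(ltW BR) ?(ltW mR) ?(ltW K0R).
pose G1 z := c1 * \sum_(0 <= i < B) sqmod (geo K (z ^+ (m ^ i))).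
pose G2 z := c2 * \sum_(0 <= i < B) \sum_(0 <= j < K) sqmod (geo j (z ^+ (m ^ i))).
have mi i : (0 < m ^ i)%N by rewrite expn_gt0 (ltnW m1).
apply: (@mean_le_mono _ _ (fun z => G1 z + G2 z)
  (c1 * \sum_(0 <= i < B) K%:R + c2 * \sum_(0 <= i < B) \sum_(0 <= j < K) K%:R)).
- move=> z z1.
  have G10 : 0 <= G1 z.
    by rewrite mulr_ge0// sumr_ge0// => i _; exact: sqmod_ge0.
  have G20 : 0 <= G2 z.
    rewrite mulr_ge0// sumr_ge0// => i _; rewrite sumr_ge0// => j _.
    exact: sqmod_ge0.
  have [|] := boolP (has (fun i => K%:R ^+ 2 / 4 < sqmod (geo K (z ^+ (m ^ i)))) (index_iota 0 B)).
    move=> /hasP[i iB /= hi]; apply: (@le_trans _ _ 1); first by case: (_ < _).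
    suff : 1 <= G1 z by move: G20; lra.
    rewrite /G1 (bigD1_seq i) ?iota_uniq//= mulrDr.
    apply: (@le_trans _ _ (c1 * sqmod (geo K (z ^+ (m ^ i))))); last first.
      by rewrite lerDl mulr_ge0// sumr_ge0// => j _; exact: sqmod_ge0.
    by rewrite /c1 mulrAC ler_pdivlMr ?exprn_gt0// mul1r; move: hi; lra.
  move=> /hasPn /= far; have [|_] := ltP (d ^+ 2); last exact: addr_ge0.
  rewrite ev_fejer_average// sqmodC; set H := \sum_(_ <= _ < _) _.
  have H0 : 0 <= H.
    rewrite sumr_ge0// => i _; by rewrite mulr_ge0 ?sqmod_ge0 ?invr_ge0 ?mulr_ge0.
  rewrite ltr_pXn2r ?nnegrE ?(ltW d0)// => dH.
  suff : 1 <= G2 z by move=> /le_trans; apply; rewrite lerDr.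
  have : H <= d * G2 z.
    rewrite /H /G2 !mulr_sumr big_nat [X in _ <= X]big_nat; apply: ler_sum => i iB.
    have := @geo_small2 R K m (z ^+ (m ^ i)) (unimodX _ z1) K0.
    have := far i; rewrite mem_index_iota -leNgt => /(_ iB) fi /(_ fi) h.
    apply: (le_trans (ler_wpM2l _ h)).
      by rewrite invr_ge0 mulr_ge0 ?(ltW mR) ?(ltW BR).
    rewrite !mulrA le_eqVlt; apply/orP; left; apply/eqP; congr (_ * _).
    by rewrite /c2; field; rewrite !gt_eqF.
  by move=> /(lt_le_trans dH); rewrite -{1}[d]mulr1 ltr_pM2l// => /ltW.
- rewrite !sumr_const_nat !subn0 -[K%:R *+ K]mulr_natl -[K%:R *+ B]mulr_natl -[(_ * _) *+ B]mulr_natl.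
  rewrite /c1 /c2 le_eqVlt; apply/orP; left; apply/eqP.
  by field; rewrite !gt_eqF.
apply: mean_leD; apply: mean_leZ => //; apply: mean_le_sum => i.
  exact: mean_le_geo.
apply: (@mean_le_mono _ _ (fun z => \sum_(0 <= j < K) sqmod (geo j (z ^+ (m ^ i))))
   (\sum_(0 <= j < K) j%:R)) => //.
  by rewrite big_nat [X in _ <= X]big_nat; apply: ler_sum => j /andP[_ jK]; rewrite ler_nat ltnW.
by apply: mean_le_sum => j; exact: mean_le_geo.
Qed.

End averaged.

Lemma exists_le_natinv (C : R) (e : R) : 0 < e -> exists b, (1 < b)%N /\ C / b%:R <= e.
Proof.
move=> e0; have [b [b0 bP]] := large_nat (C / e); exists b.+1; split=> //.
rewrite ler_pdivrMr ?ltr0n// mulrC -ler_pdivrMr// (le_trans bP)//.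
by rewrite ler_nat.
Qed.

Lemma sqmod_sub1M (p a : R[i]) (d d1 d2 : R) : sqmod (1 - p) <= d1 ->
  sqmod (1 - a) <= d2 ^+ 2 -> 0 <= d2 -> d1 <= 1 -> d1 <= d / 4 ->
  d2 <= 1 -> d2 <= d / 16 -> sqmod (1 - p * a) <= d.
Proof.
move=> h1 h2 d20 d11 d14 d21 d216.
have -> : 1 - p * a = (1 - p) + p * (1 - a) by ring.
apply: (le_trans (sqmodD _ _)); rewrite sqmodM.
have p4 : sqmod p <= 4.
  have -> : p = 1 + - (1 - p) by ring.
  apply: (le_trans (sqmodD _ _)); rewrite sqmod1 sqmodN; lra.
have := sqmod_ge0 p; have := sqmod_ge0 (1 - a); nra.
Qed.

Lemma dominant_pos (D : nat) (t v : int) : 0 < t -> (`|v| < D)%N -> 0 < D%:Z * t + v.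
Proof.
move=> t0 vD; have : D%:Z <= D%:Z * t by rewrite ler_peMr.
lia.
Qed.

(* Flatness is recorded through s so that, by interpolation, the l^q norm to
   the power q is at most s^(k+2) T whenever q >= 2 + 1/(k+1). *)
Definition flat p (k : nat) (e : R) := exists s T : R,
  [/\ 0 < s <= 1, coef_le p (s ^+ k.+1), lnorm1 p <= T & s ^+ k.+2 * T <= e].

(* P(z^D) is one-sided but has large coefficients; multiplying by the flat
   two-sided A spreads each of them without leaving positive frequencies. *)
Lemma flat_one_sided k (e d : R) : 0 < e -> 0 < d -> exists Q : seq (R * int),
  [/\ forall x, x \in Q -> 0 < x.2, flat Q k e &
    mean_le (fun z => (d < sqmod (1 - ev Q z))%R%:R) e].
Proof.
move=> e0 d0; pose d1 := Num.min 1 (d / 4); pose d2 := Num.min 1 (d / 16).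
have d10 : 0 < d1 by rewrite lt_min ltr01 divr_gt0.
have d20 : 0 < d2 by rewrite lt_min ltr01 divr_gt0.
have [P [P0 PP]] := @one_sided R (e / 2) d1 (divr_gt0 e0 (ltr0Sn _ _)) d10.
pose L := 1 + lnorm1 P.
have L1 : 1 <= L by rewrite lerDl lnorm1_ge0.
have e4 : 0 < e / 4 by rewrite divr_gt0.
have [k0 [k00 k0P]] := exists_le_natinv 4 e4.
have [k1 [k10 k1P]] := exists_le_natinv (16 / d2) e4.
have me0 : 0 < Num.min 1 e by rewrite lt_min ltr01.
(* The flatness data will be s = L/b and T = L m with B = b^(k+1) and m = k1 k0 B, so that s^(k+2) T
   = L^(k+3) k1 k0 / b; the extra summand L gives s <= 1. The factors k0 and k1 make each term of
   [fejer_average_mean] at most e/4. *)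
have [b [b0 bP]] := exists_le_natinv (L ^+ k.+3 * (k1 * k0)%:R + L) me0.
pose B := (b ^ k.+1)%N; pose K := (k0 * B)%N; pose m := (k1 * K)%N.
have B0 : (0 < B)%N by rewrite expn_gt0 (ltnW b0).
have K0 : (0 < K)%N by rewrite muln_gt0 (ltnW k00).
have m1 : (1 < m)%N by rewrite (leq_trans k10)// leq_pmulr.
have bR : 0 < b%:R :> R by rewrite ltr0n ltnW.
have k0R : 0 < k0%:R :> R by rewrite ltr0n ltnW.
have k1R : 0 < k1%:R :> R by rewrite ltr0n ltnW.
have BR : 0 < B%:R :> R by rewrite ltr0n.
have L0 : 0 < L by rewrite (lt_le_trans ltr01).
have LP : lnorm1 P <= L by rewrite lerDr.
(* The frequencies of A are below m^B in modulus, so dilating P by this D keeps the product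
   one-sided. *)
pose A := fejer_average m B; pose D := (m ^ B)%N.
have D0 : (0 < D)%N by rewrite expn_gt0 (ltnW m1).
exists (lmul (ldil D P) A); split.
- move=> x /allpairsP[[y v] /= [/mapP[y' /P0 y0 ->] /(fejer_average_bound m1) vD' ->]] /=.
  exact: (dominant_pos y0 (vD' B0)).
- have bmax : (L ^+ k.+3 * (k1 * k0)%:R) / b%:R + L / b%:R <= Num.min 1 e.
    by rewrite -mulrDl.
  have t1 : 0 <= L ^+ k.+3 * (k1 * k0)%:R / b%:R.
    by rewrite divr_ge0 ?(ltW bR)// mulr_ge0// exprn_ge0// ltW.
  have t2 : 0 < L / b%:R by rewrite divr_gt0.
  move: bmax; rewrite le_min => /andP[bm1 bm2].
  exists (L / b%:R), (L * m%:R); split.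
  + by apply/andP; split=> //; lra.
  + move=> n; apply: (le_trans (coef_le_mul _ (coef_fejer_average m1 B0) n)).
    rewrite lnorm1_dil exprMn exprVn /B natrX ler_wpM2r ?invr_ge0 ?exprn_ge0 ?(ltW bR)//.
    by apply: (le_trans LP); rewrite exprS ler_peMr ?(ltW L0)// exprn_ege1.
  + rewrite lnorm1_mul lnorm1_dil ler_pM ?lnorm1_ge0//.
    exact: lnorm1_fejer_average.
  + apply: le_trans bm2; apply: le_trans (_ : L ^+ k.+3 * (k1 * k0)%:R / b%:R <= _); last lra.
    rewrite le_eqVlt; apply/orP; left; apply/eqP.
    rewrite /m /K /B !natrM natrX exprMn exprVn !exprS.
    have bk : b%:R ^+ k != 0 :> R by rewrite expf_neq0// gt_eqF.
    by field; rewrite bk gt_eqF.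
have hA := fejer_average_mean m1 B0 K0 d20.
apply: mean_le_mono (mean_leD (PP D D0) hA); last first.
  have -> : 4 * B%:R / K%:R = 4 / k0%:R :> R by rewrite /K natrM; field; rewrite !gt_eqF.
  have -> : 16 * K%:R / (d2 * m%:R) = 16 / d2 / k1%:R.
    by rewrite /m natrM; field; rewrite !gt_eqF// ltr0n.
  by lra.
move=> z z1 /=; rewrite ev_mul ?unimod_neq0// ev_dil.
set p := ev P _; set a := ev _ z.
have [h1|h1] := ltP d1 (sqmod (1 - p)).
  apply: (@le_trans _ _ 1); first by case: (_ < _).
  by rewrite lerDl; case: (_ < _).
have [h2|h2] := ltP (d2 ^+ 2) (sqmod (1 - a)).
  by rewrite add0r; case: (_ < _).
rewrite add0r ltNge.
rewrite (sqmod_sub1M h1 h2) ?(ltW d20)// /d1 /d2 ge_min ?lexx ?orbT//.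
Qed.

End flat_polynomials.

(** * The filters (1 - |H|^2 / M)^r *)

Section filter_lists.
Variables (R : realFieldType) (V : zmodType).
Definition lcompl (p : seq (R * V)) : seq (R * V) := lone ++ lscale (- 1) p.
Definition lgram (M : R) (H : seq (R * V)) := lscale M^-1 (lmul (ladj H) H).
Definition lfilter (M : R) (H : seq (R * V)) (r : nat) :=
  lpow (lcompl (lgram M H)) r.
End filter_lists.

Section flat_filter.
Local Open Scope complex_scope.
Variable R : realType.
Implicit Types (p q : seq (R * int)) (z w u : R[i]).
Local Notation normc := ComplexField.Normc.normc.

Lemma ev_compl p z : ev (lcompl p) z = 1 - ev p z.
Proof. by rewrite ev_cat ev_one ev_scale rmorphN rmorph1 mulN1r. Qed.

Lemma sqmod_ev_le p z : unimod z -> sqmod (ev p z) <= lnorm1 p ^+ 2.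
Proof.
move=> z1; rewrite sqmod_normc ler_pXn2r ?nnegrE ?normc_ge0 ?lnorm1_ge0//.
apply: (le_trans (normc_sum _ _)); apply: ler_sum => x _.
rewrite ComplexField.Normc.normcM normc_real.
rewrite (_ : normc (z ^ x.2) = 1) ?mulr1//.
case: x.2 => n; first by rewrite -exprnP normc_unimod//; exact: unimodX.
rewrite NegzE -exprnN ComplexField.Normc.normcV normc_unimod ?invr1//.
exact: unimodX.
Qed.

Lemma ev_filter M H r z : unimod z ->
  ev (lfilter M H r) z = ((1 - sqmod (ev H z) / M) ^+ r)%:C.
Proof.
move=> z1; have z0 := unimod_neq0 z1.
rewrite ev_pow// ev_compl ev_scale ev_mul// -conjc_ev// [X in _ * X]mulrC.
by rewrite -sqmodE rmorphXn rmorphB rmorph1 /= mulrC -rmorphM.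
Qed.

(* With x = |H|^2 / M, the filter (1 - x)^r kills the set where 1 - Q is large,
   and costs at most r x where it is small. *)
Lemma flat_filter k (e : R) : 0 < e -> exists (Q : seq (R * int)) (M : R) (r : nat),
  [/\ forall x, x \in Q -> 0 < x.2, flat Q k e, 2 * lnorm1 (lcompl Q) ^+ 2 <= M,
     norm2c (lmul (lcompl Q) (lfilter M (lcompl Q) r)) <= e &
     norm2c (lcompl (lfilter M (lcompl Q) r)) <= e].
Proof.
move=> e0; pose c := Num.min e (1 / 2).
have c0 : 0 < c by rewrite lt_min e0 divr_gt0.
have ce : c <= e by rewrite /c ge_min lexx.
have c2 : c <= 1 / 2 by rewrite /c ge_min lexx orbT.
pose d := c ^+ 2 / 2.
have d0 : 0 < d by rewrite divr_gt0 ?exprn_gt0.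
have c20 : 0 < c / 2 by rewrite divr_gt0.
have [Q [Qpos [s [T [s1 Qs QT sT]]] Qm]] := flat_one_sided k c20 d0.
set H := lcompl Q; pose M : R := 2 * lnorm1 H ^+ 2.
have H1 : 1 <= lnorm1 H.
  rewrite /H /lcompl lnorm1_cat {1}/lnorm1 big_seq1 /= normr1 lerDl.
  exact: lnorm1_ge0.
have M2 : 2 <= M by rewrite /M; have := exprn_ege1 2 H1; lra.
have M0 : 0 < M by lra.
(* M < 2 c r gives x (1 - x/M)^(2r) <= c for every value x of |H|^2; taking r no larger keeps r d /
   M of order c, so that 1 - (1 - x/M)^r is small where x <= d. *)
pose r := (Num.trunc (M / (2 * c))).+1.
have r1 : M / (2 * c) < r%:R by exact: truncnS_gt.
have r2 : r%:R <= M / (2 * c) + 1.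
  have h : 0 <= M / (2 * c) by rewrite divr_ge0 ?(ltW M0)// mulr_ge0// ltW.
  have /andP[h1 _] := truncn_itv h.
  by rewrite /r -natr1; move: h1; lra.
have rM : r%:R * d <= c * 3 / 4 * M.
  have : r%:R * (2 * c) <= M + 2 * c.
    have c20' : 0 <= 2 * c by rewrite mulr_ge0// ltW.
    have := ler_wpM2r c20' r2.
    have -> : (M / (2 * c) + 1) * (2 * c) = M + 2 * c by field; rewrite gt_eqF.
    by [].
  rewrite /d; nra.
exists Q, M, r; split=> //.
- exists s, T; split=> //; apply: (le_trans sT); lra.
- rewrite -/H; apply: (norm2c_le (F := fun=> c)); last first.
    apply: (mean_le_mono _ ce (mean_le_cst c)) => z _; exact: lexx.
  move=> z z1; rewrite ev_mul ?unimod_neq0// sqmodM ev_filter// sqmodC.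
  have := sqmod_ev_le H z1; have := sqmod_ge0 (ev H z).
  set x := sqmod _ => x0 xH.
  have y01 : 0 <= x / M <= 1.
    rewrite divr_ge0 ?(ltW M0)//= ler_pdivrMr// mul1r /M.
    by have := sqr_ge0 (lnorm1 H); lra.
  have := bernoulli_inv (r * 2) y01; rewrite -exprM natrM.
  set Y := (1 - x / M) ^+ _.
  have Y0 : 0 <= Y by rewrite exprn_ge0// subr_ge0; case/andP: y01.
  have h : x <= c * (1 + r%:R * 2 * (x / M)).
    have Mr : M <= r%:R * 2 * c.
      by move: r1; rewrite ltr_pdivrMr ?mulr_gt0// => /ltW; lra.
    have := ler_wpM2r (proj1 (andP y01)) Mr.
    by rewrite [M * _]mulrC divfK ?gt_eqF//; lra.
  move=> hY; have := ler_wpM2r Y0 h; have := ler_wpM2l (ltW c0) hY; lra.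
- rewrite -/H.
  apply: (norm2c_le (F := fun z => (d < sqmod (1 - ev Q z))%R%:R + c / 2)); last first.
    apply: (mean_le_mono _ _ (mean_leD Qm (mean_le_cst (c / 2)))) => [z _|].
      exact: lexx.
    by move: ce; lra.
  move=> z z1; rewrite ev_compl ev_filter// -(rmorph1 (real_complex R)) -rmorphB sqmodC.
  have := sqmod_ev_le H z1; have := sqmod_ge0 (ev H z).
  rewrite ev_compl; set x := sqmod _ => x0 xH.
  have y01 : 0 <= x / M <= 1.
    rewrite divr_ge0 ?(ltW M0)//= ler_pdivrMr// mul1r /M.
    by have := sqr_ge0 (lnorm1 H); lra.
  have := bernoulli r y01; set Y := (1 - x / M) ^+ _.
  have Y0 : 0 <= Y by rewrite exprn_ge0// subr_ge0; case/andP: y01.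
  have Y1 : Y <= 1 by rewrite exprn_ile1// ?subr_ge0; case/andP: y01 => ? ?; lra.
  have [_ _|xd hY] := ltP d x; first by rewrite /=; nra.
  have h : r%:R * (x / M) <= c * 3 / 4.
    rewrite mulrA ler_pdivrMr//; apply: le_trans rM; rewrite ler_wpM2l ?ler0n//.
  have h2 : (1 - Y) ^+ 2 <= (c * 3 / 4) ^+ 2.
    by rewrite ler_pXn2r ?nnegrE//; lra.
  by rewrite add0r (le_trans h2)//; nra.
Qed.

End flat_filter.

(** * Quadratic forms and approximate inverses *)

Section list_measure.
Variables (R : realFieldType) (V : zmodType).
Implicit Types (p q x y w : seq (R * V)).

Definition lsum p (F : V -> R) : R := \sum_(a <- p) a.1 * F a.2.

(** Equality as measures: lists differing by the order or the splitting of masses are identified by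
    testing against all functions. *)
Definition leqv p q := forall F, lsum p F = lsum q F.

Lemma lsum_cat p q F : lsum (p ++ q) F = lsum p F + lsum q F.
Proof. by rewrite /lsum big_cat. Qed.

Lemma lsum_scale c p F : lsum (lscale c p) F = c * lsum p F.
Proof.
by rewrite /lsum big_map mulr_sumr; apply: eq_bigr => a _; rewrite mulrA.
Qed.

Lemma lsum_one F : lsum lone F = F 0.
Proof. by rewrite /lsum big_seq1 mul1r. Qed.

Lemma lsum_mul p q F : lsum (lmul p q) F = lsum p (fun s => lsum q (fun t => F (s + t))).
Proof.
rewrite /lsum (big_lmul (fun a s => a * F s)); apply: eq_bigr => a _.
by rewrite mulr_sumr; apply: eq_bigr => b _; rewrite mulrA.
Qed.

Lemma lsum_adj p F : lsum (ladj p) F = lsum p (fun s => F (- s)).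
Proof. by rewrite /lsum (big_ladj (fun a s => a * F s)). Qed.

Lemma eq_lsum p F G : F =1 G -> lsum p F = lsum p G.
Proof. by move=> FG; apply: eq_bigr => a _; rewrite FG. Qed.

Lemma lsum_lin p c F G : lsum p (fun s => c * F s + G s) = c * lsum p F + lsum p G.
Proof.
rewrite /lsum mulr_sumr -big_split; apply: eq_bigr => a _ /=.
by rewrite mulrDr mulrCA.
Qed.

Lemma exchange_lsum p q (F : V -> V -> R) :
  lsum p (fun s => lsum q (F s)) = lsum q (fun t => lsum p (fun s => F s t)).
Proof.
rewrite /lsum; under eq_bigr => a _ do rewrite mulr_sumr.
rewrite exchange_big; apply: eq_bigr => b _ /=; rewrite mulr_sumr.
by apply: eq_bigr => a _; rewrite mulrCA.
Qed.

Lemma lform_lsum (k : V -> R) p q :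
  lform k p q = lsum p (fun s => lsum q (fun t => k (s - t))).
Proof.
apply: eq_bigr => a _; rewrite mulr_sumr; apply: eq_bigr => b _.
by rewrite mulrA.
Qed.

Lemma lsum_compl p F : lsum (lcompl p) F = F 0 - lsum p F.
Proof. by rewrite lsum_cat lsum_one lsum_scale mulN1r. Qed.

Lemma leqv_sym p q : leqv p q -> leqv q p.
Proof. by move=> h F. Qed.

Lemma leqv_mul p p' q q' : leqv p p' -> leqv q q' -> leqv (lmul p q) (lmul p' q').
Proof.
by move=> h k F; rewrite !lsum_mul h; apply: eq_lsum => s; exact: k.
Qed.

Lemma lmulA p q r : leqv (lmul p (lmul q r)) (lmul (lmul p q) r).
Proof.
move=> F; rewrite !lsum_mul; apply: eq_lsum => s; rewrite lsum_mul.
by apply: eq_lsum => t; apply: eq_lsum => v; rewrite addrA.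
Qed.

Lemma lmulC p q : leqv (lmul p q) (lmul q p).
Proof.
move=> F; rewrite !lsum_mul exchange_lsum; apply: eq_lsum => s.
by apply: eq_lsum => t; rewrite addrC.
Qed.

Lemma lmul1 p : leqv (lmul lone p) p.
Proof. by move=> F; rewrite lsum_mul lsum_one; apply: eq_lsum => s; rewrite add0r. Qed.

Lemma lmul_catl p q r : leqv (lmul (p ++ q) r) (lmul p r ++ lmul q r).
Proof. by move=> F; rewrite lsum_cat !lsum_mul lsum_cat. Qed.

Lemma lmul_compl p x : leqv (lmul (lcompl p) x) (x ++ lscale (- 1) (lmul p x)).
Proof.
move=> F; rewrite lsum_cat lsum_scale !lsum_mul lsum_compl mulN1r.
by congr (_ - _); apply: eq_lsum => s; rewrite add0r.
Qed.

Section form.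
Variable k : V -> R.
Local Notation "<< p , q >>" := (lform k p q).
Definition nrm2 p := lform k p p.

Lemma lform_eqv p p' q q' : leqv p p' -> leqv q q' -> lform k p q = lform k p' q'.
Proof. by move=> h h'; rewrite !lform_lsum h; apply: eq_lsum => s; exact: h'. Qed.

Lemma nrm2_eqv p q : leqv p q -> nrm2 p = nrm2 q.
Proof. by move=> h; exact: lform_eqv. Qed.

Lemma lform_catl p q r : lform k (p ++ q) r = lform k p r + lform k q r.
Proof. by rewrite !lform_lsum lsum_cat. Qed.

Lemma lform_scalel c p q : lform k (lscale c p) q = c * lform k p q.
Proof. by rewrite !lform_lsum lsum_scale. Qed.

Hypothesis k_even : forall s, k (- s) = k s.

Lemma lformC p q : lform k p q = lform k q p.
Proof.
rewrite !lform_lsum exchange_lsum; apply: eq_lsum => s; apply: eq_lsum => t.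
by rewrite -k_even opprB.
Qed.

Lemma lform_catr p q r : lform k r (p ++ q) = lform k r p + lform k r q.
Proof. by rewrite lformC lform_catl !(lformC r). Qed.

Lemma lform_scaler c p q : lform k q (lscale c p) = c * lform k q p.
Proof. by rewrite lformC lform_scalel lformC. Qed.

Lemma lform_mull w p q : lform k (lmul w p) q = lform k p (lmul (ladj w) q).
Proof.
rewrite !lform_lsum lsum_mul exchange_lsum; apply: eq_lsum => s.
rewrite lsum_mul lsum_adj; apply: eq_lsum => t; apply: eq_lsum => v.
by congr k; rewrite opprD opprK addrA [t + s]addrC.
Qed.

Lemma nrm2_shift a s p : nrm2 (lmul [:: (a, s)] p) = a ^+ 2 * nrm2 p.
Proof.
rewrite /nrm2 !lform_lsum lsum_mul /lsum big_seq1 /= mulr_sumr mulr_sumr.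
apply: eq_bigr => x _; rewrite (big_lmul (fun b t => b * k (s + x.2 - t))) big_seq1 /=.
rewrite !mulr_sumr; apply: eq_bigr => y _.
have -> : s + x.2 - (s + y.2) = x.2 - y.2 by rewrite opprD addrACA subrr add0r.
by ring.
Qed.

Hypothesis k_psd : forall p, 0 <= nrm2 p.

Lemma nrm2_cat p q : nrm2 (p ++ q) = nrm2 p + 2 * lform k p q + nrm2 q.
Proof. by rewrite /nrm2 lform_catl !lform_catr (lformC q p); ring. Qed.

Lemma nrm2_scale c p : nrm2 (lscale c p) = c ^+ 2 * nrm2 p.
Proof. by rewrite /nrm2 lform_scalel lform_scaler mulrA expr2. Qed.

Lemma lform_le p q : 2 * lform k p q <= nrm2 p + nrm2 q.
Proof.
have := k_psd (p ++ lscale (- 1) q).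
by rewrite nrm2_cat nrm2_scale lform_scaler; lra.
Qed.

Lemma nrm2_catD p q : nrm2 (p ++ q) <= 2 * nrm2 p + 2 * nrm2 q.
Proof. by rewrite nrm2_cat; have := lform_le p q; lra. Qed.

Lemma lform_sum_lmul w p q :
  lform k (lmul w p) q = \sum_(a <- w) a.1 * lform k (lmul [:: (1, a.2)] p) q.
Proof.
rewrite lform_lsum lsum_mul; apply: eq_bigr => a _; congr (_ * _).
rewrite lform_lsum lsum_mul /lsum big_seq1 /= mul1r; apply: eq_bigr => b _.
by [].
Qed.

Lemma normr_lform_shift a b p :
  `|lform k (lmul [:: (1, a)] p) (lmul [:: (1, b)] p)| <= nrm2 p.
Proof.
rewrite ler_norml; apply/andP; split.
  have := lform_le (lscale (- 1) (lmul [:: (1, a)] p)) (lmul [:: (1, b)] p).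
  by rewrite nrm2_scale !nrm2_shift lform_scalel; lra.
have := lform_le (lmul [:: (1, a)] p) (lmul [:: (1, b)] p).
by rewrite !nrm2_shift; lra.
Qed.

(** Young's inequality: translations preserve the form, so by polarization each pair of shifts
    contributes at most [nrm2 p]. *)
Lemma nrm2_mul_le w p : nrm2 (lmul w p) <= lnorm1 w ^+ 2 * nrm2 p.
Proof.
rewrite /nrm2 lform_sum_lmul expr2 -mulrA {1}/lnorm1 mulr_suml.
apply: ler_sum => a _; apply: (le_trans (ler_norm _)); rewrite normrM.
rewrite ler_wpM2l// lformC lform_sum_lmul (le_trans (ler_norm_sum _ _ _))//.
rewrite /lnorm1 mulr_suml; apply: ler_sum => b _; rewrite normrM ler_wpM2l//.
exact: normr_lform_shift.
Qed.

Section gram.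
Variables (M : R) (H : seq (R * V)).
Hypotheses (M0 : 0 < M) (HM : lnorm1 H ^+ 2 <= M).
Local Notation S := (lgram M H).

Lemma lmul_gram x : leqv (lmul S x) (lscale M^-1 (lmul (ladj H) (lmul H x))).
Proof.
move=> F; rewrite lsum_scale lsum_mul lsum_scale; congr (_ * _).
by rewrite -lsum_mul -lmulA.
Qed.

Lemma nrm2_gram x : nrm2 (lmul S x) <= M^-1 * nrm2 (lmul H x).
Proof.
rewrite (nrm2_eqv (lmul_gram x)) nrm2_scale expr2 -mulrA ler_wpM2l ?invr_ge0 ?(ltW M0)//.
rewrite mulrC ler_pdivrMr// mulrC (le_trans (nrm2_mul_le _ _))// lnorm1_adj.
by rewrite ler_wpM2r// k_psd.
Qed.

(** With S = H*H/M, the norm of x - S x squared is |x|^2 - 2 <x, S x> + |S x|^2, and |S x|^2 <= |H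
    x|^2 / M = <x, S x> because the l^1 norm of H bounds it as an operator. *)
Lemma nrm2_compl_gram x : nrm2 (lmul (lcompl S) x) <= nrm2 x.
Proof.
rewrite (nrm2_eqv (lmul_compl _ _)) nrm2_cat nrm2_scale lform_scaler lformC.
rewrite (lform_eqv (lmul_gram x) (fun=> erefl)) lform_scalel lformC.
have -> : lform k x (lmul (ladj H) (lmul H x)) = nrm2 (lmul H x).
  by rewrite -lform_mull.
have : 0 <= M^-1 * nrm2 (lmul H x) by rewrite mulr_ge0 ?k_psd// invr_ge0 ltW.
by have := nrm2_gram x; rewrite sqrrN expr1n; lra.
Qed.

Lemma nrm2_filter r x : nrm2 (lmul (lfilter M H r) x) <= nrm2 x.
Proof.
elim: r => [|r IH]; first by rewrite (nrm2_eqv (lmul1 _)).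
rewrite (nrm2_eqv (leqv_sym (lmulA _ _ _))).
exact: le_trans (nrm2_compl_gram _) IH.
Qed.

End gram.

(** The error is relative to x, so one N serves all x. The class A records a property of N; it will
    be having integer shifts only. *)
Definition approx_inv (A : seq (R * V) -> Prop) w := forall e, 0 < e ->
  exists2 N, A N & forall x, nrm2 (x ++ lscale (- 1) (lmul N (lmul w x))) <= e * nrm2 x.

(** x - Nw Nv v w x = (x - Nw w x) + Nw (w x - Nv v w x). The accuracy of Nv is chosen after Nw,
    since its error is amplified by Nw and w. *)
Lemma approx_inv_mul A v w : (forall p q, A p -> A q -> A (lmul p q)) ->
  approx_inv A v -> approx_inv A w -> approx_inv A (lmul v w).
Proof.
move=> AM hv hw e e0.
have [Nw Aw wP] := hw (e / 4) (divr_gt0 e0 (ltr0Sn _ _)).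
pose c := 4 * (lnorm1 Nw ^+ 2 * lnorm1 w ^+ 2 + 1).
have c0 : 0 < c by rewrite mulr_gt0// ltr_wpDl// mulr_ge0// sqr_ge0.
have [Nv Av vP] := hv (e / c) (divr_gt0 e0 c0).
exists (lmul Nw Nv); first exact: AM.
move=> x; pose z := lmul w x ++ lscale (- 1) (lmul Nv (lmul v (lmul w x))).
have -> : nrm2 (x ++ lscale (- 1) (lmul (lmul Nw Nv) (lmul (lmul v w) x))) =
   nrm2 ((x ++ lscale (- 1) (lmul Nw (lmul w x))) ++ lmul Nw z).
  apply: nrm2_eqv => F; rewrite !lsum_cat !lsum_scale.
  have -> : lsum (lmul Nw z) F = lsum (lmul Nw (lmul w x)) F -
     lsum (lmul (lmul Nw Nv) (lmul (lmul v w) x)) F.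
    rewrite -[X in _ - X]lmulA [in RHS]lsum_mul [X in _ - X]lsum_mul lsum_mul.
    rewrite -mulN1r addrC -lsum_lin; apply: eq_lsum => s.
    rewrite lsum_cat lsum_scale addrC; congr (_ * _ + _).
    rewrite !(lsum_mul Nv); apply: eq_lsum => t.
    exact: lmulA.
  ring.
apply: (le_trans (nrm2_catD _ _)).
have h1 := wP x.
have h2 : nrm2 (lmul Nw z) <= e / 4 * nrm2 x.
  apply: (le_trans (nrm2_mul_le _ _)).
  have := vP (lmul w x); rewrite -/z => hz.
  apply: (le_trans (ler_wpM2l (sqr_ge0 _) hz)).
  have := nrm2_mul_le w x => hwx.
  have ec : 0 <= e / c by rewrite divr_ge0 ?(ltW e0) ?(ltW c0).
  apply: (le_trans (ler_wpM2l (sqr_ge0 _) (ler_wpM2l ec hwx))).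
  rewrite !mulrA ler_wpM2r ?k_psd//.
  rewrite [X in X <= _](_ : _ = (lnorm1 Nw ^+ 2 * lnorm1 w ^+ 2) * e / c); last by ring.
  rewrite ler_pdivrMr// /c; set t := _ * lnorm1 w ^+ 2.
  nra.
by have := k_psd x; lra.
Qed.

Fixpoint neumann (S : seq (R * V)) n :=
  if n is m.+1 then lone ++ lmul S (neumann S m) else [::].

Lemma neumannP S n x : leqv (x ++ lscale (- 1) (lmul (neumann S n) (lmul (lcompl S) x)))
  (lmul (lpow S n) x).
Proof.
elim: n => [|n IH] F.
  rewrite (lmul1 x F) lsum_cat lsum_scale lsum_mul.
  by rewrite [lsum [::] _](_ : _ = 0) ?mulr0 ?addr0// /lsum big_nil.
set y := lmul (lcompl S) x in IH *.
have -> : lsum (lmul (lpow S n.+1) x) F =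
    lsum S (fun s => -1 * lsum (lmul (neumann S n) y) (fun t => F (s + t)) +
                     lsum x (fun t => F (s + t))).
  rewrite /= -(lmulA _ _ _ F) lsum_mul; apply: eq_lsum => s.
  by rewrite -(IH (fun t => F (s + t))) lsum_cat lsum_scale addrC.
rewrite lsum_lin -!lsum_mul lsum_cat lsum_scale.
have -> : lsum (lmul (neumann S n.+1) y) F =
    lsum y F + lsum (lmul S (lmul (neumann S n) y)) F.
  by rewrite (lmul_catl _ _ _ F) lsum_cat (lmul1 _ F) (lmulA _ _ _ F).
by rewrite [lsum y F](lmul_compl _ _ F) lsum_cat lsum_scale; ring.
Qed.

Lemma approx_inv_compl (A : seq (R * V) -> Prop) S :
  (forall n, A (neumann S n)) -> (forall x, nrm2 (lmul S x) <= 4^-1 * nrm2 x) ->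
  (forall e : R, 0 < e -> exists n, 4^-1 ^+ n <= e) ->
  approx_inv A (lcompl S).
Proof.
move=> AN S4 arch e /arch[n ne]; exists (neumann S n) => // x.
rewrite (nrm2_eqv (neumannP _ _ _)).
apply: le_trans (ler_wpM2r (k_psd _) ne).
elim: n {ne} => [|n IH]; first by rewrite (nrm2_eqv (lmul1 _)) expr0 mul1r.
rewrite /= (nrm2_eqv (leqv_sym (lmulA _ _ _))) exprS -mulrA.
by apply: (le_trans (S4 _)); rewrite ler_wpM2l// invr_ge0.
Qed.

End form.
End list_measure.

(** * Trigonometric polynomials in the frequencies d Z and their decoupling for large d *)

Section embedding.
Variable R : realType.
Implicit Types (p q : seq (R * int)) (x y w : seq (R * R)).

Definition emb (d : nat) p : seq (R * R) := [seq (a.1, d%:R * a.2%:~R) | a <- p].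

Lemma emb_cat d p q : emb d (p ++ q) = emb d p ++ emb d q.
Proof. exact: map_cat. Qed.

Lemma emb_one d : emb d lone = lone.
Proof. by rewrite /emb /= mulr0. Qed.

Lemma emb_scale d c p : emb d (lscale c p) = lscale c (emb d p).
Proof. by rewrite /emb /lscale -!map_comp. Qed.

Lemma emb_adj d p : emb d (ladj p) = ladj (emb d p).
Proof.
by rewrite /emb /ladj -!map_comp; apply: eq_map => a /=; rewrite rmorphN mulrN.
Qed.

Lemma emb_mul d p q : emb d (lmul p q) = lmul (emb d p) (emb d q).
Proof.
rewrite /emb /lmul map_allpairs allpairs_mapl allpairs_mapr.
by apply: eq_allpairs => a b; rewrite /= rmorphD mulrDr.
Qed.

Lemma emb_compl d p : emb d (lcompl p) = lcompl (emb d p).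
Proof. by rewrite emb_cat emb_one emb_scale. Qed.

Lemma emb_filter d M H r : emb d (lfilter M H r) = lfilter M (emb d H) r.
Proof.
rewrite /lfilter; elim: r => [|r IH]; first exact: emb_one.
by rewrite /= emb_mul IH emb_compl emb_scale emb_mul emb_adj.
Qed.

Lemma lnorm1_emb d p : lnorm1 (emb d p) = lnorm1 p.
Proof. by rewrite /lnorm1 big_map. Qed.

Lemma lsum_emb d p F : lsum (emb d p) F = \sum_(a <- p) a.1 * F (d%:R * a.2%:~R).
Proof. by rewrite /lsum big_map. Qed.

Definition vanishing (W : R -> R) := forall e, 0 < e ->
  exists T, forall s, T <= `|s| -> `|W s| <= e.

Lemma cvg_seq_sum (T : Type) (s : seq T) (F : T -> nat -> R) (l : T -> R) :
  (forall a, F a d @[d --> \oo] --> l a) ->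
  (\sum_(a <- s) F a d) @[d --> \oo] --> \sum_(a <- s) l a.
Proof.
move=> h; elim: s => [|a s IH].
  by rewrite big_nil; under eq_fun do rewrite big_nil; exact: cvg_cst.
rewrite big_cons; under eq_fun do rewrite big_cons.
exact: cvgD.
Qed.

Lemma cvg_vanishing W (n : int) c : vanishing W ->
  W (d%:R * n%:~R + c) @[d --> \oo] --> kron R n * W c.
Proof.
move=> hW; rewrite /kron; have [->|n0] := eqVneq n 0.
  by rewrite mul1r; under eq_fun do rewrite mulr0 add0r; exact: cvg_cst.
rewrite mul0r; apply/cvgrPdist_le => e /hW [T hT].
have [N [_ NT]] := large_nat (T + `|c|).
exists N => // d /= Nd; rewrite sub0r normrN; apply: hT.
have n1 : 1 <= `|n%:~R : R|.
  rewrite -intr_norm -[1]/(1%:~R) ler_int; move: n0; rewrite -normr_gt0.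
  by rewrite gtz0_ge1.
have h1 : d%:R <= `|d%:R * n%:~R : R|.
  by rewrite normrM ger0_norm ?ler0n// ler_peMr.
have h2 : N%:R <= d%:R :> R by rewrite ler_nat.
have h3 : `|d%:R * n%:~R : R| <= `|d%:R * n%:~R + c| + `|c|.
  by rewrite -{1}[d%:R * n%:~R](addrK c) (le_trans (ler_normB _ _)).
lra.
Qed.

Lemma lform_emb k d p x : nrm2 k (lmul (emb d p) x) =
  \sum_(a <- p) \sum_(u <- x) \sum_(b <- p) \sum_(v <- x)
    (a.1 * u.1 * b.1 * v.1) * k (d%:R * (a.2 - b.2)%:~R + (u.2 - v.2)).
Proof.
rewrite /nrm2 lform_lsum lsum_mul lsum_emb; apply: eq_bigr => a _.
rewrite {1}/lsum mulr_sumr; apply: eq_bigr => u _.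
rewrite lsum_mul lsum_emb !mulr_sumr; apply: eq_bigr => b _.
rewrite /lsum !mulr_sumr; apply: eq_bigr => v _.
rewrite !mulrA; congr (_ * k _).
by rewrite rmorphB /=; ring.
Qed.

(** The kernel is evaluated at d (n - n') + (u - v), where it tends to 0 unless n = n'. In the limit
    p acts like an independent factor. *)
Lemma cvg_nrm2_emb k p x : vanishing k ->
  nrm2 k (lmul (emb d p) x) @[d --> \oo] --> norm2c p * nrm2 k x.
Proof.
move=> hk; under eq_fun do rewrite lform_emb.
have -> : norm2c p * nrm2 k x =
  \sum_(a <- p) \sum_(u <- x) \sum_(b <- p) \sum_(v <- x)
    (a.1 * u.1 * b.1 * v.1) * (kron R (a.2 - b.2) * k (u.2 - v.2)).
  rewrite /norm2c /nrm2 /lform mulr_suml; apply: eq_bigr => a _.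
  rewrite mulr_sumr; apply: eq_bigr => u _.
  rewrite mulr_suml; apply: eq_bigr => b _.
  rewrite mulr_sumr; apply: eq_bigr => v _; ring.
do 4! (apply: cvg_seq_sum => ?).
by apply: cvgMl_tmp; exact: cvg_vanishing.
Qed.

(** The same decoupling for linear functionals: only the zero frequency of p remains. A single
    vanishing majorant W makes it uniform in j, as all Taylor coefficients must be controlled with
    one d. *)
Lemma cvg_lsum_emb (F : nat -> R -> R) (W : R -> R) p x :
  (forall j s, `|F j s| <= W s) -> vanishing W -> forall e, 0 < e ->
  \forall d \near \oo, forall j,
    `|lsum (lmul (emb d p) x) (F j) - lsum p (kron R) * lsum x (F j)| <= e.
Proof.
move=> FW hW e e0.
have : (\sum_(a <- p) \sum_(u <- x) `|a.1 * u.1| * ((1 - kron R a.2) * W (d%:R * a.2%:~R + u.2)))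
    @[d --> \oo] --> \sum_(a <- p) \sum_(u <- x) `|a.1 * u.1| * ((1 - kron R a.2) * (kron R a.2 * W u.2)).
  do 2! (apply: cvg_seq_sum => ?).
  by do 2! apply: cvgMl_tmp; exact: cvg_vanishing.
rewrite big1 => [|a _]; last first.
  rewrite big1// => u _; rewrite /kron; case: eqP => _; rewrite ?subrr ?mul0r ?mulr0//.
move/cvgrPdist_le => /(_ _ e0); apply: filterS => d; rewrite sub0r normrN => h j.
apply: le_trans (le_trans (ler_norm _) h).
rewrite lsum_mul lsum_emb [lsum p _]/lsum mulr_suml -sumrB.
apply: (le_trans (ler_norm_sum _ _ _)); apply: ler_sum => a _.
rewrite -mulrA -mulrBr /lsum mulr_sumr -sumrB mulr_sumr.
apply: (le_trans (ler_norm_sum _ _ _)); apply: ler_sum => u _.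
rewrite [X in `|X| <= _](_ : _ = (a.1 * u.1) * (F j (d%:R * a.2%:~R + u.2) - kron R a.2 * F j u.2)); last ring.
rewrite normrM ler_wpM2l// /kron; case: eqP => [->|_].
  by rewrite subrr mul0r mulr0 add0r mul1r subrr normr0.
by rewrite mul0r !subr0 mul1r.
Qed.

Lemma kron_even (n : int) : kron R (- n) = kron R n.
Proof. by rewrite /kron oppr_eq0. Qed.

(** Bessel's inequality with the constant function 1; applied to 1 - psi, it shows that the mean of
    psi is close to 1. *)
Lemma sqr_lsum_kron p : lsum p (kron R) ^+ 2 <= norm2c p.
Proof.
have := norm2c_ge0 (p ++ lscale (- lsum p (kron R)) lone).
have kpsd := @norm2c_ge0 R.
rewrite /norm2c -!/(nrm2 _ _) nrm2_cat ?nrm2_scale ?lform_scaler//; try exact: kron_even.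
have -> : lform (kron R) p lone = lsum p (kron R).
  by rewrite lform_lsum; apply: eq_lsum => s; rewrite lsum_one subr0.
have -> : nrm2 (kron R) lone = 1.
  by rewrite /nrm2 lform_lsum !lsum_one subr0 /kron eqxx.
by nra.
Qed.

Lemma one_step k (F : nat -> R -> R) (W : R -> R) (n : nat) x e :
  (forall s, k (- s) = k s) -> (forall y, 0 <= nrm2 k y) -> vanishing k ->
  (forall j s, `|F j s| <= W s) -> vanishing W -> 0 < e ->
  exists (Q : seq (R * int)) (M : R) (r : nat),
  [/\ forall a, a \in Q -> 0 < a.2, flat Q n e, 0 < M, 2 * lnorm1 (lcompl Q) ^+ 2 <= M &
   \forall d \near \oo, let psi := lfilter M (lcompl (emb d Q)) r in
   [/\ nrm2 k (lmul (lcompl psi) x) <= e,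
       nrm2 k (lmul (lcompl (emb d Q)) (lmul psi x)) <= e &
       forall j, `|lsum (lmul psi x) (F j) - lsum x (F j)| <= e]].
Proof.
move=> k_even k_psd hk FW hW e0.
pose C := \sum_(a <- x) `|a.1| * W a.2.
have W0 s : 0 <= W s by exact: le_trans (FW 0%N s).
have C0 : 0 <= C by rewrite sumr_ge0// => a _; rewrite mulr_ge0.
(* The second bound absorbs the factor [nrm2 k x] of the decoupled norm; the third is a square
   because the mean of psi is controlled only through the square root of a [norm2c]. *)
pose c := Num.min (Num.min e (e / (2 * (nrm2 k x + 1)))) ((e / (2 * (C + 1))) ^+ 2).
have nx := k_psd x.
have c0 : 0 < c.
  by rewrite !lt_min e0 exprn_gt0 ?divr_gt0// ?mulr_gt0//; lra.
have [Q [M [r [Qpos [s [T [s1 Qs QT sT]]] HM h1 h2]]]] := flat_filter n c0.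
have ce : c <= e by rewrite /c !ge_min lexx.
have cx : c * nrm2 k x <= e / 2.
  have : c <= e / (2 * (nrm2 k x + 1)) by rewrite /c !ge_min lexx orbT.
  rewrite ler_pdivlMr; last lra.
  by nra.
have cC : c <= (e / (2 * (C + 1))) ^+ 2 by rewrite /c !ge_min lexx !orbT.
have HQ : 1 <= lnorm1 (lcompl Q).
  by rewrite lnorm1_cat {1}/lnorm1 big_seq1 normr1 lerDl lnorm1_ge0.
exists Q, M, r; split=> //.
- by exists s, T; split=> //; exact: le_trans ce.
- by have := exprn_ege1 2 HQ; lra.
have e2 : 0 < e / 2 by rewrite divr_gt0.
pose psi := lfilter M (lcompl Q) r.
have /cvgrPdist_le /(_ _ e2) := @cvg_nrm2_emb k (lcompl psi) x hk.
have /cvgrPdist_le /(_ _ e2) := @cvg_nrm2_emb k (lmul (lcompl Q) psi) x hk.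
have := @cvg_lsum_emb F W psi x FW hW _ e2.
apply: filterS3 => d d1 d2 d3; rewrite -emb_compl -emb_filter -emb_compl -/psi.
split.
- have b3 : norm2c (lcompl psi) * nrm2 k x <= c * nrm2 k x by rewrite ler_wpM2r.
  by move: d3; rewrite ler_distlC => /andP[_ ?]; lra.
- rewrite (nrm2_eqv _ (lmulA _ _ _)) -emb_mul.
  have b2 : norm2c (lmul (lcompl Q) psi) * nrm2 k x <= c * nrm2 k x by rewrite ler_wpM2r.
  by move: d2; rewrite ler_distlC => /andP[_ ?]; lra.
move=> j; have xF : `|lsum x (F j)| <= C.
  apply: (le_trans (ler_norm_sum _ _ _)); apply: ler_sum => a _.
  by rewrite normrM ler_wpM2l.
have : `|lsum psi (kron R) - 1| <= e / (2 * (C + 1)).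
  rewrite -(@ler_pXn2r _ 2%N)// ?nnegrE ?divr_ge0 ?(ltW e0)//; last lra.
  rewrite real_normK ?num_real// (le_trans _ cC)// (le_trans _ h2)//.
  apply: le_trans (sqr_lsum_kron _).
  by rewrite lsum_compl /kron eqxx -sqrrN opprB.
rewrite ler_pdivlMr; last lra.
move=> hc; have := d1 j; set A := lsum (lmul _ _) _; set L := lsum psi _ in hc *.
set f := lsum x _ in xF * => hA.
have -> : A - f = (A - L * f) + (L - 1) * f by ring.
rewrite (le_trans (ler_normD _ _))// normrM.
have := normr_ge0 f; have := normr_ge0 (L - 1); nra.
Qed.

End embedding.

(** * Square integrable functions and translates of the Gaussian *)

Section L2.
Variable R : realType.
Local Notation mu := (@lebesgue_measure R).
Implicit Types (f g h : R -> R).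

Definition N2 f : \bar R := (\int[mu]_t ((f t) ^+ 2)%:E)%E.

Lemma measurable_sqr f : measurable_fun setT f ->
  measurable_fun setT (EFin \o (fun t => (f t) ^+ 2)).
Proof. by move=> mf; apply/measurable_EFinP; exact: measurable_funX. Qed.

Lemma N2_ge0 f : (0 <= N2 f)%E.
Proof. by apply: integral_ge0 => t _; rewrite lee_fin sqr_ge0. Qed.

Lemma N2_le f g : measurable_fun setT f -> measurable_fun setT g ->
  (forall t, (f t) ^+ 2 <= (g t) ^+ 2) -> (N2 f <= N2 g)%E.
Proof.
move=> mf mg fg; apply: ge0_le_integral => //.
- by move=> t _; rewrite lee_fin sqr_ge0.
- exact: measurable_sqr.
- exact: measurable_sqr.
- by move=> t _; rewrite lee_fin.
Qed.

Lemma N2Z c f : measurable_fun setT f ->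
  N2 (fun t => c * f t) = ((c ^+ 2)%:E * N2 f)%E.
Proof.
move=> mf; rewrite /N2; under eq_integral do rewrite exprMn EFinM.
rewrite ge0_integralZl_EFin ?sqr_ge0//; first by move=> t _; rewrite lee_fin sqr_ge0.
exact: measurable_sqr.
Qed.

Lemma N2D f g : measurable_fun setT f -> measurable_fun setT g ->
  (N2 (fun t => f t + g t)%R <= 2%:E * N2 f + 2%:E * N2 g)%E.
Proof.
move=> mf mg.
rewrite -!ge0_integralZl_EFin//; [|by move=> t _; rewrite lee_fin sqr_ge0|exact: measurable_sqr|by move=> t _; rewrite lee_fin sqr_ge0|exact: measurable_sqr].
rewrite -ge0_integralD//.
- apply: ge0_le_integral => //.
  + by move=> t _; rewrite lee_fin sqr_ge0.
  + by apply: measurable_sqr; exact: measurable_funD.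
  + apply/measurable_EFinP; apply: measurable_funD; apply: measurable_funM => //; exact: measurable_funX.
  + move=> t _; rewrite -!EFinM -EFinD lee_fin.
    by have := sqr_ge0 (f t - g t); nra.
- by move=> t _; rewrite -EFinM lee_fin mulr_ge0// sqr_ge0.
- by apply/measurable_EFinP; apply: measurable_funM => //; exact: measurable_funX.
- by move=> t _; rewrite -EFinM lee_fin mulr_ge0// sqr_ge0.
- by apply/measurable_EFinP; apply: measurable_funM => //; exact: measurable_funX.
Qed.

Lemma N2_fatou (F : nat -> R -> R) f (b : \bar R) :
  (forall n, measurable_fun setT (F n)) ->
  (forall t, F n t @[n --> \oo] --> f t) ->
  (forall n, N2 (F n) <= b)%E -> (N2 f <= b)%E.
Proof.
move=> mF Ff Fb.
have -> : N2 f = (\int[mu]_t limn_einf (fun n => ((F n t) ^+ 2)%:E))%E.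
  apply: eq_integral => t _; apply/esym; apply: (cvg_limn_einf_sup _).1.
  apply/cvg_EFin; first exact: nearW.
  rewrite (_ : fine \o _ = (fun n => F n t * F n t)); last by apply/funext => n; rewrite /= expr2.
  by rewrite expr2; exact: cvgM.
apply: (le_trans (@fatou _ _ _ mu setT measurableT (fun n t => ((F n t) ^+ 2)%:E)
  (fun n => measurable_sqr (mF n)) (fun n t _ => sqr_ge0 _))).
rewrite limn_einf_lim; apply: lime_le; first exact: is_cvg_einfs.
apply: nearW => n; apply: le_trans (Fb n).
by apply: ereal_inf_lbound; exists n => //=.
Qed.

Lemma N2_dominated (F : nat -> R -> R) f G :
  (forall n, measurable_fun setT (F n)) -> measurable_fun setT f ->
  (forall t, F n t @[n --> \oo] --> f t) ->
  mu.-integrable setT (EFin \o G) ->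
  (forall n t, (F n t - f t) ^+ 2 <= G t) ->
  forall e, 0 < e -> \forall n \near \oo, (N2 (fun t => f t - F n t)%R < e%:E)%E.
Proof.
move=> mF mf Ff iG FG e e0.
have mS n : measurable_fun setT (EFin \o (fun t => (f t - F n t) ^+ 2)).
  by apply: measurable_sqr; exact: measurable_funB.
have cv : {ae mu, forall t, setT t ->
    ((f t - F n t) ^+ 2)%:E @[n --> \oo] --> 0%E}.
  apply: aeW => t _; apply/cvg_EFin; first exact: nearW.
  rewrite (_ : fine \o _ = (fun n => (f t - F n t) * (f t - F n t))); last first.
    by apply/funext => n; rewrite /= expr2.
  rewrite -(mulr0 0); apply: cvgM; rewrite -(subrr (f t)); apply: cvgB => //; exact: cvg_cst.
have dm : {ae mu, forall t n, setT t -> (`|((f t - F n t) ^+ 2)%:E| <= (EFin \o G) t)%E}.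
  apply: aeW => t n _; rewrite /= lee_fin ger0_norm ?sqr_ge0//.
  by rewrite -sqrrN opprB.
have [_ _] := @dominated_convergence _ _ _ mu setT measurableT
  (fun n t => ((f t - F n t) ^+ 2)%:E) (fun=> 0%E) (EFin \o G) mS (measurable_cst _) cv iG dm.
rewrite integral0 => /fine_cvgP[fin /cvgrPdist_lt /(_ _ e0)] h.
near=> n; rewrite -[N2 _]fineK; last by near: n.
rewrite lte_fin; apply: le_lt_trans (ler_norm _) _; rewrite -normrN -sub0r.
by near: n.
Unshelve. all: by end_near. Qed.

Definition act (x : seq (R * R)) (u : R -> R) (t : R) : R :=
  lsum x (fun s => u (t - s)).

Lemma act_mul x y u t : act (lmul x y) u t = act x (act y u) t.
Proof.
rewrite /act lsum_mul; apply: eq_lsum => s; apply: eq_lsum => v.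
by rewrite opprD addrA.
Qed.

Lemma measurable_shift (s : R) f : measurable_fun setT f ->
  measurable_fun setT (fun t : R => f (t - s)).
Proof. by move=> mf; apply: measurableT_comp => //; exact: measurable_funB. Qed.

Lemma measurable_act x u : measurable_fun setT u -> measurable_fun setT (act x u).
Proof.
move=> mu_; rewrite /act /lsum; apply: measurable_sum => a.
by apply: measurable_funM => //; exact: measurable_shift.
Qed.

(** The integral of exp(-2 t^2), which is the square of the Gaussian and a multiple of the normal
    density of deviation 1/2; [kappa] below is thus the autocorrelation of the Gaussian. *)
Definition gauss_mass : R := (normal_peak 2^-1)^-1.

Definition kappa (s : R) : R := gauss_mass * expR (- (s ^+ 2 / 2)).

Local Notation gam := (@gauss_fun R).

(** Completing the square: (t-a)^2 + (t-b)^2 = 2 (t - (a+b)/2)^2 + (a-b)^2 / 2. *)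
Lemma gauss_mul (a b t : R) : gam (t - a) * gam (t - b) =
  kappa (a - b) * normal_pdf ((a + b) / 2) 2^-1 t.
Proof.
have h2 : 2^-1 != 0 :> R by rewrite invr_neq0// pnatr_eq0.
rewrite normal_pdfE// /kappa /gauss_mass mulrACA mulrA mulVf ?mul1r; last first.
  by rewrite gt_eqF// normal_peak_gt0.
by rewrite -!expRD; congr expR; rewrite mulr2n; field.
Qed.

Lemma integrable_gauss_mul a b :
  mu.-integrable setT (fun t => (gam (t - a) * gam (t - b))%:E).
Proof.
under eq_fun do rewrite gauss_mul EFinM.
by apply: integrableZl => //; exact: integrable_normal_pdf.
Qed.

Lemma integral_gauss_mul a b :
  (\int[mu]_t (gam (t - a) * gam (t - b))%:E)%E = (kappa (a - b))%:E.
Proof.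
under eq_integral do rewrite gauss_mul EFinM.
rewrite integralZl//; last exact: integrable_normal_pdf.
by rewrite integral_normal_pdf mule1.
Qed.

Lemma nrm2E x : N2 (act x gam) = (nrm2 kappa x)%:E.
Proof.
rewrite /N2 /nrm2 /lform.
under eq_integral => t _.
  rewrite (_ : act x gam t ^+ 2 = \sum_(a <- x) \sum_(b <- x)
     a.1 * b.1 * (gam (t - a.2) * gam (t - b.2))).
    rewrite -sumEFin; under eq_bigr do rewrite -sumEFin.
    over.
  rewrite expr2 /act /lsum mulr_suml; apply: eq_bigr => a _.
  by rewrite mulr_sumr; apply: eq_bigr => b _; ring.
have I a b : mu.-integrable setT (fun t => (a.1 * b.1 * (gam (t - a.2) * gam (t - b.2)))%:E).
  by under eq_fun do rewrite EFinM; apply: integrableZl => //; exact: integrable_gauss_mul.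
rewrite integral_sum//; last by move=> a; exact: integrable_sum.
rewrite -sumEFin; apply: eq_bigr => a _.
rewrite integral_sum// -sumEFin; apply: eq_bigr => b _.
under eq_integral do rewrite EFinM.
rewrite integralZl//; last exact: integrable_gauss_mul.
by rewrite integral_gauss_mul -EFinM.
Qed.

Lemma kappa_even s : kappa (- s) = kappa s.
Proof. by rewrite /kappa sqrrN. Qed.

Lemma gauss_mass_gt0 : 0 < gauss_mass.
Proof. by rewrite invr_gt0 normal_peak_gt0// invr_neq0// pnatr_eq0. Qed.

Lemma kappa_psd x : 0 <= nrm2 kappa x.
Proof. by rewrite -lee_fin -nrm2E N2_ge0. Qed.

Lemma kappa_ge0 s : 0 <= kappa s.
Proof. by rewrite mulr_ge0 ?expR_ge0// ltW// gauss_mass_gt0. Qed.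

Lemma expRN_le (y : R) : 0 <= y -> expR (- y) <= (1 + y)^-1.
Proof.
move=> y0; rewrite expRN lef_pV2 ?posrE ?expR_gt0 ?expR_ge1Dx//; lra.
Qed.

Lemma vanishing_inv (W : R -> R) (C : R) : 0 <= C ->
  (forall s, `|W s| <= C / (1 + `|s|)) -> vanishing W.
Proof.
move=> C0 h e e0; exists (C / e) => s hs; apply: (le_trans (h s)).
have s1 : 0 < 1 + `|s| by have := normr_ge0 s; lra.
rewrite ler_pdivrMr//; move: hs; rewrite ler_pdivrMr// => hs.
nra.
Qed.

Lemma vanishing_kappa : vanishing kappa.
Proof.
apply: (@vanishing_inv _ (gauss_mass * 2)); first by rewrite mulr_ge0// ltW// gauss_mass_gt0.
move=> s; rewrite ger0_norm ?kappa_ge0// /kappa -mulrA ler_wpM2l//.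
  by rewrite ltW// gauss_mass_gt0.
have y0 : 0 <= s ^+ 2 / 2 by rewrite divr_ge0// sqr_ge0.
apply: (le_trans (expRN_le y0)).
have s1 : 0 < 1 + `|s| by have := normr_ge0 s; lra.
rewrite ler_pdivlMr// mulrC ler_pdivrMr; last lra.
have -> : s ^+ 2 = `|s| ^+ 2 by rewrite real_normK// num_real.
by have := sqr_ge0 (`|s| - 1); nra.
Qed.

End L2.

(** * Density of the rational translates of the Gaussian *)

Section prelim.
Variable R : realType.

Lemma cvg_harmonic_le (u : nat -> R) l (C : R) :
  (forall n, `|u n - l| <= C / n.+1%:R) -> u n @[n --> \oo] --> l.
Proof.
move=> h; apply/cvgrPdist_le => e e0.
have [N [N0 NP]] := large_nat (C / e).
exists N => // n /= Nn; rewrite distrC (le_trans (h n))//.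
rewrite ler_pdivrMr// mulrC -ler_pdivrMr// (le_trans NP)// ler_nat.
exact: leqW.
Qed.

Lemma expR_sub1_le (u : R) : u <= expR u - 1 <= u * expR u.
Proof.
have h1 := expR_ge1Dx u; have h2 := expR_ge1Dx (- u).
have h3 := expRxMexpNx_1 u; have h4 := expR_gt0 u.
apply/andP; split; first lra.
have : expR u * (1 - u) <= expR u * expR (- u) by rewrite ler_wpM2l// ltW.
rewrite h3; lra.
Qed.

(** A polynomial in p tending to the indicator of p >= 1/2. What decides is m 4^m p^(2m) = m
    (2p)^(2m), which tends to 0 for p < 1/2 and is at least m otherwise; the factor m settles the
    case p = 1/2. *)
Definition bump (p : R) (m : nat) : R := 1 - (1 - p ^+ (2 * m)) ^+ (m * 4 ^ m).

Lemma bump_itv p m : 0 <= p <= 1 -> 0 <= bump p m <= 1.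
Proof.
move=> /andP[p0 p1]; rewrite /bump.
have q0 : 0 <= p ^+ (2 * m) by rewrite exprn_ge0.
have q1 : p ^+ (2 * m) <= 1 by rewrite exprn_ile1.
have r0 : 0 <= (1 - p ^+ (2 * m)) ^+ (m * 4 ^ m) by rewrite exprn_ge0// subr_ge0.
have r1 : (1 - p ^+ (2 * m)) ^+ (m * 4 ^ m) <= 1.
  by rewrite exprn_ile1// ?subr_ge0//; lra.
by apply/andP; split; lra.
Qed.

Lemma cvg_bump p : 0 <= p <= 1 -> bump p m @[m --> \oo] --> ((2^-1 <= p)%R%:R : R).
Proof.
move=> p01; have /andP[p0 p1] := p01.
have q01 m : 0 <= p ^+ (2 * m) <= 1 by rewrite exprn_ge0// exprn_ile1.
have [hp|hp] := leP 2^-1 p => /=.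
  apply: (@cvg_harmonic_le _ _ 1) => m.
  have /andP[b0 b1] := bump_itv m p01.
  rewrite ler0_norm ?subr_le0// opprB /bump opprB addrC subrK.
  have := bernoulli_inv (m * 4 ^ m) (q01 m).
  set y := (1 - _) ^+ _; rewrite natrM natrX => hy.
  have y0 : 0 <= y by rewrite exprn_ge0// subr_ge0; case/andP: (q01 m).
  have h4 : 1 <= 4 ^+ m * p ^+ (2 * m).
    rewrite exprM -exprMn exprn_ege1//.
    have : 2^-1 ^+ 2 <= p ^+ 2 by rewrite ler_pXn2r ?nnegrE.
    lra.
  rewrite ler_pdivlMr// (le_trans _ hy)// ler_wpM2l// -natr1 addrC lerD2l.
  by rewrite -mulrA ler_peMr.
pose y := 1 - 2 * p.
have y0 : 0 < y by rewrite /y; lra.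
have y1 : y <= 1 by rewrite /y; lra.
apply: (@cvg_harmonic_le _ _ (y ^- 2)) => m; rewrite subr0.
have /andP[b0 b1] := bump_itv m p01.
rewrite ger0_norm// /bump.
have hb := bernoulli (m * 4 ^ m) (q01 m).
apply: (@le_trans _ _ ((m * 4 ^ m)%:R * p ^+ (2 * m))); first by move: hb; lra.
have y01 : 0 <= y <= 1 by rewrite ltW.
have := bernoulli_inv m y01; rewrite {1}/y opprB addrCA subrr addr0.
set z := (2 * p) ^+ m => hz.
have z0 : 0 <= z by rewrite exprn_ge0// mulr_ge0.
have -> : (m * 4 ^ m)%:R * p ^+ (2 * m) = m%:R * z ^+ 2.
  rewrite natrM natrX -mulrA; congr (_ * _).
  rewrite exprM -exprMn /z -exprM mulnC exprM; congr (_ ^+ _).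
  by rewrite exprMn; congr (_ * _); rewrite -natrX.
have m0 : 0 <= m%:R :> R by rewrite ler0n.
have d0 : 0 < 1 + m%:R * y by rewrite ltr_pwDl// mulr_ge0// ltW.
have zle : z <= (1 + m%:R * y)^-1 by rewrite -[X in _ <= X]mul1r ler_pdivlMr.
have z1 : m%:R * y * z <= 1.
  by move: hz; rewrite mulrDr mulr1; nra.
have zy : z * (y * (m%:R + 1)) <= 1.
  by apply: le_trans hz; rewrite ler_wpM2l//; nra.
have AB : (m%:R * y * z) * (z * (y * (m%:R + 1))) <= 1.
  by apply: mulr_ile1 => //; rewrite !mulr_ge0 ?(ltW y0)// addr_ge0.
rewrite -natr1 ler_pdivlMr; last by rewrite ltr_wpDl.
rewrite -[X in _ <= X]mul1r ler_pdivlMr ?exprn_gt0//.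
by apply: le_trans AB; rewrite le_eqVlt; apply/orP; left; apply/eqP; ring.
Qed.

(** For large n the angle lies in ]-pi, pi[, where the sine has the sign of its argument. *)
Lemma cvg_ray (tau t : R) :
  ((0 <= sin ((tau - t) / n.+1%:R))%R%:R : R) @[n --> \oo] --> ((t <= tau)%R%:R : R).
Proof.
have pi0 := @pi_gt0 R.
have [N [N0 NP]] := large_nat (`|tau - t| / pi).
have ub n : (N <= n)%N -> `|tau - t| / n.+1%:R < pi.
  move=> Nn; rewrite ltr_pdivrMr// mulrC -ltr_pdivrMr// (le_lt_trans NP)//.
  by rewrite ltr_nat ltnS.
apply: (@cvg_near_cst _ _ _ _ _).
exists N => // n /= /ub h; congr (nat_of_bool _)%:R.
have [tt|tt] := leP t tau.
  rewrite ger0_norm ?subr_ge0// in h.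
  by rewrite sin_ge0_pi// divr_ge0 ?subr_ge0//= ltW.
apply/negbTE; rewrite -ltNge -oppr_gt0 -sinN sin_gt0_pi// -mulNr opprB.
rewrite ltr0_norm ?subr_lt0// opprB in h.
by rewrite h andbT divr_gt0// subr_gt0.
Qed.

Lemma series_sin_coeff_le (y : R) n : `|series (sin_coeff y) n| <= expR `|y|.
Proof.
apply: (le_trans (ler_norm_sum _ _ _)).
apply: (@le_trans _ _ (series (exp_coeff `|y|) n)).
  apply: ler_sum => k _; rewrite /sin_coeff /exp_coeff /= normf_div normr_nat.
  rewrite ler_wpM2r ?invr_ge0// normrM normrX ler_piMl// ?exprn_ge0//.
  rewrite normrM normrX normrN1 expr1n mulr1 normr_nat.
  by case: odd.
apply: nondecreasing_cvgn_le; last exact: is_cvg_series_exp_coeff.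
by apply: nondecreasing_series => k _ _; rewrite exp_coeff_ge0.
Qed.

End prelim.

Section density.
Variable R : realType.
Local Notation mu := (@lebesgue_measure R).
Local Notation gam := (@gauss_fun R).
(** K is any closed linear class containing the rational translates of the Gaussian; it will be the
    class of approximable functions. Limits of multipliers lead from exponentials to t, sines, rays,
    Borel sets and simple functions. *)
Variable K : (R -> R) -> Prop.
Hypothesis K_meas : forall f : R -> R, K f -> measurable_fun setT f.
Hypothesis K_lin : forall (a : R) f h, K f -> K h -> K (fun t => a * f t + h t).
Hypothesis K_cl : forall f : R -> R, measurable_fun setT f ->
  (forall e : R, 0 < e -> exists2 h, K h & (N2 (fun t => f t - h t)%R < e%:E)%E) -> K f.
Hypothesis K_gauss : forall r : rat, K (fun t => gam (t - ratr r)).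

Let K_ext f h : K f -> f =1 h -> K h.
Proof. by move=> Kf /funext <-. Qed.

Let K_scale a f : K f -> K (fun t => a * f t).
Proof.
move=> Kf; apply: K_ext (K_lin a Kf (K_lin (-1) Kf Kf)) _ => t.
by rewrite mulN1r addNr addr0.
Qed.

Let K_dom (F : nat -> R -> R) f G : (forall n, K (F n)) ->
  (forall t, F n t @[n --> \oo] --> f t) ->
  mu.-integrable setT (EFin \o G) ->
  (forall n t, (F n t - f t) ^+ 2 <= G t) -> K f.
Proof.
move=> KF Ff iG FG.
have mF n := K_meas (KF n).
have mf : measurable_fun setT f.
  by apply: (measurable_fun_cvg mF) => t _; exact: Ff.
apply: K_cl => // e e0.
have /filter_ex[n hn] := N2_dominated mF mf Ff iG FG e0.
by exists (F n).
Qed.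

Definition exp_bounded (f : R -> R) C c := forall t, `|f t| <= C * expR (c * `|t|).

(** From (c - |t|)^2 >= 0 one gets 2 c |t| - 2 t^2 <= c^2 - t^2, which leaves an integrable
    Gaussian. *)
Lemma exp_bounded_gauss C c : mu.-integrable setT
  (EFin \o (fun t => (C * expR (c * `|t|) * gam t) ^+ 2)).
Proof.
apply: (@le_integrable _ _ _ mu setT measurableT _
  (fun t => ((C ^+ 2 * expR (c ^+ 2)) %:E * (gam t)%:E)%E)).
- apply: measurable_sqr; apply: measurable_funM => //; last exact: measurable_gauss_fun.
  apply: measurable_funM => //; apply: measurableT_comp => //.
  by apply: measurable_funM => //; exact: measurableT_comp.
- move=> t _; rewrite /= lee_fin ger0_norm ?sqr_ge0// (le_trans _ (ler_norm _))//.
  rewrite !exprMn -!(mulrA (C ^+ 2)) ler_wpM2l ?sqr_ge0// /gauss_fun -!expRM_natl -!expRD ler_expR.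
  have -> : t ^+ 2 = `|t| ^+ 2 by rewrite real_normK// num_real.
  by have := sqr_ge0 (c - `|t|); nra.
by apply: integrableZl => //; exact: integrableT_gauss.
Qed.

Let K_exp_dom (F : nat -> R -> R) f C c :
  (forall n, K (fun t => gam t * F n t)) ->
  (forall t, F n t @[n --> \oo] --> f t) ->
  (forall n, exp_bounded (F n) C c) -> K (fun t => gam t * f t).
Proof.
move=> KF Ff FC.
apply: (K_dom KF _ (exp_bounded_gauss (2 * C) c)).
  by move=> t; apply: cvgMl_tmp; exact: Ff.
move=> n t.
have fC : `|f t| <= C * expR (c * `|t|).
  exact: (cvgr_to_le (cvg_norm (Ff t)) (nearW _ (fun m => FC m t))).
have h : `|gam t * F n t - gam t * f t| <= 2 * C * expR (c * `|t|) * gam t.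
  rewrite -mulrBr normrM ger0_norm ?gauss_fun_ge0// mulrC ler_wpM2r ?gauss_fun_ge0//.
  by rewrite (le_trans (ler_normB _ _))//; have := FC n t; lra.
rewrite -[X in X <= _]real_normK ?num_real// ler_pXn2r ?nnegrE//.
exact: le_trans h.
Qed.

(* m is a multiplier when it preserves the functions phi of exponential growth
   for which every e^{st} phi gamma lies in K. *)
Let X (f : R -> R) := (exists C c, exp_bounded f C c) /\
  forall s, K (fun t => gam t * (expR (s * t) * f t)).

Let M (m : R -> R) := (exists C c, exp_bounded m C c) /\
  forall f, X f -> X (fun t => m t * f t).

Let exp_boundedW f C c D d : exp_bounded f C c -> C <= D -> 0 <= D -> c <= d ->
  exp_bounded f D d.
Proof.
move=> h CD D0 cd t; apply: (le_trans (h t)).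
apply: (le_trans (ler_wpM2r (expR_ge0 _) CD)); rewrite ler_wpM2l// ler_expR.
by rewrite ler_wpM2r.
Qed.

Let exp_bounded_exp s : exp_bounded (fun t => expR (s * t)) 1 `|s|.
Proof.
move=> t; rewrite mul1r ger0_norm ?expR_ge0// ler_expR (le_trans (ler_norm _))//.
by rewrite normrM.
Qed.

Let exp_boundedM f h C c D d : exp_bounded f C c -> exp_bounded h D d ->
  exp_bounded (fun t => f t * h t) (C * D) (c + d).
Proof.
move=> hf hh t; rewrite normrM (mulrDl c) expRD mulrACA.
by rewrite ler_pM// ?hf ?hh.
Qed.

Let X1 : X (fun=> 1).
Proof.
split; first by exists 1, 0 => t; rewrite mul0r expR0 mulr1 normr1.
(* The translate by r is exp(-r^2) exp(2 r t) gamma(t), so rationals r tending to s/2 reach exp(s t)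
   gamma(t). *)
move=> s; have /choice[r rP] n : exists q : rat, (s / 2 < (ratr q : R)) && ((ratr q : R) < s / 2 + n.+1%:R^-1).
  have /rat_in_itvoo[q] : s / 2 < s / 2 + n.+1%:R^-1 by rewrite ltrDl invr_gt0.
  by rewrite in_itv /= => h; exists q.
apply: (@K_exp_dom (fun n t => expR (2 * ratr (r n) * t) * 1) _ 1 (`|s| + 2)).
- move=> n; apply: K_ext (K_scale (expR (ratr (r n) ^+ 2)) (K_gauss (r n))) _ => t.
  by rewrite mulr1 /gauss_fun -!expRD; congr expR; ring.
- move=> t; apply: cvgM; last exact: cvg_cst.
  apply: continuous_cvg; first exact: continuous_expR.
  apply: cvgM; last exact: cvg_cst.
  apply: (@cvg_harmonic_le _ _ _ 2) => n; have /andP[h1 h2] := rP n.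
  move: h1 h2; move: (n.+1%:R^-1) => w h1 h2.
  by rewrite ler_norml; apply/andP; split; lra.
move=> n t; rewrite mulr1 mul1r ger0_norm ?expR_ge0// ler_expR.
rewrite (le_trans (ler_norm _))// normrM ler_wpM2r//.
have /andP[h1 h2] := rP n.
have n1 : n.+1%:R^-1 <= 1 :> R by rewrite invf_le1// ler1n.
move: h1 h2 n1; move: (n.+1%:R^-1) => w h1 h2 n1.
have := ler_norm s; have := ler_norm (- s); rewrite normrN => *.
by rewrite ler_norml; apply/andP; split; lra.
Qed.

Let X_dom (F : nat -> R -> R) f C c : (forall n, X (F n)) ->
  (forall t, F n t @[n --> \oo] --> f t) -> (forall n, exp_bounded (F n) C c) -> X f.
Proof.
move=> XF Ff FC; split.
  exists C, c => t.
  exact: (cvgr_to_le (cvg_norm (Ff t)) (nearW _ (fun m => FC m t))).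
move=> s; apply: (@K_exp_dom (fun n t => expR (s * t) * F n t) _ (1 * C) (`|s| + c)).
- by move=> n; have [_] := XF n; exact.
- by move=> t; apply: cvgMl_tmp; exact: Ff.
- by move=> n; exact: exp_boundedM.
Qed.

Let M_dom (F : nat -> R -> R) f C c : (forall n, M (F n)) ->
  (forall t, F n t @[n --> \oo] --> f t) -> (forall n, exp_bounded (F n) C c) -> M f.
Proof.
move=> MF Ff FC; split.
  exists C, c => t.
  exact: (cvgr_to_le (cvg_norm (Ff t)) (nearW _ (fun m => FC m t))).
move=> h Xh; have [[D [d hD]] _] := Xh.
apply: (@X_dom (fun n t => F n t * h t) _ (C * D) (c + d)).
- by move=> n; have [_] := MF n; exact.
- by move=> t; apply: cvgMr_tmp; exact: Ff.
- by move=> n; exact: exp_boundedM.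
Qed.

Let M_lin a f h : M f -> M h -> M (fun t => a * f t + h t).
Proof.
move=> [[C [c fC]] Mf] [[D [d hD]] Mh].
have lb (f1 h1 : R -> R) C1 c1 D1 d1 : exp_bounded f1 C1 c1 -> exp_bounded h1 D1 d1 ->
    exists E e, exp_bounded (fun t => a * f1 t + h1 t) E e.
  move=> b1 b2; exists (`|a| * `|C1| + `|D1|), (Num.max c1 d1) => t.
  rewrite mulrDl (le_trans (ler_normD _ _))// lerD//.
    rewrite normrM -mulrA ler_wpM2l//.
    by apply: (exp_boundedW b1) => //; rewrite ?ler_norm// le_max lexx.
  by apply: (exp_boundedW b2) => //; rewrite ?ler_norm// le_max lexx orbT.
split; first exact: lb fC hD.
move=> u Xu; have [[E1 [e1 b1]] K1] := Mf u Xu; have [[E2 [e2 b2]] K2] := Mh u Xu.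
split.
  have [E [e b]] := lb _ _ _ _ _ _ b1 b2; exists E, e => t.
  by have := b t; rewrite mulrA -mulrDl.
move=> s; apply: K_ext (K_lin a (K1 s) (K2 s)) _ => t; ring.
Qed.

Let M_mul f h : M f -> M h -> M (fun t => f t * h t).
Proof.
move=> [[C [c fC]] Mf] [[D [d hD]] Mh]; split.
  by exists (C * D), (c + d); exact: exp_boundedM.
move=> u /Mh /Mf; congr X; apply/funext => t; exact: mulrA.
Qed.

Let M_exp s : M (fun t => expR (s * t)).
Proof.
split; first by exists 1, `|s|; exact: exp_bounded_exp.
move=> f [[C [c fC]] Kf]; split.
  by exists (1 * C), (`|s| + c); apply: exp_boundedM.
move=> r; apply: K_ext (Kf (r + s)) _ => t.
by rewrite mulrDl expRD; ring.
Qed.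

Let M_ext f h : M f -> f =1 h -> M h.
Proof. by move=> Mf /funext <-. Qed.

Let M1 : M (fun=> 1).
Proof. by apply: M_ext (M_exp 0) _ => t; rewrite mul0r expR0. Qed.

Let M_cst a : M (fun=> a).
Proof.
apply: M_ext (M_lin (a - 1) M1 M1) _ => t; by rewrite mulr1 subrK.
Qed.

Let M_X n f : M f -> M (fun t => f t ^+ n).
Proof.
move=> Mf; elim: n => [|n IH]; first by apply: M_ext M1 _ => t; rewrite expr0.
by apply: M_ext (M_mul Mf IH) _ => t; rewrite exprS.
Qed.

Let M_scale a f : M f -> M (fun t => a * f t).
Proof. by move=> Mf; apply: M_ext (M_mul (M_cst a) Mf) _. Qed.

Let M_sum (I : Type) (s : seq I) (F : I -> R -> R) : (forall i, M (F i)) ->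
  M (fun t => \sum_(i <- s) F i t).
Proof.
move=> MF; elim: s => [|i s IH].
  by apply: M_ext (M_cst 0) _ => t; rewrite big_nil.
by apply: M_ext (M_lin 1 (MF i) IH) _ => t; rewrite big_cons mul1r.
Qed.

(** t is the limit of n (exp(t/n) - 1), dominated by exp(2 |t|). *)
Let M_id : M (fun t => t).
Proof.
apply: (@M_dom (fun n t => n.+1%:R * (expR (n.+1%:R^-1 * t) - 1)) _ 1 2).
- move=> n; apply: M_scale.
  by apply: M_ext (M_lin 1 (M_exp n.+1%:R^-1) (M_cst (-1))) _ => t; rewrite mul1r.
- move=> t.
  apply: (@squeeze_cvgr _ _ _ _ (fun=> t) (fun n => t * expR (n.+1%:R^-1 * t))).
  + apply: nearW => n; have /andP[h1 h2] := expR_sub1_le (n.+1%:R^-1 * t).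
    have n0 : 0 < n.+1%:R :> R by [].
    have nv : n.+1%:R * (n.+1%:R^-1 * t) = t by rewrite mulrA mulfV ?mul1r// gt_eqF.
    apply/andP; split; first by rewrite -{1}nv ler_wpM2l// ltW.
    by rewrite -{2}nv -mulrA ler_wpM2l// ltW.
  + exact: cvg_cst.
  + rewrite [X in _ --> X](_ : t = t * expR 0); last by rewrite expR0 mulr1.
    apply: cvgMl_tmp.
    apply: continuous_cvg; first exact: continuous_expR.
    by apply: (@cvg_harmonic_le _ _ _ `|t|) => n; rewrite subr0 normrM mulrC normfV normr_nat.
move=> n t; have n0 : 0 < n.+1%:R :> R by [].
set v := n.+1%:R^-1 * t.
have vt : `|v| <= `|t|.
  rewrite /v normrM ger0_norm// ler_piMl// invf_le1// ler1n//.
have nv : n.+1%:R * v = t by rewrite /v mulrA mulfV ?mul1r// gt_eqF.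
have h : `|expR v - 1| <= `|v| * expR `|v|.
  have /andP[h1 h2] := expR_sub1_le v.
  have e1 : 1 <= expR `|v| by rewrite -expR0 ler_expR.
  have e2 : expR v <= expR `|v| by rewrite ler_expR ler_norm.
  have := ler_norm v; have := ler_norm (- v); rewrite normrN => a1 a2.
  have v0 := normr_ge0 v; have ev := expR_ge0 v.
  by rewrite ler_norml; apply/andP; split; nra.
rewrite normrM ger0_norm ?ler0n// (le_trans (ler_wpM2l (ler0n _ _) h))// mulrA.
rewrite -{1}[n.+1%:R]ger0_norm ?ler0n// -normrM nv mul1r.
apply: (@le_trans _ _ (expR `|t| * expR `|t|)); last by rewrite -expRD mulr_natl mulr2n.
rewrite ler_pM// ?expR_ge0// ?ler_expR//.
by have := expR_ge1Dx `|t|; lra.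
Qed.

(** Sine is a bounded multiplier, unlike t; [bump] can therefore be applied to it with values in
    [0, 1]. The partial sums of its series are dominated by exp |a t + b|. *)
Let M_sin (a b : R) : M (fun t => sin (a * t + b)).
Proof.
pose F n t := series (sin_coeff (a * t + b)) n.
have Maff : M (fun t => a * t + b) by apply: M_lin; [exact: M_id|exact: M_cst].
apply: (@M_dom F _ (expR `|b|) `|a|).
- move=> n; apply: M_sum => k.
  apply: M_ext (M_scale ((odd k)%:R * (-1) ^+ k.-1./2 / k`!%:R) (M_X k Maff)) _ => t.
  by rewrite /sin_coeff /=; ring.
- move=> t; rewrite /F sin.unlock; exact: is_cvg_series_sin_coeff.
- move=> n t; apply: (le_trans (series_sin_coeff_le _ _)).
  rewrite -expRD ler_expR addrC (le_trans (ler_normD _ _))// normrM addrC//.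
Qed.

Let M_compl f : M f -> M (fun t => 1 - f t).
Proof. by move=> Mf; apply: M_ext (M_lin (-1) Mf M1) _ => t; rewrite mulN1r addrC. Qed.

Let M_ray tau : M (fun t => (t <= tau)%R%:R).
Proof.
apply: (@M_dom (fun n t => (0 <= sin ((tau - t) / n.+1%:R))%R%:R) _ 1 0); last first.
- by move=> n t; rewrite mul0r expR0 mulr1 normr_nat; case: (0 <= sin _).
- by move=> t; exact: cvg_ray.
move=> n; pose p t : R := (1 + sin ((tau - t) / n.+1%:R)) / 2.
have p01 t : 0 <= p t <= 1.
  by have := sin_le1 ((tau - t) / n.+1%:R); have := sin_geN1 ((tau - t) / n.+1%:R);
     rewrite /p => *; apply/andP; split; lra.
have Mp : M p.
  apply: M_ext (M_lin 2^-1 (M_sin (- n.+1%:R^-1) (tau / n.+1%:R)) (M_cst 2^-1)) _ => t.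
  have -> : - n.+1%:R^-1 * t + tau / n.+1%:R = (tau - t) / n.+1%:R by ring.
  by rewrite /p; ring.
apply: (@M_dom (fun m t => bump (p t) m) _ 1 0).
- by move=> m; apply: M_compl; apply: M_X; apply: M_compl; exact: M_X.
- move=> t; rewrite (_ : (0 <= sin _) = (2^-1 <= p t)); first exact: cvg_bump.
  by rewrite /p; move: (sin _) => x; apply/idP/idP; lra.
move=> m t; rewrite mul0r expR0 mulr1; have /andP[b0 b1] := bump_itv m (p01 t).
by rewrite ger0_norm.
Qed.

Let ind (B : set R) (t : R) : R := \1_B t.

Let ind_itv B t : 0 <= ind B t <= 1.
Proof. by rewrite /ind indicE; case: (_ \in _); rewrite ?lexx ?ler01. Qed.

(** The products 1 - prod (1 - 1_B) need no disjointness and stay in [0, 1], which provides the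
    domination. *)
Let M_bigcup (B : nat -> set R) : (forall i, M (ind (B i))) -> M (ind (\bigcup_i B i)).
Proof.
move=> MB.
pose F n t := 1 - \prod_(0 <= i < n) (1 - ind (B i) t).
have MF n : M (F n).
  apply: M_compl; elim: n => [|n IH].
    by apply: M_ext M1 _ => t; rewrite big_geq.
  by apply: M_ext (M_mul IH (M_compl (MB n))) _ => t; rewrite big_nat_recr.
apply: (@M_dom F _ 1 0) => //.
- move=> t; rewrite /ind indicE; case: (boolP (t \in _)) => [|tB].
    rewrite inE => -[i _ Bi]; apply: (@cvg_near_cst _ _ _ _ _).
    exists i.+1 => // n /= ni; rewrite /F (bigD1_seq i) ?iota_uniq//= ?mem_index_iota//.
    by rewrite /ind indicE mem_set// subrr mul0r subr0.
  apply: (@cvg_near_cst _ _ _ _ _); apply: nearW => n; rewrite /F big1 ?subrr// => i _.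
  rewrite /ind indicE memNset ?subr0// => Bi.
  by move: tB => /negP; apply; rewrite inE; exists i.
move=> n t; rewrite mul0r expR0 mulr1 /F.
have : 0 <= \prod_(0 <= i < n) (1 - ind (B i) t) <= 1.
  elim: n => [|n /andP[h1 h2]]; first by rewrite big_geq// ler01 lexx.
  rewrite big_nat_recr//=; have /andP[b0 b1] := ind_itv (B n) t.
  by rewrite mulr_ge0 ?subr_ge0// mulr_ile1 ?subr_ge0//; lra.
by move=> /andP[h1 h2]; rewrite ger0_norm; lra.
Qed.

Let M_measurable (B : set R) : measurable B -> M (ind B).
Proof.
move=> mB; have : (@RGenOInfty.G R).-sigma.-measurable B.
  by rewrite -RGenOInfty.measurableE.
apply: (smallest_sub (C := sigma_algebra setT) (G := @RGenOInfty.G R) (X := [set B | M (ind B)])).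
  split.
  - by apply: M_ext (M_cst 0) _ => t; rewrite /ind indic0.
  - move=> A MA /=; apply: M_ext (M_compl MA) _ => t.
    by rewrite setTD /ind !indicE in_setC; case: (_ \in _) => /=; rewrite ?subrr ?subr0.
  - exact: M_bigcup.
move=> _ [x ->] /=; apply: M_ext (M_compl (M_ray x)) _ => t.
rewrite /ind indicE (_ : (t \in `]x, +oo[%classic) = (x < t)); last first.
  by apply/idP/idP; rewrite inE /= in_itv /= andbT.
by rewrite ltNge; case: (t <= x); rewrite ?subrr ?subr0.
Qed.

Import HBNNSimple.

Let K_nonneg (f : R -> R) : measurable_fun setT f -> (forall t, 0 <= f t) ->
  (N2 f < +oo)%E -> K f.
Proof.
move=> mf f0 fN.
have g0 t : 0 < gam t by rewrite expR_gt0.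
(* Multipliers act on the Gaussian, so f is written as gamma h and h is approximated from below by
   simple functions; f^2 is then the dominating function. *)
pose h t := f t / gam t.
have mh : measurable_fun setT (EFin \o h).
  apply/measurable_EFinP; apply: measurable_funM => //.
  have -> : (fun t => (gam t)^-1) = (fun t : R => expR (t ^+ 2)).
    by apply/funext => t; rewrite /gauss_fun expRN invrK.
  by apply: measurableT_comp => //; exact: measurable_funX.
have h0 t : setT t -> (0 <= (EFin \o h) t)%E.
  by move=> _; rewrite /= lee_fin divr_ge0// ltW.
pose F n : R -> R := nnsfun_approx measurableT mh n.
have Fh t : F n t @[n --> \oo] --> h t.
  have /fine_cvgP[_] := cvg_nnsfun_approx measurableT mh h0 (I : setT t).
  exact.
have Fle n t : 0 <= F n t <= h t.
  have nd : nondecreasing_seq (F ^~ t).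
    by move=> a b ab; have := nd_nnsfun_approx measurableT mh ab; move=> /lefP; exact.
  have cF : cvgn (F ^~ t) by apply/cvg_ex; exists (h t); exact: Fh.
  have := nondecreasing_cvgn_le nd cF n; rewrite (cvg_lim _ (Fh t))// => ->.
  by rewrite andbT.
apply: (@K_dom (fun n t => gam t * F n t) f (fun t => f t ^+ 2)).
- move=> n; have MF : M (F n).
    apply: M_ext; last by move=> t; rewrite /F fimfunE fsbig_finite//=.
    apply: M_sum => y; apply: M_scale; apply: M_measurable.
    exact: measurable_funPTI.
  have [_ /(_ _ X1)[_ /(_ 0) KF]] := MF.
  by apply: K_ext KF _ => t; rewrite mul0r expR0 mul1r mulr1.
- move=> t; have -> : f t = gam t * h t by rewrite mulrC divfK// gt_eqF.
  by apply: cvgMl_tmp; exact: Fh.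
- apply/integrableP; split; first exact: measurable_sqr.
  rewrite (_ : (\int[_]_(x in _) _)%E = N2 f)//.
  by apply: eq_integral => t _ /=; rewrite ger0_norm// sqr_ge0.
move=> n t; have /andP[a1 a2] := Fle n t.
have b1 : gam t * F n t <= f t by rewrite mulrC -ler_pdivlMr.
have b2 : 0 <= gam t * F n t by rewrite mulr_ge0// ltW.
have := f0 t; nra.
Qed.

Lemma gauss_translates_dense (f : R -> R) : measurable_fun setT f ->
  (N2 f < +oo)%E -> K f.
Proof.
move=> mf fN.
have part (g : R -> R) : measurable_fun setT g -> (forall t, 0 <= g t <= `|f t|) -> K g.
  move=> mg gf; apply: K_nonneg => //; first by move=> t; case/andP: (gf t).
  apply: le_lt_trans fN; apply: N2_le => // t.
  have /andP[g0 g1] := gf t.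
  by rewrite -[f t ^+ 2]real_normK ?num_real// ler_pXn2r ?nnegrE.
have mn : measurable_fun setT (fun t : R => `|f t|) by exact: measurableT_comp.
have Kp : K (fun t => (`|f t| + f t) / 2).
  apply: part; first by apply: measurable_funM => //; exact: measurable_funD.
  move=> t; have := ler_norm (f t); have := ler_norm (- f t); rewrite normrN => *.
  by apply/andP; split; lra.
have Km : K (fun t => (`|f t| - f t) / 2).
  apply: part; first by apply: measurable_funM => //; exact: measurable_funB.
  move=> t; have := ler_norm (f t); have := ler_norm (- f t); rewrite normrN => *.
  by apply/andP; split; lra.
by apply: K_ext (K_lin (-1) Km Kp) _ => t; field.
Qed.

End density.

(** * Products of the Gaussian with entire power series *)

Section rapid.
Variable R : realType.
Implicit Types (c : nat -> R).

(** Infinite radius of convergence, in the form of Cauchy estimates. *)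
Definition rapid c := forall r : R, 1 <= r -> exists C, forall j, `|c j| * r ^+ j <= C.

Lemma rapid_cvg c t : rapid c -> cvgn (pseries c t).
Proof.
move=> rc; have r1 : 1 <= 2 * `|t| + 1 by rewrite lerDr mulr_ge0.
have [C hC] := rc _ r1.
have C0 : 0 <= C by apply: le_trans (hC 0%N); rewrite mulr_ge0.
apply: normed_cvg; apply: (@series_le_cvg _ _ (geometric C 2^-1)).
- by move=> n; rewrite /= normr_ge0.
- by move=> n; rewrite /= mulr_ge0// exprn_ge0.
- move=> n /=; rewrite normrM normrX exprVn ler_pdivlMr ?exprn_gt0//.
  apply: le_trans (hC n); rewrite -mulrA ler_wpM2l// -exprMn lerXn2r ?nnegrE//; have := normr_ge0 t; lra.
by apply: is_cvg_geometric_series; rewrite ger0_norm ?invr_ge0//; lra.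
Qed.

Lemma natr_le_expn (n : nat) : n%:R <= 2 ^+ n :> R.
Proof. by rewrite -natrX ler_nat ltnW// ltn_expl. Qed.

Lemma rapid_diffs c : rapid c -> rapid (pseries_diffs c).
Proof.
move=> rc r r1; have r21 : 1 <= 2 * r by lra.
have [C hC] := rc _ r21; exists C => j; rewrite /pseries_diffs normrM normr_nat.
apply: le_trans (hC j.+1); rewrite exprMn (mulrC j.+1%:R) -mulrA ler_wpM2l//.
have r0 : 0 <= r ^+ j by rewrite exprn_ge0//; lra.
rewrite ler_pM ?natr_le_expn//.
by rewrite exprS ler_peMl.
Qed.

Definition coef_shift c j : R := if j is i.+1 then c i else 0.

Lemma rapid_shift c : rapid c -> rapid (coef_shift c).
Proof.
move=> rc r r1; have [C hC] := rc _ r1; have C0 : 0 <= C.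
  by apply: le_trans (hC 0%N); rewrite mulr_ge0// exprn_ge0//; lra.
exists (C * r) => -[|j] /=.
  by rewrite normr0 mul0r mulr_ge0//; lra.
by rewrite exprSr mulrA ler_wpM2r//; lra.
Qed.

Lemma rapid_lin a c d : rapid c -> rapid d -> rapid (fun j => a * c j + d j).
Proof.
move=> rc rd r r1; have [C hC] := rc _ r1; have [D hD] := rd _ r1.
exists (`|a| * C + D) => j.
have rj : 0 <= r ^+ j by rewrite exprn_ge0//; lra.
apply: (le_trans (ler_wpM2r rj (ler_normD _ _))); rewrite mulrDl lerD//.
by rewrite normrM -mulrA ler_wpM2l.
Qed.

Definition psum c t := limn (pseries c t).

Lemma psum_cvg c t : rapid c -> pseries c t @ \oo --> psum c t.
Proof. exact: rapid_cvg. Qed.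

Lemma is_derive_psum c t : rapid c ->
  is_derive t (1 : R) (psum c) (psum (pseries_diffs c) t).
Proof.
move=> rc; have rc1 := rapid_diffs rc; have rc2 := rapid_diffs rc1.
apply: (@pseries_snd_diffs _ c (`|t| + 1)); try exact: rapid_cvg.
by rewrite [X in _ < X]ger0_norm ?addr_ge0// ltrDl.
Qed.

Lemma psum_shift c t : rapid c -> psum (coef_shift c) t = t * psum c t.
Proof.
move=> rc; apply/cvg_lim => //; rewrite -cvg_shiftS.
rewrite (_ : (fun n => _) = (fun n => t * pseries c t n)).
  by apply: cvgMl_tmp; exact: psum_cvg.
apply/funext => n; rewrite /pseries /series /= big_nat_recl//= mul0r add0r mulr_sumr.
by apply: eq_bigr => i _; rewrite exprS mulrCA.
Qed.

Lemma psum_lin a c d t : rapid c -> rapid d ->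
  psum (fun j => a * c j + d j) t = a * psum c t + psum d t.
Proof.
move=> rc rd; apply/cvg_lim => //.
rewrite (_ : pseries _ t = (fun n => a * pseries c t n + pseries d t n)).
  by apply: cvgD; [apply: cvgMl_tmp|]; exact: psum_cvg.
apply/funext => n; rewrite /pseries /series /= mulr_sumr -big_split.
by apply: eq_bigr => i _ /=; rewrite mulrDl mulrA.
Qed.

Definition gauss_psum c t := gauss_fun t * psum c t.

(** Coefficients of the derivative: differentiating the Gaussian contributes the factor -2 t, that
    is, a shift. The class is thus stable under differentiation, which yields smoothness. *)
Definition gauss_diffs c j := -2 * coef_shift c j + pseries_diffs c j.

Lemma rapid_gauss_diffs c : rapid c -> rapid (gauss_diffs c).
Proof. by move=> rc; apply: rapid_lin; [exact: rapid_shift|exact: rapid_diffs]. Qed.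

Lemma is_derive_gauss_psum c t : rapid c ->
  is_derive t (1 : R) (gauss_psum c) (gauss_psum (gauss_diffs c) t).
Proof.
move=> rc; have h1 := is_derive_psum t rc.
have h2 : is_derive t (1 : R) (@gauss_fun R) (-2 * t * gauss_fun t).
  rewrite /gauss_fun; apply: is_derive_eq.
  by rewrite /GRing.scale /= mulr1; ring.
have := is_deriveM h2 h1.
rewrite (_ : gauss_fun t *: _ + _ = gauss_psum (gauss_diffs c) t)//.
rewrite /gauss_psum /gauss_diffs psum_lin; [|exact: rapid_shift|exact: rapid_diffs].
by rewrite psum_shift// /GRing.scale /=; ring.
Qed.

Lemma derive1n_gauss_psum c n : rapid c ->
  derive1n n (gauss_psum c) = gauss_psum (iter n gauss_diffs c).
Proof.
move=> rc; elim: n => [//|n IH].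
have rn : rapid (iter n gauss_diffs c).
  by elim: n {IH} => [//|n IH] /=; exact: rapid_gauss_diffs.
rewrite derive1nS IH; apply/funext => t; rewrite derive1E.
by case: (is_derive_gauss_psum t rn).
Qed.

Lemma derivable_gauss_psum c n t : rapid c ->
  derivable (derive1n n (gauss_psum c)) t 1.
Proof.
move=> rc; rewrite derive1n_gauss_psum//.
have rn : rapid (iter n gauss_diffs c).
  by elim: n => [//|n IH] /=; exact: rapid_gauss_diffs.
by case: (is_derive_gauss_psum t rn).
Qed.

Lemma continuous_gauss_psum c : rapid c -> continuous (gauss_psum c).
Proof.
move=> rc t; apply: differentiable_continuous; apply/derivable1_diffP.
exact: (@derivable_gauss_psum _ 0).
Qed.

Lemma smooth_gauss_psum c : rapid c -> smooth (fun t => (gauss_psum c t)%:C%C).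
Proof.
move=> rc n t; split => /=; first exact: derivable_gauss_psum.
have r0 : rapid (fun=> 0) by move=> r _; exists 0 => j; rewrite normr0 mul0r.
have -> : (fun=> 0) = gauss_psum (fun=> 0).
  apply/funext => s; rewrite /gauss_psum.
  rewrite /psum (_ : pseries _ s = (fun=> 0)) ?lim_cst ?mulr0//.
  apply/funext => n'; rewrite /pseries /series /= big1// => i _.
  by rewrite mul0r.
exact: derivable_gauss_psum.
Qed.

Lemma half_sum (n : nat) : \sum_(0 <= j < n) (2^-1 : R) ^+ j <= 2.
Proof.
suff -> : \sum_(0 <= j < n) (2^-1 : R) ^+ j = 2 - 2 * 2^-1 ^+ n.
  by rewrite lerBlDr lerDl mulr_ge0// exprn_ge0// invr_ge0.
elim: n => [|n IH]; first by rewrite big_geq// expr0; ring.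
by rewrite big_nat_recr//= IH exprS; field.
Qed.

(** Once k >= 2 |t|, the weight k^j dominates (2 |t|)^j, so the coefficient errors sum to at most 2
    (1/2)^k. *)
Lemma psum_cvg_seq (th : nat -> nat -> R) c t : rapid c -> (forall k, rapid (th k)) ->
  (forall k j, `|th k j - c j| * k%:R ^+ j <= (1 / 2) ^+ k) ->
  psum (th k) t @[k --> \oo] --> psum c t.
Proof.
move=> rc rth h.
have [N [N0 NP]] := large_nat (2 * `|t|).
have key k : (N <= k)%N -> `|psum (th k) t - psum c t| <= (1 / 2) ^+ k * 2.
  move=> Nk; have -> : psum (th k) t - psum c t = psum (fun j => -1 * c j + th k j) t.
    by rewrite psum_lin// mulN1r addrC.
  have rd : rapid (fun j => -1 * c j + th k j) by exact: rapid_lin.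
  have cv := cvg_norm (psum_cvg (t := t) rd) _.
  apply: (cvgr_to_le (cv _)); apply: nearW => n.

  rewrite /pseries /series /=.
  apply: (le_trans (ler_norm_sum _ _ _)).
  apply: (@le_trans _ _ (\sum_(0 <= j < n) (1 / 2) ^+ k * (2^-1) ^+ j)).
    apply: ler_sum => j _; rewrite normrM normrX mulN1r addrC.
    rewrite exprVn ler_pdivlMr ?exprn_gt0// -mulrA -exprMn.
    apply: le_trans (h k j); rewrite ler_wpM2l// lerXn2r ?nnegrE ?mulr_ge0//.
    by rewrite mulrC (le_trans NP)// ler_nat.
  rewrite -mulr_sumr ler_wpM2l ?exprn_ge0//.
  exact: half_sum.
apply/cvgrPdist_le => e e0.
have [m hm] : exists m, (1 / 2 : R) ^+ m * 2 <= e.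
  have h12 : 0 < (1 / 2 : R) <= 1 by apply/andP; split; lra.
  have [m hm] := small_pow h12 (divr_gt0 e0 (ltr0Sn _ 1)).
  exists m; move: hm; have -> : 1 - 1 / 2 = 1 / 2 :> R by lra.
  lra.
exists (N + m)%N => // k /= Nk; rewrite distrC (le_trans (key k _))//.
  exact: leq_trans (leq_addr _ _) Nk.
apply: le_trans hm; rewrite ler_wpM2r// ler_wiXn2l//; try lra.
exact: leq_trans (leq_addl _ _) Nk.
Qed.

End rapid.

(** * Entire extension of the power series *)

Section complex_series.
Local Open Scope complex_scope.
Variable R : realType.
Local Notation normc := ComplexField.Normc.normc.
Local Notation Re := complex.Re.
Local Notation Im := complex.Im.
Implicit Types (c : nat -> R) (z h : R[i]).

Definition ccvg (u : nat -> R[i]) (l : R[i]) : Prop :=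
  Re (u n) @[n --> \oo] --> Re l /\ Im (u n) @[n --> \oo] --> Im l.

Lemma ccvgB u v k l : ccvg u k -> ccvg v l -> ccvg (fun n => u n - v n) (k - l).
Proof.
case: k l => [a b] [a' b'] [u1 u2] [v1 v2]; split.
  rewrite (_ : (fun n => _) = (fun n => Re (u n) - Re (v n))); first exact: cvgB.
  by apply/funext => n; case: (u n) (v n) => [? ?] [? ?].
rewrite (_ : (fun n => _) = (fun n => Im (u n) - Im (v n))); first exact: cvgB.
by apply/funext => n; case: (u n) (v n) => [? ?] [? ?].
Qed.

Lemma ccvgMl h u l : ccvg u l -> ccvg (fun n => h * u n) (h * l).
Proof.
case: h l => [a b] [a' b'] [u1 u2]; split => /=.
  rewrite (_ : (fun n => _) = (fun n => a * Re (u n) - b * Im (u n))).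
    by apply: cvgB; exact: cvgMl_tmp.
  by apply/funext => n; case: (u n).
rewrite (_ : (fun n => _) = (fun n => a * Im (u n) + b * Re (u n))).
  by apply: cvgD; exact: cvgMl_tmp.
by apply/funext => n; case: (u n).
Qed.

Lemma ccvg_normc_le u l (b : R) : ccvg u l -> (forall n, normc (u n) <= b) ->
  normc l <= b.
Proof.
move=> [u1 u2] ub.
have b0 : 0 <= b by apply: le_trans (ub 0%N); exact: normc_ge0.
rewrite -(@ler_pXn2r _ 2%N)// ?nnegrE ?normc_ge0// -sqmod_normc.
have cv : (fun n => Re (u n) * Re (u n) + Im (u n) * Im (u n)) @ \oo -->
    Re l * Re l + Im l * Im l by apply: cvgD; exact: cvgM.
rewrite /sqmod !expr2; apply: (cvgr_to_le cv); apply: nearW => n.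
rewrite -!expr2 -/(sqmod (u n)) sqmod_normc.
by rewrite ler_pXn2r ?nnegrE ?normc_ge0.
Qed.

Definition cpart c z n : R[i] := \sum_(0 <= j < n) (c j)%:C * z ^+ j.

Definition cpsum c z : R[i] :=
  limn (fun n => Re (cpart c z n)) +i* limn (fun n => Im (cpart c z n)).

Lemma normr_Re z : `|Re z| <= normc z.
Proof.
case: z => a b /=; rewrite -sqrtr_sqr ler_sqrt ?addr_ge0 ?sqr_ge0//.
by rewrite lerDl sqr_ge0.
Qed.

Lemma normr_Im z : `|Im z| <= normc z.
Proof.
case: z => a b /=; rewrite -sqrtr_sqr ler_sqrt ?addr_ge0 ?sqr_ge0//.
by rewrite lerDr sqr_ge0.
Qed.

Lemma normcX z n : normc (z ^+ n) = normc z ^+ n.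
Proof.
elim: n => [|n IH]; first by rewrite !expr0 normc_real normr1.
by rewrite !exprS ComplexField.Normc.normcM IH.
Qed.

Lemma rapid_normcvg c r : rapid c -> 0 <= r -> cvgn (series (fun j => `|c j| * r ^+ j)).
Proof.
move=> rc r0; have ra : rapid (fun j => `|c j|).
  by move=> s s1; have [C hC] := rc _ s1; exists C => j; rewrite normr_id.
exact: (@rapid_cvg R _ r ra).
Qed.

Lemma cpart_Re c z n : Re (cpart c z n) = series (fun j => c j * Re (z ^+ j)) n.
Proof.
elim: n => [|n IH]; first by rewrite /cpart /series /= !big_geq.
rewrite /cpart /series /= !big_nat_recr//= -/(cpart c z n) -[X in _ = X + _]IH.
by case: (cpart c z n) (z ^+ n) => [? ?] [? ?] /=; rewrite mul0r subr0.
Qed.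

Lemma cpart_Im c z n : Im (cpart c z n) = series (fun j => c j * Im (z ^+ j)) n.
Proof.
elim: n => [|n IH]; first by rewrite /cpart /series /= !big_geq.
rewrite /cpart /series /= !big_nat_recr//= -/(cpart c z n) -[X in _ = X + _]IH.
by case: (cpart c z n) (z ^+ n) => [? ?] [? ?] /=; rewrite mul0r addr0.
Qed.

Lemma cpart_ccvg c z : rapid c -> ccvg (cpart c z) (cpsum c z).
Proof.
move=> rc; have cn := rapid_normcvg rc (normc_ge0 z).
split => /=.
  suff : cvgn (fun n => Re (cpart c z n)) by [].
  under eq_fun do rewrite cpart_Re.
  apply: normed_cvg; apply: series_le_cvg cn => [n|n|n] /=.
  - exact: normr_ge0.
  - by rewrite mulr_ge0// exprn_ge0// normc_ge0.
  - by rewrite normrM ler_wpM2l// -normcX normr_Re.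
suff : cvgn (fun n => Im (cpart c z n)) by [].
under eq_fun do rewrite cpart_Im.
apply: normed_cvg; apply: series_le_cvg cn => [n|n|n] /=.
- exact: normr_ge0.
- by rewrite mulr_ge0// exprn_ge0// normc_ge0.
- by rewrite normrM ler_wpM2l// -normcX normr_Im.
Qed.

Lemma expr_second_order z h (r : R) j : 1 <= r -> normc (z + h) <= r -> normc z <= r ->
  normc ((z + h) ^+ j - z ^+ j - j%:R * h * z ^+ j.-1) <=
  normc h ^+ 2 * (j%:R ^+ 2 * r ^+ j).
Proof.
move=> r1 zhr zr; elim: j => [|j IH].
  by rewrite !expr0 subrr !mul0r subr0 normc_real normr0 expr0n /= mul0r mulr0.
set D := (z + h) ^+ j - _ - _ in IH.
have zj : j%:R * z ^+ j = (j%:R * z ^+ j.-1) * z :> R[i].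
  by case: (j) => [|k]; rewrite ?mul0r//= exprSr mulrA.
have -> : (z + h) ^+ j.+1 - z ^+ j.+1 - j.+1%:R * h * z ^+ j.+1.-1 =
   (z + h) * D + (j%:R * z ^+ j.-1) * (h * h).
  have -> : j.+1%:R * h * z ^+ j = h * (j%:R * z ^+ j) + h * z ^+ j.
    by rewrite -natr1; ring.
  by rewrite /= zj /D !exprS; ring.
apply: (le_trans (le_normcD _ _)).
rewrite !ComplexField.Normc.normcM.
have r0 : 0 <= r by lra.
have rj0 : 0 <= r ^+ j by rewrite exprn_ge0.
have nj : normc (j%:R : R[i]) = j%:R.
  by rewrite -(rmorph_nat (real_complex R)) normc_real normr_nat.
have zj1 : normc (z ^+ j.-1) <= r ^+ j.
  rewrite normcX (le_trans (lerXn2r _ _ _ zr)) ?nnegrE ?normc_ge0//.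
  by case: (j) => [|k] //=; rewrite exprS ler_peMl// exprn_ge0.
have h20 := sqr_ge0 (normc h).
have t1 : normc (z + h) * normc D <= r * (normc h ^+ 2 * (j%:R ^+ 2 * r ^+ j)).
  by rewrite ler_pM// ?normc_ge0.
have t2 : normc (j%:R : R[i]) * normc (z ^+ j.-1) * (normc h * normc h) <=
    j%:R * r ^+ j * normc h ^+ 2.
  by rewrite -expr2 ler_wpM2r// nj ler_wpM2l.
apply: (le_trans (lerD t1 t2)); rewrite -natr1 [r ^+ j.+1]exprS.
have j0 : 0 <= j%:R :> R by [].
set H := normc h ^+ 2 in h20 *; set P := r ^+ j in rj0 *.
have : j%:R * P * H <= j%:R * (r * P) * H.
  by rewrite ler_wpM2r// ler_wpM2l// ler_peMl.
have : 0 <= (j%:R + 1) * (r * P) * H.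
  by rewrite !mulr_ge0 ?normc_ge0// addr_ge0.
have -> : (j%:R + 1) * (r * P) * H = j%:R * (r * P) * H + r * P * H by ring.
set J : R := j%:R.
have -> : H * ((J + 1) ^+ 2 * (r * P)) = r * (H * (J ^+ 2 * P)) + 2 * (J * (r * P) * H) + r * P * H by ring.
lra.
Qed.

Lemma cpart_diffs c z n : cpart (pseries_diffs c) z n =
  \sum_(0 <= j < n.+1) (c j)%:C * (j%:R * z ^+ j.-1).
Proof.
rewrite big_nat_recl//= mul0r mulr0 add0r; apply: eq_bigr => j _.
by rewrite /pseries_diffs rmorphM /= rmorph_nat; ring.
Qed.

(** Termwise remainders carry a factor j^2 r^j; since j^2 <= 4^j they are summed by the series at 4
    r. A quadratic remainder gives the complex derivative. *)
Lemma cpsum_second_order c z : rapid c -> exists2 A : R, 0 <= A &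
  forall h, normc h <= 1 ->
  normc (cpsum c (z + h) - cpsum c z - h * cpsum (pseries_diffs c) z) <=
  A * normc h ^+ 2.
Proof.
move=> rc; pose r := normc z + 1.
have r1 : 1 <= r by rewrite /r lerDr normc_ge0.
have cn : cvgn (series (fun j => `|c j| * (4 * r) ^+ j)).
  by apply: rapid_normcvg => //; lra.
have t0 j : 0 <= `|c j| * (4 * r) ^+ j by rewrite mulr_ge0// exprn_ge0//; lra.
exists (limn (series (fun j => `|c j| * (4 * r) ^+ j))).
  by apply: limr_ge => //; apply: nearW => n; rewrite sumr_ge0.
move=> h h1.
have cv : ccvg (fun n => cpart c (z + h) n.+1 - cpart c z n.+1 -
    h * cpart (pseries_diffs c) z n)
   (cpsum c (z + h) - cpsum c z - h * cpsum (pseries_diffs c) z).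
  apply: ccvgB; last by apply: ccvgMl; apply: cpart_ccvg; exact: rapid_diffs.
  have [a1 a2] := ccvgB (cpart_ccvg (z + h) rc) (cpart_ccvg z rc).
  by split; [rewrite -cvg_shiftS in a1|rewrite -cvg_shiftS in a2].
apply: (ccvg_normc_le cv) => n.
rewrite cpart_diffs /cpart mulr_sumr -!sumrB.
apply: (le_trans (normc_sum _ _)).
apply: (@le_trans _ _ (normc h ^+ 2 * series (fun j => `|c j| * (4 * r) ^+ j) n.+1)).
  rewrite /series /= mulr_sumr; apply: ler_sum => j _.
  have -> : (c j)%:C * (z + h) ^+ j - (c j)%:C * z ^+ j - h * ((c j)%:C * (j%:R * z ^+ j.-1))
    = (c j)%:C * ((z + h) ^+ j - z ^+ j - j%:R * h * z ^+ j.-1) by ring.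
  rewrite ComplexField.Normc.normcM normc_real mulrCA ler_wpM2l//.
  apply: (le_trans (@expr_second_order z h r j r1 _ _)).
  - by apply: (le_trans (le_normcD _ _)); rewrite /r lerD2l.
  - by rewrite /r lerDl.
  rewrite ler_wpM2l ?sqr_ge0// exprMn ler_wpM2r ?exprn_ge0//; first lra.
  have -> : 4 = 2 ^+ 2 :> R by rewrite -natrX.
  by rewrite -exprM mulnC exprM lerXn2r ?nnegrE ?exprn_ge0// natr_le_expn.
rewrite mulrC ler_wpM2r ?sqr_ge0//.
apply: nondecreasing_cvgn_le => //.
by apply: nondecreasing_series => k _ _.
Qed.

Lemma cpsum_real c (t : R) : rapid c -> cpsum c t%:C = (psum c t)%:C.
Proof.
move=> rc; rewrite /cpsum.
have E n : cpart c t%:C n = (pseries c t n)%:C.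
  rewrite /cpart /pseries /series /= rmorph_sum; apply: eq_bigr => j _.
  by rewrite /= rmorphM rmorphXn.
rewrite (_ : (fun n => Re _) = pseries c t); last by apply/funext => n; rewrite E.
rewrite (_ : (fun n => Im _) = (fun=> 0)); last by apply/funext => n; rewrite E.
by rewrite lim_cst.
Qed.

Lemma derivable_cpsum c z : rapid c ->
  derivable (cpsum c : R[i]^o -> R[i]^o) z 1.
Proof.
move=> rc; have [A A0 hA] := cpsum_second_order z rc.
apply/cvg_ex; exists (cpsum (pseries_diffs c) z : R[i]^o).
apply/cvgrPdist_le => e e0.
have [e1 e1E e10] : exists2 e1 : R, e = e1%:C & 0 < e1.
  case: e e0 => a b; rewrite ltcE /= => /andP[/eqP -> a0]; by exists a.
pose d := Num.min 1 (e1 / (A + 1)).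
have d0 : 0 < d by rewrite lt_min ltr01 divr_gt0//; lra.
have dC0 : (0 : R[i]) < d%:C by rewrite ltcR.
apply/nbhs_ballP; exists d%:C => //= h; rewrite -ball_normE /ball_ /= sub0r normrN => hd h0.
have hn : normc h < d by move: hd; rewrite normc_def -ltcR; case: (h).
have nh0 : 0 < normc h.
  rewrite lt_def normc_ge0 andbT; apply/eqP => /ComplexField.Normc.eq0_normc hh.
  by rewrite hh eqxx in h0.
have h1 : normc h <= 1 by rewrite ltW// (lt_le_trans hn)// ge_min lexx.
have := hA h h1; set D := cpsum c _ - _ - _ => hD.
have -> : cpsum (pseries_diffs c) z - h^-1 *: (cpsum c (h *: (1 : R[i]^o) + z) - cpsum c z)
   = - (h^-1 * D) :> R[i].
  by rewrite /D /GRing.scale /= mulr1 [h + z]addrC [in RHS]mulrBr mulKf// opprB.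
rewrite normrN e1E.
have -> : `|h^-1 * D| = (normc (h^-1 * D))%:C by [].
rewrite lecR ComplexField.Normc.normcM ComplexField.Normc.normcV.
rewrite mulrC ler_pdivrMr// (le_trans hD)// expr2 mulrA ler_wpM2r ?normc_ge0//.
have : normc h <= e1 / (A + 1) by rewrite ltW// (lt_le_trans hn)// ge_min lexx orbT.
rewrite ler_pdivlMr; last lra.
have := normc_ge0 h; lra.
Qed.

(** Taylor coefficients of exp(-t^2): the Gaussian factor of g is extended to the complex plane as a
    power series too. *)
Definition gauss_coef (j : nat) : R :=
  if odd j then 0 else (-1) ^+ j./2 / (j./2)`!%:R.

Lemma rapid_gauss_coef : rapid gauss_coef.
Proof.
move=> r r1; exists (expR (r ^+ 2)) => j; rewrite /gauss_coef.
have [oj|ej] := boolP (odd j); first by rewrite normr0 mul0r expR_ge0.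
rewrite normrM normrX normrN1 expr1n mul1r normfV normr_nat mulrC.
rewrite -{1}(odd_double_half j) (negPf ej) add0n -muln2 mulnC exprM.
have r20 : 0 <= r ^+ 2 by rewrite sqr_ge0.
case: (j./2) => [|k].
  by rewrite expr0 fact0 invr1 mulr1 -expR0 ler_expR.
by have := expR_ge1Dxn k r20; lra.
Qed.

Lemma psum_gauss_coef t : psum gauss_coef t = gauss_fun t.
Proof.
have cv := psum_cvg (t := t) rapid_gauss_coef.
rewrite /gauss_fun /expR.
apply/esym/cvg_lim => //.
have dbl : (fun n => n.*2)%N @ \oo --> \oo.
  apply/cvgnyPge => A; exists A => // n /= An.
  by rewrite (leq_trans An)// -addnn leq_addr.
have := cvg_comp _ _ dbl cv; rewrite (_ : _ \o _ = series (exp_coeff (- t ^+ 2)))//.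
apply/funext => n /=; rewrite /pseries /series /=.
elim: n => [|n IH]; first by rewrite !big_geq.
rewrite doubleS !big_nat_recr//= IH -addrA; congr (_ + _).
rewrite /gauss_coef /= odd_double /= doubleK mul0r addr0.
rewrite /exp_coeff /= [(- t ^+ 2) ^+ n]exprNn -muln2 mulnC exprM; ring.
Qed.

Lemma entire_gauss_psum c : rapid c ->
  entire_on_reals (fun t => (gauss_psum c t)%:C).
Proof.
move=> rc; exists (fun z => cpsum gauss_coef z * cpsum c z); split.
  move=> z; apply: (@derivableM _ (R[i]^o)).
  - exact/derivable_cpsum/rapid_gauss_coef.
  - exact: derivable_cpsum.
move=> t; rewrite !cpsum_real//; last exact: rapid_gauss_coef.
by rewrite psum_gauss_coef -rmorphM.
Qed.

End complex_series.

(** * The inductive construction *)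

Section taylor.
Variable R : realType.
Implicit Types (x y : seq (R * R)).

(** gamma(t - s) = gamma(t) gamma(s) exp(2 s t); these are the Taylor coefficients in t of the
    quotient by gamma(t). *)
Definition gauss_taylor (s : R) (j : nat) : R := gauss_fun s * ((2 * s) ^+ j / j`!%:R).

Definition taylor x (j : nat) : R := lsum x (fun s => gauss_taylor s j).

Lemma expR_coeff_le (y : R) j : 0 <= y -> y ^+ j / j`!%:R <= expR y.
Proof.
move=> y0; case: j => [|j].
  by rewrite expr0 fact0 invr1 mulr1 -expR0 ler_expR.
by have := expR_ge1Dxn j y0; lra.
Qed.

Lemma gauss_taylor_le (r s : R) j : 0 <= r ->
  `|gauss_taylor s j| * r ^+ j <= gauss_fun s * expR (2 * r * `|s|).
Proof.
move=> r0; rewrite /gauss_taylor normrM ger0_norm ?gauss_fun_ge0// -[X in X <= _]mulrA ler_wpM2l ?gauss_fun_ge0//.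
rewrite normrM normfV normr_nat normrX mulrAC -exprMn normrM ger0_norm//.
have -> : 2 * `|s| * r = 2 * r * `|s| by ring.
by rewrite expR_coeff_le// !mulr_ge0.
Qed.

Lemma rapid_gauss_taylor s : rapid (gauss_taylor s).
Proof.
move=> r r1; exists (gauss_fun s * expR (2 * r * `|s|)) => j.
by apply: gauss_taylor_le; lra.
Qed.

Lemma psum_gauss_taylor s t : psum (gauss_taylor s) t = gauss_fun s * expR (2 * s * t).
Proof.
apply/cvg_lim => //.
rewrite (_ : pseries _ _ = (fun n => gauss_fun s * series (exp_coeff (2 * s * t)) n)).
  by apply: cvgMl_tmp; exact: is_cvg_series_exp_coeff.
apply/funext => n; rewrite /pseries /series /= mulr_sumr; apply: eq_bigr => j _.
by rewrite /gauss_taylor /exp_coeff /= !exprMn; ring.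
Qed.

Lemma taylor_cons a x j : taylor (a :: x) j = a.1 * gauss_taylor a.2 j + taylor x j.
Proof. by rewrite /taylor /lsum big_cons. Qed.

Lemma rapid_taylor x : rapid (taylor x).
Proof.
elim: x => [|a x IH].
  by move=> r _; exists 0 => j; rewrite /taylor /lsum big_nil normr0 mul0r.
rewrite (_ : taylor _ = (fun j => a.1 * gauss_taylor a.2 j + taylor x j)).
  by apply: rapid_lin => //; exact: rapid_gauss_taylor.
by apply/funext => j; rewrite taylor_cons.
Qed.

Lemma act_gauss x t : act x (@gauss_fun R) t = gauss_psum (taylor x) t.
Proof.
rewrite /gauss_psum; elim: x => [|a x IH].
  rewrite /act /lsum big_nil /psum (_ : pseries _ _ = (fun=> 0)) ?lim_cst ?mulr0//.
  apply/funext => n; rewrite /pseries /series /= big1// => j _.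
  by rewrite /taylor /lsum big_nil mul0r.
rewrite (_ : taylor _ = (fun j => a.1 * gauss_taylor a.2 j + taylor x j)); last first.
  by apply/funext => j; rewrite taylor_cons.
rewrite psum_lin; [|exact: rapid_gauss_taylor|exact: rapid_taylor].
rewrite mulrDr -IH /act /lsum big_cons psum_gauss_taylor; congr (_ + _).
rewrite mulrCA; congr (_ * _); rewrite /gauss_fun -!expRD; congr expR; ring.
Qed.

Lemma vanishing_gauss (r : R) : 0 <= r ->
  vanishing (fun s : R => gauss_fun s * expR (2 * r * `|s|)).
Proof.
move=> r0; pose b := 2 * r + 1.
apply: (@vanishing_inv _ _ (expR (b ^+ 2))); first exact: expR_ge0.
move=> s; rewrite ger0_norm ?mulr_ge0 ?gauss_fun_ge0 ?expR_ge0//.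
have s0 := normr_ge0 s.
rewrite ler_pdivlMr; last lra.
apply: (@le_trans _ _ (gauss_fun s * expR (2 * r * `|s|) * expR `|s|)).
  by rewrite ler_wpM2l ?mulr_ge0 ?gauss_fun_ge0 ?expR_ge0// expR_ge1Dx.
rewrite /gauss_fun -!expRD ler_expR.
have -> : s ^+ 2 = `|s| ^+ 2 by rewrite real_normK// num_real.
by rewrite /b; have := sqr_ge0 (2 * r + 1 - `|s|); nra.
Qed.

End taylor.

Section int_shift.
Variable R : realType.
Implicit Types (x y : seq (R * R)).

(** Integer shifts keep rational translates rational, so approximate inverses involve only
    translates of g that the construction treats. *)
Definition int_shift x := forall a, a \in x -> a.2 \is a Num.int.

Lemma int_shift_one : int_shift lone.
Proof. by move=> a; rewrite inE => /eqP -> /=; exact: rpred0. Qed.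

Lemma int_shift_cat x y : int_shift x -> int_shift y -> int_shift (x ++ y).
Proof. by move=> hx hy a; rewrite mem_cat => /orP[/hx|/hy]. Qed.

Lemma int_shift_scale c x : int_shift x -> int_shift (lscale c x).
Proof. by move=> hx a /mapP[b /hx hb ->]. Qed.

Lemma int_shift_mul x y : int_shift x -> int_shift y -> int_shift (lmul x y).
Proof.
by move=> hx hy a /allpairsP[[b c] /= [/hx hb /hy hc ->]]; exact: rpredD.
Qed.

Lemma int_shift_adj x : int_shift x -> int_shift (ladj x).
Proof. by move=> hx a /mapP[b /hx hb ->] /=; rewrite rpredN. Qed.

Lemma int_shift_emb d p : int_shift (@emb R d p).
Proof.
by move=> a /mapP[b _ ->] /=; apply: rpredM; [exact: natr_int|exact: intr_int].
Qed.

Lemma int_shift_neumann S n : int_shift S -> int_shift (neumann S n).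
Proof.
move=> hS; elim: n => [//|n IH] /=.
by apply: (@int_shift_cat lone); [exact: int_shift_one|exact: int_shift_mul].
Qed.

Lemma approx_inv_one k : (forall y : seq (R * R), 0 <= nrm2 k y) ->
  approx_inv k int_shift lone.
Proof.
move=> kp e e0; exists lone; first exact: int_shift_one.
move=> y; rewrite (_ : nrm2 _ _ = 0); first by rewrite mulr_ge0// ltW.
rewrite (nrm2_eqv k (q := [::])) ?/nrm2 /lform ?big_nil//.
move=> F; rewrite lsum_cat lsum_scale (lmul1 _ F) (lmul1 _ F) mulN1r subrr.
by rewrite /lsum big_nil.
Qed.

(** The factor 2 in the bound on M gives the Gram operator norm at most 1/2, hence the ratio 1/4 for
    squared norms in the Neumann series. *)
Lemma approx_inv_filter k M (H : seq (R * R)) r :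
  (forall s, k (- s) = k s) -> (forall y : seq (R * R), 0 <= nrm2 k y) ->
  int_shift H -> 0 < M -> 2 * lnorm1 H ^+ 2 <= M ->
  approx_inv k int_shift (lfilter M H r).
Proof.
move=> ke kp hH M0 HM; rewrite /lfilter; elim: r => [|r IH] /=.
  exact: approx_inv_one.
apply: approx_inv_mul => //; first exact: int_shift_mul.
have hS : int_shift (lgram M H).
  by apply: int_shift_scale; apply: int_shift_mul => //; exact: int_shift_adj.
apply: approx_inv_compl => //.
- by move=> n; exact: int_shift_neumann.
- move=> y; apply: (le_trans (nrm2_mul_le ke kp _ _)); rewrite ler_wpM2r//.
  rewrite /lgram lnorm1_scale lnorm1_mul lnorm1_adj -expr2 ger0_norm ?invr_ge0 ?(ltW M0)//.
  have h0 : 0 <= M^-1 * lnorm1 H ^+ 2 by rewrite mulr_ge0 ?sqr_ge0// invr_ge0 ltW.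
  have h1 : M^-1 * lnorm1 H ^+ 2 <= 2^-1.
    by rewrite mulrC ler_pdivrMr//; lra.
  by have -> : 4^-1 = 2^-1 ^+ 2 :> R; [field|rewrite lerXn2r ?nnegrE].
- move=> e e0; have h34 : 0 < (3 / 4 : R) <= 1 by apply/andP; split; lra.
  have [n hn] := small_pow h34 e0; exists n.
  by move: hn; have -> : 1 - 3 / 4 = 4^-1 :> R by field.
Qed.

End int_shift.

(** * The growth and separation conditions on Lambda *)

Section frequencies.
Variable R : realType.
Variable eps : nat -> R.
Hypothesis eps0 : forall n, 0 < eps n.
Hypothesis eps_cvg : eps n @[n --> \oo] --> (0 : R).
Implicit Types (L : seq R).

Definition valid L := [/\ (0 < size L)%N, 1 <= nth 0 L 0 &
  forall i, (i.+1 < size L)%N -> (1 + eps i) * nth 0 L i < nth 0 L i.+1 /\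
    nth 0 L i + 1 <= nth 0 L i.+1].

Lemma valid_rcons L y : valid L -> (1 + eps (size L).-1) * last 0 L < y ->
  last 0 L + 1 <= y -> valid (rcons L y).
Proof.
move=> [L0 L1 Lr] y1 y2; split; first by rewrite size_rcons.
  by rewrite nth_rcons L0.
move=> i; rewrite size_rcons ltnS => iL; rewrite !nth_rcons iL.
have [iL1|iL1] := ltnP i.+1 (size L); first exact: Lr.
have e : i.+1 = size L by apply/eqP; rewrite eqn_leq iL iL1.
have iE : i = (size L).-1 by rewrite -e.
have -> : nth 0 L i = last 0 L by rewrite -nth_last iE.
by rewrite e eqxx; split => //; rewrite iE.
Qed.

Lemma valid_fill L N : valid L -> exists2 L', valid (L ++ L') & (N <= size (L ++ L'))%N.
Proof.
move=> vL; elim: N => [|N [L' vL' NL']]; first by exists [::]; rewrite ?cats0.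
pose l := last 0 (L ++ L'); pose y := Num.max ((1 + eps (size (L ++ L')).-1) * l + 1) (l + 1).
exists (rcons L' y); last by rewrite -rcons_cat size_rcons.
rewrite -rcons_cat; apply: valid_rcons => //.
  by rewrite lt_max ltrDl ltr01.
by rewrite le_max lexx orbT.
Qed.

Definition block (s d : R) (K : nat) := [seq s + d * n.+1%:R | n <- iota 0 K].

Lemma blockS s d K : block s d K.+1 = rcons (block s d K) (s + d * K.+1%:R).
Proof. by rewrite /block -[in iota _ _]addn1 iotaD map_cat cats1 add0n. Qed.

(** Inside the block every point before the last is at most 2 d K, so eps times it is below d/2,
    while consecutive points differ by d. *)
Lemma valid_block L (s d : R) K : valid L -> (0 < K)%N ->
  (forall n, ((size L).-1 <= n)%N -> eps n < (4 * K%:R)^-1) ->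
  1 <= d -> `|s| <= d -> 2 * `|last 0 L| + 1 < s + d ->
  forall J, (J <= K)%N -> valid (L ++ block s d J).
Proof.
move=> vL K0 epsK d1 sd lsd; have K1 : 1 <= K%:R :> R by rewrite ler1n.
have L0 : (0 < size L)%N by case: vL.
elim=> [|J IH] JK; first by rewrite cats0.
have -> : L ++ block s d J.+1 = rcons (L ++ block s d J) (s + d * J.+1%:R).
  by rewrite blockS rcons_cat.
have eJ : eps (size (L ++ block s d J)).-1 < (4 * K%:R)^-1.
  by apply: epsK; rewrite size_cat -!subn1 leq_sub2r// leq_addr.
have K4 : (4 * K%:R)^-1 <= 4^-1 :> R by rewrite lef_pV2 ?posrE//; lra.
have e0 := eps0 (size (L ++ block s d J)).-1.
apply: valid_rcons; first exact: IH (ltnW JK).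
- rewrite last_cat; case: J JK eJ e0 {IH} => [|J] JK eJ e0.
    rewrite /= mulr1; set e := eps _ in eJ e0 *.
    have := ler_norm (last 0 L); have := normr_ge0 (last 0 L); nra.
  set e := eps _ in eJ e0 *; rewrite blockS last_rcons mulrDl mul1r.
  have h : s + d * J.+1%:R <= 2 * d * K%:R.
    have : J.+1%:R <= K%:R - 1 :> R by rewrite lerBrDr natr1 ler_nat.
    have := ler_norm s; nra.
  have h2 : e * (s + d * J.+1%:R) <= e * (2 * d * K%:R) by rewrite ler_wpM2l// ltW.
  have h3 : e * (4 * K%:R) < 1 by rewrite -ltr_pdivlMr ?mul1r//; lra.
  have d0 : 0 <= d by lra.
  have := ler_wpM2l d0 (ltW h3); rewrite -[J.+2%:R]natr1; lra.
- rewrite last_cat; case: J JK eJ e0 {IH} => [|J] JK eJ e0.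
    by rewrite /= mulr1; have := ler_norm (last 0 L); have := normr_ge0 (last 0 L); lra.
  rewrite blockS last_rcons.
  by rewrite -[J.+2%:R]natr1; lra.
Qed.

Lemma eps_small (e : R) : 0 < e -> exists N, forall n, (N <= n)%N -> eps n < e.
Proof.
move=> e0; have /cvgrPdist_lt /(_ _ e0)[N _ hN] := eps_cvg.
exists N => n Nn; have := hN n Nn; rewrite /= sub0r normrN ger0_norm//.
exact: ltW.
Qed.

End frequencies.

Section construction.
Variable R : realType.
Variable eps : nat -> R.
Hypothesis eps0 : forall n, 0 < eps n.
Hypothesis eps_cvg : eps n @[n --> \oo] --> (0 : R).

(* st_freq is the initial segment of Lambda built so far, st_list encodes the
   current approximation of g as a combination of translates of the Gaussian,
   and st_bound dominates the l^1 norms of the approximate inverses of all the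
   previous st_list. *)
Record state := State {
  st_freq : seq R; st_list : seq (R * R); st_bound : R }.

Definition invariant st := [/\ valid eps (st_freq st),
  approx_inv (@kappa R) (@int_shift R) (st_list st) & 1 <= st_bound st].

Definition step_block (k : nat) (s : R) (st st' : state) :=
  exists (Q : seq (R * int)) (d K : nat) (L' : seq R),
  [/\ st_freq st' = (st_freq st ++ L') ++ block s d%:R K, (0 < K)%N,
      (forall a, a \in Q -> 0 < a.2 <= K%:Z), flat Q k ((1 / 2) ^+ k) &
      nrm2 (@kappa R) (lmul (lcompl (emb d Q)) (st_list st')) <= (1 / 2) ^+ k].

(** By the factor [st_bound st ^+ 2], every earlier inverse S moves by at most (1/4)^k in squared
    norm when applied to the new list. The weights k^j make the limit of the Taylor coefficients
    rapid. *)
Definition step_filter (k : nat) (st st' : state) := exists psi : seq (R * R),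
  [/\ st_list st' = lmul psi (st_list st),
      (forall x, nrm2 (@kappa R) (lmul psi x) <= nrm2 (@kappa R) x),
      st_bound st ^+ 2 * nrm2 (@kappa R) (lmul (lcompl psi) (st_list st)) <= (1 / 4) ^+ k &
      (forall j, `|taylor (st_list st') j - taylor (st_list st) j| * k%:R ^+ j <=
        (1 / 2) ^+ k.+1)].

Definition step_inverse (k : nat) (st st' : state) := exists S : seq (R * R),
  [/\ int_shift S,
      nrm2 (@kappa R) (lone ++ lscale (- 1) (lmul S (st_list st'))) <= (1 / 4) ^+ k,
      lnorm1 S <= st_bound st' & st_bound st <= st_bound st'].

Lemma freq_bound (Q : seq (R * int)) : (forall a, a \in Q -> 0 < a.2) ->
  exists2 K : nat, (0 < K)%N & forall a, a \in Q -> 0 < a.2 <= K%:Z.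
Proof.
move=> Qpos; have [N hN] := @lnorm1_bound R Q; exists N.+1 => // a aQ.
rewrite Qpos//=; have := hN a aQ; have := Qpos a aQ.
case: (a.2) => // n _; rewrite absz_nat lez_nat => nN; exact: leqW.
Qed.

Lemma step_exists k s st : invariant st -> exists st',
  [/\ invariant st', step_block k s st st', step_filter k st st' & step_inverse k st st'].
Proof.
move=> [vL inv B1]; set L := st_freq st in vL; set p := st_list st in inv.
set B := st_bound st in B1.
pose e := Num.min ((1 / 2 : R) ^+ k.+1) ((1 / 4) ^+ k / B ^+ 2).
have B0 : 0 < B by lra.
have h2 m : 0 < (1 / 2 : R) ^+ m by rewrite exprn_gt0.
have h4 m : 0 < (1 / 4 : R) ^+ m by rewrite exprn_gt0.
have e0 : 0 < e by rewrite lt_min h2 divr_gt0// exprn_gt0.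
have e1 : e <= (1 / 2) ^+ k.
  apply: (@le_trans _ _ ((1 / 2) ^+ k.+1)); first by rewrite ge_min lexx.
  by rewrite exprS; have := h2 k; lra.
have e2 : e <= (1 / 2) ^+ k.+1 by rewrite ge_min lexx.
have e3 : B ^+ 2 * e <= (1 / 4) ^+ k.
  by rewrite mulrC -ler_pdivlMr ?exprn_gt0// ge_min lexx orbT.
(* The weighted family stays below the single vanishing function of [FW], so one d serves all j. *)
pose F j (s : R) : R := k%:R ^+ j * gauss_taylor s j.
have FW j s' : `|F j s'| <= gauss_fun s' * expR (2 * k%:R * `|s'|).
  by rewrite normrM mulrC [`|k%:R ^+ j|]ger0_norm ?exprn_ge0// gauss_taylor_le.
have [Q [M [r [Qpos Qflat M0 HM]]]] := one_step k p (@kappa_even R) (@kappa_psd R)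
  (@vanishing_kappa R) FW (vanishing_gauss (ler0n R k)) e0.
move=> [N1 _ hN1].
have [K K0 QK] := freq_bound Qpos.
have K1 : 1 <= K%:R :> R by rewrite ler1n.
have dK : 0 < (4 * K%:R)^-1 :> R by rewrite invr_gt0; lra.
have [N2 hN2] := eps_small eps0 eps_cvg dK.
have [L' vL' NL'] := valid_fill N2.+1 vL.
(* The order of choices is Q, K, L', d. As K does not depend on d, filler points can be inserted
   until eps < 1/(4K), and only then is d taken large compared with the last of them. *)
have [D [D0 DP]] := large_nat (`|s| + 2 * `|last 0 (L ++ L')| + 2 + `|s|).
pose d := (N1 + D)%N.
have dD : D%:R <= d%:R :> R by rewrite ler_nat leq_addl.
have dN : (N1 <= d)%N by exact: leq_addr.
clearbody d; have /= [c1 c2 c3] := hN1 _ dN.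
set psi := lfilter M (lcompl (emb d Q)) r in c1 c2 c3.
have lH : 2 * lnorm1 (lcompl (emb d Q)) ^+ 2 <= M by rewrite -emb_compl lnorm1_emb.
have hH : int_shift (lcompl (emb d Q)) by rewrite -emb_compl; exact: int_shift_emb.
have inv' : approx_inv (@kappa R) (@int_shift R) (lmul psi p).
  apply: approx_inv_mul => //.
  - exact: kappa_even.
  - exact: kappa_psd.
  - exact: int_shift_mul.
  by apply: approx_inv_filter => //; [exact: kappa_even|exact: kappa_psd].
have n1 : 0 < nrm2 (@kappa R) lone + 1 by have := @kappa_psd R lone; lra.
have [S hS /(_ lone) SP] := inv' _ (divr_gt0 (h4 k) n1).
pose B' := Num.max B (lnorm1 S).
exists (State ((L ++ L') ++ block s d%:R K) (lmul psi p) B').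
have BB' : B <= B' by rewrite le_max lexx.
split.
- split=> /=; last by rewrite (le_trans B1).
    apply: (valid_block eps0 vL' K0 _ _ _ _ (leqnn K)).
    + move=> n hn; apply: hN2; apply: leq_trans hn.
      by rewrite -ltnS (leq_trans NL')// leqSpred.
    + have := normr_ge0 s; have := normr_ge0 (last 0 (L ++ L')); lra.
    + have := normr_ge0 s; have := normr_ge0 (last 0 (L ++ L')); lra.
    + have := ler_norm (- s); rewrite normrN; have := normr_ge0 s; have := normr_ge0 (last 0 (L ++ L')); lra.
  exact: inv'.
- exists Q, d, K, L'; split=> //=; last exact: le_trans e1.
  have [s' [T [? ? ? sT]]] := Qflat; exists s', T; split=> //; exact: le_trans e1.
- exists psi; split=> //=.
  + move=> x; apply: nrm2_filter => //; [exact: kappa_even|exact: kappa_psd|].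
    by have := sqr_ge0 (lnorm1 (lcompl (emb d Q))); lra.
  + by apply: le_trans e3; rewrite ler_wpM2l// sqr_ge0.
  + move=> j; apply: le_trans e2; apply: le_trans (c3 j).
    rewrite -[k%:R ^+ j]ger0_norm ?exprn_ge0// -normrM mulrBl.
    have E y : taylor y j * k%:R ^+ j = lsum y (F j).
      rewrite /taylor /lsum mulr_suml; apply: eq_bigr => a _; rewrite /F; ring.
    by rewrite !E.
- exists S; split=> //=; last by rewrite le_max lexx orbT.
  have -> : nrm2 (@kappa R) (lone ++ lscale (- 1) (lmul S (lmul psi p))) =
     nrm2 (@kappa R) (lone ++ lscale (- 1) (lmul S (lmul (lmul psi p) lone))).
    apply: nrm2_eqv => G; rewrite !lsum_cat !lsum_scale; congr (_ + _ * _).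
    rewrite !lsum_mul; apply: eq_lsum => u.
    by rewrite (lmulC _ lone (fun t => G (u + t))) (lmul1 _ (fun t => G (u + t))) lsum_mul.
  apply: (le_trans SP); rewrite mulrAC ler_pdivrMr// ler_wpM2l ?(ltW (h4 k))//.
  by rewrite lerDl.
Qed.

(** Indices are read as codes of pairs (r, m); the second component makes every rational r recur. *)
Definition target (k : nat) : rat := if @unpickle (rat * nat)%type k is Some rm then rm.1 else 0.

(** Pigeonhole: the n + 1 distinct codes of (r, 0), ..., (r, n) cannot all be below n. *)
Lemma target_infinitely_often (r : rat) n : exists2 k, (n <= k)%N & target k = r.
Proof.
have [h|h] := pselect (exists2 m : 'I_n.+1, (n <= pickle (r, m : nat))%N & True).
  case: h => m hm _; exists (pickle (r, m : nat)) => //.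
  by rewrite /target pickleK.
exfalso.
have lt (m : 'I_n.+1) : (pickle (r, m : nat) < n)%N.
  by rewrite ltnNge; apply/negP => hm; apply: h; exists m.
pose f (m : 'I_n.+1) : 'I_n := Ordinal (lt m).
have finj : injective f.
  move=> a b /(congr1 (fun x : 'I_n => x : nat)) /= /(pcan_inj pickleK) [ab].
  exact: val_inj.
by have := leq_card f finj; rewrite !card_ord ltnn.
Qed.

Lemma construction_exists : exists st : nat -> state,
  [/\ st 0%N = State [:: 1] lone 1, forall k, invariant (st k) &
    forall k, [/\ step_block k (ratr (target k)) (st k) (st k.+1),
      step_filter k (st k) (st k.+1) & step_inverse k (st k) (st k.+1)]].
Proof.
have I0 : invariant (State [:: 1] lone 1).
  have v1 : valid eps [:: 1] by split; [|exact: lexx|move=> i; rewrite ltnS ltn0].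
  split=> //=.
  by apply: approx_inv_one; exact: kappa_psd.
pose T := {st | invariant st}.
have /choice[f fP] : forall x : nat * T, exists y : T,
   [/\ step_block x.1 (ratr (target x.1)) (sval x.2) (sval y),
       step_filter x.1 (sval x.2) (sval y) & step_inverse x.1 (sval x.2) (sval y)].
  move=> [k [st hst]]; have [st' [hst' h1 h2 h3]] := step_exists k (ratr (target k)) hst.
  by exists (exist _ st' hst').
pose u := fix u n : T := if n is k.+1 then f (k, u k) else exist _ _ I0.
exists (fun n => sval (u n)); split=> //; first by move=> k; exact: svalP.
by move=> k; exact: (fP (k, u k)).
Qed.

End construction.

(** * Approximation and Bessel inequality for real functions *)

Section approximable.
Variable R : realType.
Variables (g : R -> R) (lam : nat -> R).
Hypothesis mg : measurable_fun setT g.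
Implicit Types (f h : R -> R) (c : nat -> R) (q : R).

Definition comb c M (t : R) : R := \sum_(0 <= n < M) c n * g (t - lam n).

(* The quantification over M lets two approximations be compared on a common
   range of indices. *)
Definition approximable f := forall q e b : R, 2 < q -> 0 < e -> 0 < b ->
  exists (N : nat) (c : nat -> R), forall M, (N <= M)%N ->
    (N2 (fun t => f t - comb c M t)%R < e%:E)%E /\
    \sum_(0 <= n < M) `|c n| `^ q <= b.

Lemma powR_addr_le (x y q : R) : 0 <= q -> 0 <= x -> 0 <= y ->
  (x + y) `^ q <= 2 `^ q * (x `^ q + y `^ q).
Proof.
move=> q0; wlog xy : x y / x <= y.
  move=> hw x0 y0; have [?|/ltW ?] := leP x y; first exact: hw.
  by rewrite addrC [x `^ q + _]addrC hw.
move=> x0 y0; apply: (@le_trans _ _ ((2 * y) `^ q)).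
  by apply: ge0_ler_powR; rewrite ?nnegrE//; lra.
by rewrite powRM// ler_wpM2l ?powR_ge0// lerDr powR_ge0.
Qed.

Lemma measurable_comb c M : measurable_fun setT (comb c M).
Proof.
apply: measurable_sum => n; apply: measurable_funM; first exact: measurable_cst.
exact: measurable_shift.
Qed.

Lemma N2D_lt (u v : R -> R) (e : R) : measurable_fun setT u -> measurable_fun setT v ->
  (N2 u < (e / 4)%:E)%E -> (N2 v < (e / 4)%:E)%E ->
  (N2 (fun t => u t + v t)%R < e%:E)%E.
Proof.
move=> mu mv hu hv; apply: le_lt_trans (N2D mu mv) _.
have fu : N2 u \is a fin_num by rewrite ge0_fin_numE ?N2_ge0// (lt_trans hu)// ltry.
have fv : N2 v \is a fin_num by rewrite ge0_fin_numE ?N2_ge0// (lt_trans hv)// ltry.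
move: hu hv; rewrite -(fineK fu) -(fineK fv) !lte_fin.
lra.
Qed.

Definition approximable_class f := measurable_fun setT f /\ approximable f.

Lemma approximable_lin (a : R) f h : approximable_class f -> approximable_class h ->
  approximable_class (fun t => a * f t + h t).
Proof.
move=> [mf af] [mh ah]; split.
  by apply: measurable_funD => //; apply: measurable_funM => //; exact: measurable_cst.
move=> q e b q2 e0 b0; have q0 : 0 <= q by lra.
have A0 : 0 < a ^+ 2 + 1 by have := sqr_ge0 a; lra.
have P0 : 0 < 2 `^ q :> R by rewrite powR_gt0.
have P1 : 0 < `|a| `^ q + 1 by have := powR_ge0 `|a| q; lra.
have e4 : 0 < e / 4 by rewrite divr_gt0.
have b2 : 0 < b / 2 / 2 `^ q by rewrite !divr_gt0.
have [N1 [c1 h1]] := af q _ _ q2 (divr_gt0 e4 A0) (divr_gt0 b2 P1).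
have [N2' [c2 h2]] := ah q _ _ q2 e4 b2.
exists (N1 + N2')%N, (fun n => a * c1 n + c2 n) => M hM.
have [h1a h1b] := h1 M (leq_trans (leq_addr _ _) hM).
have [h2a h2b] := h2 M (leq_trans (leq_addl _ _) hM).
have mdf : measurable_fun setT (fun t => f t - comb c1 M t).
  by apply: measurable_funB => //; exact: measurable_comb.
have mdh : measurable_fun setT (fun t => h t - comb c2 M t).
  by apply: measurable_funB => //; exact: measurable_comb.
split.
  rewrite (_ : (fun t => _) = (fun t => a * (f t - comb c1 M t) + (h t - comb c2 M t))).
    apply: N2D_lt => //.
      by apply: measurable_funM => //; exact: measurable_cst.
    rewrite N2Z//.
    have fu : N2 (fun t => f t - comb c1 M t)%R \is a fin_num.
      by rewrite ge0_fin_numE ?N2_ge0// (lt_trans h1a)// ltry.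
    move: h1a; rewrite -(fineK fu) !lte_fin ltr_pdivlMr//.
    have : 0 <= fine (N2 (fun t => f t - comb c1 M t)%R) by rewrite fine_ge0// N2_ge0.
    nra.
  apply/funext => t; rewrite /comb.
  under eq_bigr do rewrite mulrDl -mulrA.
  by rewrite big_split -mulr_sumr /=; ring.
apply: (@le_trans _ _ (\sum_(0 <= n < M)
    (2 `^ q * (`|a| `^ q) * (`|c1 n| `^ q) + 2 `^ q * (`|c2 n| `^ q)))).
  apply: ler_sum => n _; rewrite -mulrA -mulrDr -powRM// -normrM.
  apply: le_trans (powR_addr_le q0 (normr_ge0 _) (normr_ge0 _)).
  by apply: ge0_ler_powR; rewrite ?nnegrE ?addr_ge0// ler_normD.
rewrite big_split /= -!mulr_sumr.
have s1 : 0 <= \sum_(0 <= n < M) `|c1 n| `^ q by apply: sumr_ge0 => n _; exact: powR_ge0.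
move: h1b h2b; rewrite !ler_pdivlMr// => h1b h2b.
have : 0 <= (\sum_(0 <= n < M) `|c1 n| `^ q) * 2 `^ q by rewrite mulr_ge0// ltW.
move: h1b h2b; set A := \sum_(0 <= n < M) `|c1 n| `^ q; set B := \sum_(0 <= n < M) _.
by move: (2 `^ q) (`|a| `^ q) => u v; lra.
Qed.

(** The coefficient bound b does not involve the function, so nothing is lost in passing from h to
    f. *)
Lemma approximable_closed f : measurable_fun setT f ->
  (forall e : R, 0 < e -> exists2 h, approximable_class h &
     (N2 (fun t => f t - h t)%R < e%:E)%E) -> approximable_class f.
Proof.
move=> mf H; split=> // q e b q2 e0 b0.
have e4 : 0 < e / 4 by rewrite divr_gt0.
have [h [mh ah] fh] := H _ e4.
have [N [c hc]] := ah q (e / 4) b q2 e4 b0.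
exists N, c => M NM; have [h1 h2] := hc M NM; split=> //.
rewrite (_ : (fun t => _) = (fun t => (f t - h t) + (h t - comb c M t))).
  by apply: N2D_lt => //; apply: measurable_funB => //; exact: measurable_comb.
by apply/funext => t; ring.
Qed.

Lemma approximable_act x : approximable_class (fun=> 0) ->
  (forall a, a \in x -> approximable_class (fun t => g (t - a.2))) ->
  approximable_class (act x g).
Proof.
move=> K0; elim: x => [|a x IH] H.
  by rewrite (_ : act _ _ = (fun=> 0))//; apply/funext => t; rewrite /act /lsum big_nil.
rewrite (_ : act _ _ = (fun t => a.1 * g (t - a.2) + act x g t)); last first.
  by apply/funext => t; rewrite /act /lsum big_cons.
apply: approximable_lin; first by apply: H; rewrite mem_head.
by apply: IH => b bx; apply: H; rewrite inE bx orbT.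
Qed.

Lemma approximable0 : approximable_class (fun=> 0).
Proof.
split; first exact: measurable_cst.
move=> q e b q2 e0 b0; exists 0%N, (fun=> 0) => M _; split.
  rewrite (_ : (fun t => _) = (fun t : R => 0 * 0)).
    by rewrite N2Z// expr0n /= mul0e.
  by apply/funext => t; rewrite /comb big1 ?subrr ?mulr0// => n _; rewrite mul0r.
by rewrite big1 ?ltW// => n _; rewrite normr0 powR0//; lra.
Qed.

End approximable.

Section bessel.
Variable R : realType.
Local Notation mu := (@lebesgue_measure R).
Implicit Types (f u : R -> R).

Lemma integrable_sqr f : measurable_fun setT f -> (N2 f < +oo)%E ->
  mu.-integrable setT (EFin \o (fun t => f t ^+ 2)).
Proof.
move=> mf f2; apply/integrableP; split; first exact: measurable_sqr.
suff -> : (\int[mu]_t `|(f t ^+ 2)%:E| = N2 f)%E by [].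
by apply: eq_integral => t _ /=; rewrite ger0_norm ?sqr_ge0.
Qed.

Lemma integrable_mul f u : measurable_fun setT f -> measurable_fun setT u ->
  (N2 f < +oo)%E -> (N2 u < +oo)%E ->
  mu.-integrable setT (EFin \o (fun t => f t * u t)).
Proof.
move=> mf mu_ f2 u2.
apply: (le_integrable measurableT _ _ (integrableD measurableT (integrable_sqr mf f2) (integrable_sqr mu_ u2))).
  by apply/measurable_EFinP; apply: measurable_funM.
move=> t _ /=; rewrite lee_fin normrM [X in _ <= X]ger0_norm ?addr_ge0 ?sqr_ge0//.
rewrite -[f t ^+ 2]real_normK ?num_real// -[u t ^+ 2]real_normK ?num_real//.
have := sqr_ge0 (`|f t| - `|u t|); have := sqr_ge0 (`|f t|); have := sqr_ge0 (`|u t|).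
nra.
Qed.

Lemma N2_fine f : measurable_fun setT f -> (N2 f < +oo)%E ->
  N2 f = (\int[mu]_t f t ^+ 2)%:E.
Proof.
by move=> mf f2; rewrite /Rintegral fineK// ge0_fin_numE// N2_ge0.
Qed.

Variables (g : R -> R) (lam : nat -> R) (C : R).
Hypothesis mg : measurable_fun setT g.
Hypothesis g2 : forall n, (N2 (fun t => g (t - lam n)) < +oo)%E.
Hypothesis C0 : 0 < C.
Hypothesis gC : forall (c : nat -> R) N,
  (N2 (comb g lam c N) <= (C * \sum_(0 <= n < N) c n ^+ 2)%:E)%E.

Lemma integral_comb f c N : measurable_fun setT f -> (N2 f < +oo)%E ->
  \int[mu]_t (f t * comb g lam c N t) =
  \sum_(0 <= n < N) c n * \int[mu]_t (f t * g (t - lam n)).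
Proof.
move=> mf f2.
have fin M : (N2 (comb g lam c M) < +oo)%E by apply: le_lt_trans (gC _ _) (ltry _).
have intg n : mu.-integrable setT (EFin \o (fun t => f t * g (t - lam n))).
  by apply: integrable_mul => //; exact: measurable_shift.
elim: N => [|N IH].
  rewrite big_geq// (@eq_Rintegral _ _ _ mu setT (fun=> 0)).
    by rewrite /Rintegral integral0.
  by move=> t _; rewrite /comb big_geq// mulr0.
rewrite big_nat_recr//= -IH -RintegralZl// -RintegralD//.
- apply: eq_Rintegral => t _; rewrite /comb big_nat_recr//=; ring.
- by apply: integrable_mul => //; exact: measurable_comb.
- exact: (@integrableZl _ _ _ mu setT measurableT (c N) _ (intg N)).
Qed.

(* With [c n] the n-th inner product, [\int f (comb c)] is the sum of squares X,
   while 2 f v <= C f^2 + v^2 / C bounds it by (C |f|^2 + X) / 2. *)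
Lemma bessel_real f N : measurable_fun setT f -> (N2 f < +oo)%E ->
  \sum_(0 <= n < N) (\int[mu]_t (f t * g (t - lam n))) ^+ 2 <=
  C * \int[mu]_t f t ^+ 2.
Proof.
move=> mf f2; pose c n := \int[mu]_t (f t * g (t - lam n)).
pose v := comb g lam c N; set X := \sum_(0 <= n < N) _.
have mv : measurable_fun setT v by exact: measurable_comb.
have v2 : (N2 v < +oo)%E by apply: le_lt_trans (gC _ _) (ltry _).
have XE : \int[mu]_t (f t * v t) = X.
  by rewrite integral_comb//; apply: eq_bigr => n _; rewrite expr2.
have vX : \int[mu]_t v t ^+ 2 <= C * X by rewrite -lee_fin -N2_fine//; exact: gC.
have If := integrable_sqr mf f2; have Iv := integrable_sqr mv v2.
have Ifv := integrable_mul mf mv f2 v2.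
have If' : mu.-integrable setT (EFin \o (fun t => C / 2 * f t ^+ 2)).
  exact: (@integrableZl _ _ _ mu setT measurableT (C / 2) _ If).
have Iv' : mu.-integrable setT (EFin \o (fun t => (2 * C)^-1 * v t ^+ 2)).
  exact: (@integrableZl _ _ _ mu setT measurableT (2 * C)^-1 _ Iv).
have : X <= C / 2 * \int[mu]_t f t ^+ 2 + (2 * C)^-1 * \int[mu]_t v t ^+ 2.
  rewrite -XE -!RintegralZl// -RintegralD//; apply: le_Rintegral => //.
    exact: (integrableD measurableT If' Iv').
  move=> t _; rewrite -subr_ge0.
  have -> : C / 2 * f t ^+ 2 + (2 * C)^-1 * v t ^+ 2 - f t * v t = (2 * C)^-1 * (C * f t - v t) ^+ 2.
    by field; rewrite gt_eqF.
  by rewrite mulr_ge0 ?sqr_ge0// invr_ge0 mulr_ge0// ltW.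
have : (2 * C)^-1 * \int[mu]_t v t ^+ 2 <= X / 2.
  rewrite [X / 2](_ : _ = (2 * C)^-1 * (C * X)); last by field; rewrite gt_eqF.
  by rewrite ler_wpM2l// invr_ge0 mulr_ge0// ltW.
lra.
Qed.

End bessel.

(** * From real to complex functions *)

Section complex_transfer.
Variable R : realType.
Local Notation mu := (@lebesgue_measure R).
Local Open Scope complex_scope.
Implicit Types (f : R -> R[i]).

Lemma cmod_sqr (z : R[i]) : cmod z ^+ 2 = complex.Re z ^+ 2 + complex.Im z ^+ 2.
Proof. by case: z => a b; rewrite /cmod /= sqr_sqrtr// addr_ge0 ?sqr_ge0. Qed.

Lemma cmod_ge0 (z : R[i]) : 0 <= cmod z.
Proof. exact: normc_ge0. Qed.

Lemma cmod_le (z : R[i]) : cmod z <= `|complex.Re z| + `|complex.Im z|.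
Proof.
rewrite -(@ler_pXn2r _ 2) ?nnegrE ?addr_ge0 ?cmod_ge0// cmod_sqr.
rewrite -[complex.Re z ^+ 2]real_normK ?num_real// -[complex.Im z ^+ 2]real_normK ?num_real//.
by have := mulr_ge0 (normr_ge0 (complex.Re z)) (normr_ge0 (complex.Im z)); nra.
Qed.

Lemma L2normE f : measurable_fun setT (fun t => complex.Re (f t)) ->
  measurable_fun setT (fun t => complex.Im (f t)) ->
  L2norm f = sqrte (N2 (fun t => complex.Re (f t)) + N2 (fun t => complex.Im (f t))).
Proof.
move=> mr mi; rewrite /L2norm unlock poweR12_sqrt; last first.
  by apply: integral_ge0 => t _; exact: poweR_ge0.
congr sqrte; rewrite /N2 -ge0_integralD//.
- apply: eq_integral => t _; rewrite poweR_EFin ger0_norm ?cmod_ge0//.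
  by rewrite powR_mulrn ?cmod_ge0// cmod_sqr EFinD.
- by move=> t _; rewrite lee_fin sqr_ge0.
- exact: (measurable_sqr mr).
- by move=> t _; rewrite lee_fin sqr_ge0.
- exact: (measurable_sqr mi).
Qed.

Lemma inL2_N2 f : inL2 f -> (N2 (fun t => complex.Re (f t)) < +oo)%E /\
  (N2 (fun t => complex.Im (f t)) < +oo)%E.
Proof.
move=> [mr mi]; rewrite L2normE//.
have r0 := N2_ge0 (fun t => complex.Re (f t)); have i0 := N2_ge0 (fun t => complex.Im (f t)).
rewrite -ge0_fin_numE ?sqrte_ge0// (sqrte_fin_num (adde_ge0 r0 i0)) fin_numD.
by rewrite (ge0_fin_numE r0) (ge0_fin_numE i0) => /andP[].
Qed.

Lemma L2norm_fine f : inL2 f -> L2norm f =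
  (Num.sqrt (\int[mu]_t complex.Re (f t) ^+ 2 + \int[mu]_t complex.Im (f t) ^+ 2))%:E.
Proof.
by move=> hf; have [r2 i2] := inL2_N2 hf; case: hf => mr mi _; rewrite L2normE// (N2_fine mr r2) (N2_fine mi i2).
Qed.

Lemma L2norm_lt f (e : R) : 0 < e -> measurable_fun setT (fun t => complex.Re (f t)) ->
  measurable_fun setT (fun t => complex.Im (f t)) ->
  (N2 (fun t => complex.Re (f t)) < (e ^+ 2 / 2)%:E)%E ->
  (N2 (fun t => complex.Im (f t)) < (e ^+ 2 / 2)%:E)%E -> (L2norm f < e%:E)%E.
Proof.
move=> e0 mr mi hr hi; have hr' := lt_trans hr (ltry _); have hi' := lt_trans hi (ltry _).
rewrite L2normE//; move: hr hi; rewrite (N2_fine mr hr') (N2_fine mi hi') !lte_fin => hr hi.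
rewrite -[e]ger0_norm ?(ltW e0)// -sqrtr_sqr ltr_sqrt ?exprn_gt0//.
lra.
Qed.

Variables (g : R -> R) (lam : nat -> R).
Hypothesis mg : measurable_fun setT g.
Local Notation u := (translates (fun t => (g t)%:C) lam).

Lemma inL2_translates n : (N2 (fun t => g (t - lam n)) < +oo)%E -> inL2 (u n).
Proof.
move=> g2; have mr : measurable_fun setT (fun t => complex.Re (u n t)) by exact: measurable_shift.
have mi : measurable_fun setT (fun t => complex.Im (u n t)) by exact: measurable_cst.
split=> //; rewrite L2normE//.
rewrite (_ : N2 (fun t => complex.Im (u n t)) = 0%E); last first.
  by rewrite /N2 integral0_eq// => t _; rewrite /= expr0n.
rewrite adde0 -ge0_fin_numE ?sqrte_ge0// sqrte_fin_num ?N2_ge0//.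
by rewrite ge0_fin_numE ?N2_ge0.
Qed.

Lemma Re_lincomb N (c1 c2 : nat -> R) t :
  complex.Re (lincomb u (fun i : 'I_N => c1 i +i* c2 i) t) = comb g lam c1 N t.
Proof.
rewrite /lincomb raddf_sum /comb big_mkord; apply: eq_bigr => i _ /=.
by rewrite mulr0 subr0.
Qed.

Lemma Im_lincomb N (c1 c2 : nat -> R) t :
  complex.Im (lincomb u (fun i : 'I_N => c1 i +i* c2 i) t) = comb g lam c2 N t.
Proof.
rewrite /lincomb raddf_sum /comb big_mkord; apply: eq_bigr => i _ /=.
by rewrite mulr0 add0r.
Qed.

(** [approximable] allows any bound b > 0 on the coefficients, so the constant C = 1 works for every
    q. The real and imaginary parts are approximated separately over a common index range. *)
Lemma QF_approximation_real :
  (forall h : R -> R, measurable_fun setT h -> (N2 h < +oo)%E -> approximable_class g lam h) ->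
  QF_approximation u.
Proof.
move=> app q q2; exists 1 => f hf e e0.
have q0 : 0 < q by lra.
have [r2 i2] := inL2_N2 hf; have [mr mi _] := hf.
have := L2norm_fine hf; set F := _ + _ => FE.
have [F0|F0] := leP F 0.
  (* If f has norm 0, the coefficient bound is 0 and the empty combination is taken. *)
  exists 0%N, (fun=> 0); split.
    rewrite (_ : (fun t => _) = f); last by apply/funext => t; rewrite /lincomb big_ord0 subr0.
    by rewrite FE ler0_sqrtr.
  by rewrite /lq_norm big_ord0 powR0 ?mule_ge0 ?FE ?lee_fin ?sqrtr_ge0// invr_eq0 gt_eqF.
pose nu := Num.sqrt F; have nu0 : 0 < nu by rewrite sqrtr_gt0.
have P2 : 0 < 2 `^ q :> R by rewrite powR_gt0.
(* Half of nu^q for each part, after the loss of 2^q in splitting |c1 + i c2|^q. *)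
have b0 : 0 < nu `^ q / 2 `^ q / 2 by rewrite !divr_gt0// powR_gt0.
have e2 : 0 < e ^+ 2 / 2 by rewrite divr_gt0// exprn_gt0.
have [N1 [c1 h1]] := (app _ mr r2).2 q _ _ q2 e2 b0.
have [N2' [c2 h2]] := (app _ mi i2).2 q _ _ q2 e2 b0.
pose N := (N1 + N2')%N.
have [h1a h1b] := h1 N (leq_addr _ _).
have [h2a h2b] := h2 N (leq_addl _ _).
exists N, (fun i : 'I_N => c1 i +i* c2 i); split.
  have rE : (fun t => complex.Re (f t - lincomb u (fun i : 'I_N => c1 i +i* c2 i) t)) =
      (fun t => complex.Re (f t) - comb g lam c1 N t).
    by apply/funext => t; rewrite raddfB /= Re_lincomb.
  have iE : (fun t => complex.Im (f t - lincomb u (fun i : 'I_N => c1 i +i* c2 i) t)) =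
      (fun t => complex.Im (f t) - comb g lam c2 N t).
    by apply/funext => t; rewrite raddfB /= Im_lincomb.
  by apply: L2norm_lt => //; rewrite ?rE ?iE//; apply: measurable_funB => //; exact: measurable_comb.
rewrite FE -EFinM lee_fin mul1r -/nu /lq_norm.
have -> : nu = (nu `^ q) `^ q^-1 by rewrite -powRrM divff ?powRr1 ?gt_eqF// ltW.
apply: ge0_ler_powR; rewrite ?nnegrE ?invr_ge0 ?(ltW q0) ?powR_ge0//.
  by apply: sumr_ge0 => i _; exact: powR_ge0.
apply: (@le_trans _ _ (\sum_(i < N) 2 `^ q * (`|c1 i| `^ q + `|c2 i| `^ q))).
  apply: ler_sum => i _; apply: le_trans (powR_addr_le (ltW q0) (normr_ge0 _) (normr_ge0 _)).
  apply: ge0_ler_powR; rewrite ?nnegrE ?cmod_ge0 ?addr_ge0 ?(ltW q0)//.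
  exact: cmod_le.
rewrite -mulr_sumr big_split /=.
rewrite mulrC -ler_pdivlMr//; move: h1b h2b; rewrite !big_mkord.
by move: (nu `^ q / 2 `^ q) => w; lra.
Qed.

Lemma L2dot_real f n : L2dot f (u n) =
  (\int[mu]_t (complex.Re (f t) * g (t - lam n))) +i*
  (\int[mu]_t (complex.Im (f t) * g (t - lam n))).
Proof.
rewrite /L2dot; congr (_ +i* _); apply: eq_Rintegral => t _; rewrite /translates;
  case: (f t) => a b /=; rewrite oppr0 mulr0 ?subr0 ?addr0 ?add0r//.
Qed.

Lemma Bessel_real (C : R) : 0 < C ->
  (forall n, (N2 (fun t => g (t - lam n)) < +oo)%E) ->
  (forall (c : nat -> R) N,
    (N2 (comb g lam c N) <= (C * \sum_(0 <= n < N) c n ^+ 2)%:E)%E) ->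
  Bessel u.
Proof.
move=> C0 g2 gC; exists (Num.sqrt C) => f hf.
have [r2 i2] := inL2_N2 hf; have [mr mi _] := hf.
have := L2norm_fine hf; set F := _ + _ => FE.
have F0 : 0 <= F by rewrite addr_ge0// Rintegral_ge0// => t _; exact: sqr_ge0.
have d0 n : (0 <= (cmod (L2dot f (u n)) ^+ 2)%:E)%E by rewrite lee_fin sqr_ge0.
rewrite FE -EFinM -sqrtrM ?(ltW C0)// poweR12_sqrt; last exact: nneseries_ge0.
rewrite -[(Num.sqrt _)%:E]/(sqrte (C * F)%:E) lee_sqrt ?lee_fin ?mulr_ge0 ?(ltW C0)//.
apply: lime_le; first by apply: is_cvg_nneseries => n _ _.
apply: nearW => N; rewrite sumEFin lee_fin /F mulrDr.
under eq_bigr do rewrite L2dot_real cmod_sqr /=.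
rewrite big_split /=.
by apply: lerD; apply: bessel_real.
Qed.

End complex_transfer.

(** * The limit function *)

Section limit.
Variable R : realType.
Variable eps : nat -> R.
Variable st : nat -> state R.
Hypothesis st0 : st 0%N = State [:: 1] lone 1.
Hypothesis st_inv : forall k, invariant eps (st k).
Hypothesis st_block : forall k, step_block k (ratr (target k)) (st k) (st k.+1).
Hypothesis st_filter : forall k, step_filter k (st k) (st k.+1).
Hypothesis st_inverse : forall k, step_inverse k (st k) (st k.+1).

Local Notation L k := (st_freq (st k)).
Local Notation p k := (st_list (st k)).
Local Notation kap := (@kappa R).
Local Notation gam := (@gauss_fun R).

(** The stages extend one another and stage n has more than n points, so the default 0 is never
    read. *)
Definition lambda n := nth 0 (L n) n.

Lemma size_freq k : (k < size (L k))%N.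
Proof.
elim: k => [|k IH]; first by rewrite st0.
have [Q [d [K [L' [-> K0 _ _ _]]]]] := st_block k.
rewrite !size_cat size_map size_iota -addnA.
by rewrite (leq_ltn_trans IH)// -[X in (X < _)%N]addn0 ltn_add2l addn_gt0 K0 orbT.
Qed.

Lemma freq_prefix k m i : (k <= m)%N -> (i < size (L k))%N ->
  nth 0 (L m) i = nth 0 (L k) i /\ (i < size (L m))%N.
Proof.
move=> km ik; rewrite -(subnK km); elim: (m - k)%N => [//|n [IH1 IH2]].
rewrite addSn; have [Q [d [K [L' [-> _ _ _ _]]]]] := st_block (n + k).
rewrite -catA nth_cat IH2 IH1; split=> //.
by rewrite size_cat (leq_trans IH2)// leq_addr.
Qed.

Lemma lambdaE k i : (i < size (L k))%N -> lambda i = nth 0 (L k) i.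
Proof.
move=> ik; rewrite /lambda; have [ki|/ltnW ki] := leqP k i.
  by have [] := freq_prefix ki ik.
by have [] := freq_prefix ki (size_freq i).
Qed.

Lemma lambda_step i : (1 + eps i) * lambda i < lambda i.+1 /\ lambda i + 1 <= lambda i.+1.
Proof.
have si := size_freq i.+1; rewrite (lambdaE (ltnW si)) (lambdaE si).
by have [[_ _ h] _ _] := st_inv i.+1; exact: h.
Qed.

Lemma lambda_ge1 i : 1 <= lambda i.
Proof.
elim: i => [|i IH]; first by rewrite /lambda st0.
by have [_ h] := lambda_step i; apply: le_trans h; lra.
Qed.

Lemma lambda_gap i n : n%:R <= lambda (i + n)%N - lambda i.
Proof.
elim: n => [|n IH]; first by rewrite addn0 subrr.
by rewrite addnS -natr1; have [_ h] := lambda_step (i + n); lra.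
Qed.

Lemma lambda_dist i j : (`|i%:Z - j%:Z|%N)%:R <= `|lambda i - lambda j|.
Proof.
wlog ij : i j / (i <= j)%N.
  move=> hw; have [?|/ltnW ?] := leqP i j; first exact: hw.
  by rewrite distrC distnC hw.
rewrite distrC (distnEr ij) -{2}(subnKC ij) (le_trans (lambda_gap i (j - i)))//.
exact: ler_norm.
Qed.

Lemma half_ge0 n : 0 <= (1 / 2 : R) ^+ n.
Proof. by apply: exprn_ge0; lra. Qed.

Lemma taylor_telescope k m j : (k <= m)%N ->
  `|taylor (p m) j - taylor (p k) j| * k%:R ^+ j <= (1 / 2) ^+ k - (1 / 2) ^+ m.
Proof.
move=> km; rewrite -(subnK km); elim: (m - k)%N => [|n IH].
  by rewrite add0n !subrr normr0 mul0r.
have [psi [_ _ _ h]] := st_filter (n + k).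
have -> : taylor (p (n.+1 + k)) j - taylor (p k) j =
  (taylor (p (n + k).+1) j - taylor (p (n + k)) j) +
  (taylor (p (n + k)) j - taylor (p k) j) by rewrite addSn; ring.
have kj : 0 <= k%:R ^+ j :> R by rewrite exprn_ge0.
apply: (le_trans (ler_wpM2r kj (ler_normD _ _))); rewrite mulrDl.
have h1 : `|taylor (p (n + k).+1) j - taylor (p (n + k)) j| * k%:R ^+ j <= (1 / 2) ^+ (n + k).+1.
  apply: le_trans (h j); rewrite ler_wpM2l// lerXn2r ?nnegrE//.
  by rewrite ler_nat leq_addl.
apply: (le_trans (lerD h1 IH)); rewrite addSn exprS.
by have := half_ge0 (n + k); lra.
Qed.

Definition coefs j := limn (fun k => taylor (p k) j).

Lemma taylor_cvg j : taylor (p k) j @[k --> \oo] --> coefs j.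
Proof.
suff : cvgn (fun k => taylor (p k) j) by [].
set u := fun k => taylor (p k) j.
have C0 : 0 <= `|u 1%N - u 0%N| + 1 by rewrite addr_ge0.
have cv : cvgn (series (telescope u)).
  apply: normed_cvg; apply: (@series_le_cvg _ _ (geometric (`|u 1%N - u 0%N| + 1) (1 / 2))).
  - by move=> n; rewrite /= normr_ge0.
  - by move=> n; rewrite /= mulr_ge0// half_ge0.
  (* For n = 0 the weight 0^j gives no control when j > 0; this is why the first increment enters
     the constant of the majorant. *)
  - move=> [|n] /=; first by rewrite expr0 mulr1 /telescope lerDl.
    have := taylor_telescope j (leqnSn n.+1); rewrite -/(u _) -/(u _) => h.
    have h1 : `|u n.+2 - u n.+1| <= (1 / 2) ^+ n.+1.
      apply: (@le_trans _ _ (`|u n.+2 - u n.+1| * n.+1%:R ^+ j)).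
        by rewrite ler_peMr// exprn_ege1// ler1n.
      by apply: (le_trans h); rewrite lerBlDr lerDl half_ge0.
    by apply: (le_trans h1); rewrite ler_peMl ?lerDr ?half_ge0.
  by apply: is_cvg_geometric_series; rewrite ger0_norm; lra.
have -> : u = (fun n => u 0%N + series (telescope u) n).
  by apply/funext => n; rewrite telescopeK addrC subrK.
by apply: is_cvgD => //; exact: is_cvg_cst.
Qed.

Lemma taylor_coefs k j : `|taylor (p k) j - coefs j| * k%:R ^+ j <= (1 / 2) ^+ k.
Proof.
have cv : (fun m => `|taylor (p k) j - taylor (p m) j| * k%:R ^+ j) @ \oo -->
    `|taylor (p k) j - coefs j| * k%:R ^+ j.
  apply: cvgMr_tmp; apply: cvg_norm; apply: cvgB; first exact: cvg_cst.
  exact: taylor_cvg.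
apply: (cvgr_to_le cv); exists k => // m /= km.
by rewrite distrC (le_trans (taylor_telescope j km))// lerBlDr lerDl half_ge0.
Qed.

Lemma rapid_coefs : rapid coefs.
Proof.
move=> r r1; have [k [k0 rk]] := large_nat r.
have k1 : 1 <= k%:R :> R by lra.
have [C hC] := @rapid_taylor R (p k) _ k1.
exists (1 + C) => j.
apply: (@le_trans _ _ (`|coefs j| * k%:R ^+ j)).
  by rewrite ler_wpM2l// lerXn2r ?nnegrE//; lra.
rewrite -(subrK (taylor (p k) j) (coefs j)).
apply: (le_trans (ler_wpM2r _ (ler_normD _ _))); first by rewrite exprn_ge0.
rewrite mulrDl lerD// distrC (le_trans (taylor_coefs k j))// exprn_ile1//; lra.
Qed.

Definition limit_fun := gauss_psum coefs.
Local Notation g := limit_fun.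

Lemma limit_fun_cvg t : act (p k) gam t @[k --> \oo] --> g t.
Proof.
under eq_fun do rewrite act_gauss /gauss_psum.
apply: cvgMl_tmp; apply: psum_cvg_seq; first exact: rapid_coefs.
  by move=> k; exact: rapid_taylor.
exact: taylor_coefs.
Qed.

Lemma measurable_limit_fun : measurable_fun setT g.
Proof.
by apply: continuous_measurable_fun; apply: continuous_gauss_psum; exact: rapid_coefs.
Qed.

(** Later filters commute with x and contract, so every bound obtained at stage k holds at all later
    stages. *)
Lemma nrm2_decr x k m : (k <= m)%N -> nrm2 kap (lmul x (p m)) <= nrm2 kap (lmul x (p k)).
Proof.
move=> km; rewrite -(subnK km); elim: (m - k)%N => [//|n IH].
rewrite addSn; apply: le_trans IH.
have [psi [-> h _ _]] := st_filter (n + k).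
rewrite (nrm2_eqv _ (q := lmul psi (lmul x (p (n + k)))))//.
move=> F; rewrite (lmulA _ _ _ F) (leqv_mul (lmulC _ _) (fun=> erefl) F).
by rewrite (lmulA _ _ _ F).
Qed.

Lemma act_limit_cvg x t : act x (act (p k) gam) t @[k --> \oo] --> act x g t.
Proof.
rewrite /act /lsum; apply: cvg_seq_sum => a; apply: cvgMl_tmp.
exact: limit_fun_cvg.
Qed.

Lemma measurable_gam : measurable_fun setT gam.
Proof. exact: measurable_gauss_fun. Qed.

(** By Fatou's lemma, pointwise convergence of the stages to g is enough to carry L^2 bounds
    over. *)
Lemma N2_act_limit_sub x y b k : (forall m, (k <= m)%N -> nrm2 kap (lmul x (p m) ++ y) <= b) ->
  (N2 (fun t => act x g t + act y gam t)%R <= b%:E)%E.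
Proof.
move=> h.
apply: (@N2_fatou _ (fun n t => act x (act (p (n + k)) gam) t + act y gam t)).
- move=> n; apply: measurable_funD; apply: measurable_act; last exact: measurable_gam.
  by apply: measurable_act; exact: measurable_gam.
- move=> t; apply: cvgD; last exact: cvg_cst.
  by have := @act_limit_cvg x t; rewrite -(cvg_shiftn k).
move=> n; rewrite (_ : (fun t => _) = act (lmul x (p (n + k)) ++ y) gam).
  by rewrite nrm2E lee_fin h// leq_addl.
by apply/funext => t; rewrite [RHS]lsum_cat -/(act _ _ _) act_mul.
Qed.

Lemma N2_act_limit x k : (N2 (act x g) <= (nrm2 kap (lmul x (p k)))%:E)%E.
Proof.
rewrite (_ : act x g = (fun t => act x g t + act [::] gam t)); last first.
  by apply/funext => t; rewrite [act [::] _ _]big_nil addr0.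
apply: (@N2_act_limit_sub x [::] _ k) => m km; rewrite cats0.
exact: nrm2_decr.
Qed.

Lemma bound_mono k m : (k <= m)%N -> st_bound (st k) <= st_bound (st m).
Proof.
move=> km; rewrite -(subnK km); elim: (m - k)%N => [//|n IH].
rewrite addSn; apply: (le_trans IH).
by have [S [_ _ _ ?]] := st_inverse (n + k).
Qed.

(** The rate 1/4 beats the factor 2 of [nrm2_catD]: 2 (1/4)^k + 2 * 4 (1/4)^(k+1) = 4 (1/4)^k, which
    is why the constant 4 reproduces itself. *)
Lemma nrm2_telescope S k m : (k <= m)%N -> lnorm1 S <= st_bound (st k) ->
  nrm2 kap (lmul S (p m) ++ lscale (- 1) (lmul S (p k))) <= 4 * (1 / 4) ^+ k.
Proof.
move=> km; rewrite -(subnK km); move: (m - k)%N => n {km}; elim: n k => [|n IH] k Sk.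
  rewrite (nrm2_eqv _ (q := [::])); last first.
    by move=> F; rewrite lsum_cat lsum_scale add0n mulN1r subrr /lsum big_nil.
  by rewrite /nrm2 /lform big_nil mulr_ge0// exprn_ge0//; lra.
have [psi [pE _ psiB _]] := st_filter k.
have b1 : nrm2 kap (lscale (- 1) (lmul S (lmul (lcompl psi) (p k)))) <= (1 / 4) ^+ k.
  rewrite (nrm2_scale (@kappa_even R)) sqrrN expr1n (mul1r (nrm2 _ _)).
  apply: (le_trans (nrm2_mul_le (@kappa_even R) (@kappa_psd R) _ _)).
  apply: le_trans psiB; rewrite ler_wpM2r ?kappa_psd//.
  by rewrite lerXn2r ?nnegrE ?lnorm1_ge0// (le_trans (lnorm1_ge0 S)).
have b2 := IH k.+1 (le_trans Sk (bound_mono (leqnSn k))).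
rewrite addSnnS (nrm2_eqv _ (q := (lmul S (p (n + k.+1)) ++ lscale (- 1) (lmul S (p k.+1))) ++
   lscale (- 1) (lmul S (lmul (lcompl psi) (p k))))); last first.
  move=> F; rewrite !lsum_cat !lsum_scale pE !lsum_mul.
  rewrite [X in _ = _ + -1 * X](_ : _ = lsum S (fun s => lsum (p k) (fun t => F (s + t))) -
     lsum S (fun s => lsum (lmul psi (p k)) (fun t => F (s + t)))); first ring.
  rewrite -mulN1r addrC -lsum_lin; apply: eq_lsum => s.
  by rewrite (lmul_compl _ _ (fun t => F (s + t))) lsum_cat lsum_scale addrC.
apply: (le_trans (nrm2_catD (@kappa_even R) (@kappa_psd R) _ _)).
by move: b1 b2; rewrite exprS; lra.
Qed.

Lemma nrm2_translate s x : nrm2 kap (lmul [:: (1, s)] x) = nrm2 kap x.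
Proof. by rewrite (nrm2_shift kap) expr1n mul1r. Qed.

(* Fatou's lemma passes to the limit g in the telescoping estimate. *)
Lemma gauss_approx s e : 0 < e -> exists2 S : seq (R * R), int_shift S &
  (N2 (fun t => gam (t - s) - act (lmul [:: (1, s)] S) g t)%R < e%:E)%E.
Proof.
move=> e0.
have e5 : 0 < e / 5 by rewrite divr_gt0.
have [k hk] : exists k, (1 / 4 : R) ^+ k <= e / 5.
  have [|k hk] := @small_pow R (3 / 4) (e / 5) _ e5; first by apply/andP; split; lra.
  by exists k; rewrite (_ : 1 / 4 = 1 - 3 / 4)//; field.
have [S [hS hSp lS _]] := st_inverse k.
exists S => //.
pose x := lscale (- 1) (lmul [:: (1, s)] S); pose y : seq (R * R) := [:: (1, s)].
rewrite (_ : (fun t => _) = (fun t => act x g t + act y gam t)); last first.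
  apply/funext => t; rewrite /act lsum_scale mulN1r addrC.
  by rewrite [in RHS]/lsum big_seq1 mul1r.
apply: (@le_lt_trans _ _ (4 * (1 / 4) ^+ k)%:E); last by rewrite lte_fin; lra.
apply: (@N2_act_limit_sub _ _ _ k.+1) => m km.
rewrite (nrm2_eqv _ (q := lmul [:: (1, s)] ((lone ++ lscale (- 1) (lmul S (p k.+1))) ++
   lscale (- 1) (lmul S (p m) ++ lscale (- 1) (lmul S (p k.+1)))))); last first.
  have l1 (G : R -> R) : lsum y G = G s by rewrite /lsum big_seq1 mul1r.
  move=> F; rewrite lsum_cat lsum_mul lsum_scale lsum_mul !l1.
  rewrite lsum_mul l1 !lsum_cat !lsum_scale lsum_cat lsum_scale lsum_one !lsum_mul addr0.
  rewrite (_ : lsum S _ = lsum S (fun t => lsum (p m) (fun u => F (s + (t + u))))); first by ring.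
  by apply: eq_lsum => t; apply: eq_lsum => u; rewrite addrA.
rewrite nrm2_translate.
apply: (le_trans (nrm2_catD (@kappa_even R) (@kappa_psd R) _ _)).
have := nrm2_telescope km lS; rewrite (nrm2_scale (@kappa_even R)) sqrrN expr1n (mul1r (nrm2 _ _)) exprS.
by move: hSp; lra.
Qed.

(** Bounds the row sums of the Gram matrix by two geometric series of ratio exp(-1/2): points that
    are n places apart differ by at least n, and n^2 >= n. *)
Definition gap_const : R := 2 * kappa 0 / (1 - expR (- 2^-1)).

Lemma kappa_dist_le (a b : R) (n : nat) : n%:R <= `|a - b| ->
  kap (a - b) <= kap 0 * expR (- 2^-1) ^+ n.
Proof.
move=> nab; rewrite /kappa expr0n /= mul0r oppr0 expR0 mulr1 ler_wpM2l//.
  by rewrite ltW// gauss_mass_gt0.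
rewrite -expRM_natl ler_expR -[(a - b) ^+ 2]real_normK ?num_real//.
have : n%:R <= `|a - b| ^+ 2.
  apply: (@le_trans _ _ (n%:R ^+ 2)); last by rewrite lerXn2r ?nnegrE.
  by rewrite -natrX ler_nat; case: (n) => // k; rewrite expnS leq_pmulr.
lra.
Qed.

Lemma sum_geo_dist (r : R) i N : 0 <= r < 1 ->
  \sum_(0 <= j < N) r ^+ `|i%:Z - j%:Z|%N <= 2 / (1 - r).
Proof.
move=> /andP[r0 r1]; have d0 : 0 < 1 - r by lra.
have A n : (n <= i.+1)%N -> \sum_(0 <= j < n) r ^+ `|i%:Z - j%:Z|%N <= r ^+ (i.+1 - n) / (1 - r).
  elim: n => [|n IH] ni; first by rewrite big_geq// divr_ge0 ?exprn_ge0// ltW.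
  rewrite big_nat_recr//= (le_trans (lerD (IH (ltnW ni)) (lexx _)))//.
  rewrite ltnS in ni; rewrite distnEl// subSS subSn// exprS.
  by rewrite le_eqVlt; apply/orP; left; apply/eqP; field; rewrite gt_eqF.
have Bd n : \sum_(0 <= j < i.+1 + n) r ^+ `|i%:Z - j%:Z|%N <= (1 + r - r ^+ n.+1) / (1 - r).
  elim: n => [|n IH].
    rewrite addn0 expr1 addrK (le_trans (A _ (leqnn _)))// subnn expr0//.
  rewrite addnS big_nat_recr//= (le_trans (lerD IH (lexx _)))//.
  have -> : `|i%:Z - (i.+1 + n)%N%:Z|%N = n.+1.
    by rewrite addSnnS -[X in (X%:Z - _)%R]addn0 distnDl dist0n.
  rewrite le_eqVlt; apply/orP; left; apply/eqP; rewrite [in RHS]exprS.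
  by field; rewrite gt_eqF.
have [Ni|/ltnW Ni] := leqP N i.+1.
  apply: (le_trans (A _ Ni)); rewrite ler_wpM2r ?invr_ge0 ?(ltW d0)//.
  by apply: (@le_trans _ _ 1); [rewrite exprn_ile1// ltW|lra].
rewrite -(subnKC Ni); apply: (le_trans (Bd _)).
rewrite ler_wpM2r ?invr_ge0 ?(ltW d0)//.
by have := exprn_ge0 (N - i.+1).+1 r0; lra.
Qed.

Lemma gap_const_gt0 : 0 < gap_const.
Proof.
have h : expR (- 2^-1) < 1 :> R by rewrite expR_lt1 oppr_lt0 invr_gt0.
rewrite /gap_const divr_gt0// ?subr_gt0// mulr_gt0//.
by rewrite /kappa mulr_gt0 ?gauss_mass_gt0// expR_gt0.
Qed.

(** Schur's test: c_n c_m <= (c_n^2 + c_m^2)/2 and the symmetry of the kernel reduce the form to its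
    row sums. *)
Lemma nrm2_separated (c : nat -> R) N :
  nrm2 kap [seq (c n, lambda n) | n <- iota 0 N] <= gap_const * \sum_(0 <= n < N) c n ^+ 2.
Proof.
rewrite /nrm2 /lform big_map.
have I0 : iota 0 N = index_iota 0 N by rewrite /index_iota subn0.
have K n : \sum_(0 <= m < N) kap (lambda n - lambda m) <= gap_const.
  apply: (@le_trans _ _ (\sum_(0 <= m < N) kap 0 * expR (- 2^-1) ^+ `|n%:Z - m%:Z|%N)).
    by apply: ler_sum => m _; apply: kappa_dist_le; exact: lambda_dist.
  rewrite -mulr_sumr /gap_const -mulrA mulrCA.
  rewrite ler_wpM2l ?kappa_ge0//.
  by apply: sum_geo_dist; rewrite expR_ge0 expR_lt1 oppr_lt0 invr_gt0/=.
apply: (@le_trans _ _ (\sum_(0 <= n < N) \sum_(0 <= m < N)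
   (c n ^+ 2 + c m ^+ 2) / 2 * kap (lambda n - lambda m))).
  rewrite I0; apply: ler_sum => n _; rewrite big_map; apply: ler_sum => m _ /=.
  rewrite ler_wpM2r ?kappa_ge0//.
  by have := sqr_ge0 (c n - c m); nra.
have -> : \sum_(0 <= n < N) \sum_(0 <= m < N) (c n ^+ 2 + c m ^+ 2) / 2 * kap (lambda n - lambda m)
  = \sum_(0 <= n < N) c n ^+ 2 * \sum_(0 <= m < N) kap (lambda n - lambda m).
  pose T a b : R := c a ^+ 2 / 2 * kap (lambda a - lambda b).
  have -> : \sum_(0 <= n < N) \sum_(0 <= m < N) (c n ^+ 2 + c m ^+ 2) / 2 * kap (lambda n - lambda m)
    = \sum_(0 <= n < N) \sum_(0 <= m < N) T n m + \sum_(0 <= n < N) \sum_(0 <= m < N) T m n.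
    rewrite -big_split; apply: eq_bigr => n _ /=; rewrite -big_split; apply: eq_bigr => m _ /=.
    by rewrite /T -(kappa_even (lambda m - lambda n)) opprB; ring.
  rewrite [X in _ + X]exchange_big /= -big_split; apply: eq_bigr => n _ /=.
  rewrite -big_split mulr_sumr; apply: eq_bigr => m _ /=.
  by rewrite /T; field.
rewrite mulr_sumr; apply: ler_sum => n _.
by rewrite mulrC ler_wpM2r ?sqr_ge0.
Qed.

Lemma N2_separated (c : nat -> R) N :
  (N2 (fun t => \sum_(0 <= n < N) c n * g (t - lambda n))%R <=
   (gap_const * \sum_(0 <= n < N) c n ^+ 2)%:E)%E.
Proof.
pose x := [seq (c n, lambda n) | n <- iota 0 N].
have -> : (fun t => \sum_(0 <= n < N) c n * g (t - lambda n)) = act x g.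
  by apply/funext => t; rewrite /act /lsum /x big_map /index_iota subn0.
apply: (le_trans (N2_act_limit x 0)); rewrite lee_fin st0 /=.
rewrite (nrm2_eqv _ (q := x)); last first.
  by move=> F; rewrite (lmulC _ _ F) (lmul1 _ F).
exact: nrm2_separated.
Qed.

Lemma big_pos_int (Q : seq (R * int)) (M : nat) (F : R * int -> R) :
  (forall a, a \in Q -> 0 < a.2 <= M%:Z) ->
  \sum_(0 <= i < M) \sum_(a <- Q | a.2 == i.+1%:Z) F a = \sum_(a <- Q) F a.
Proof.
move=> HQ; under eq_bigr do rewrite big_mkcond.
rewrite exchange_big /= big_seq [RHS]big_seq; apply: eq_bigr => a aQ.
case: a aQ (HQ _ aQ) => /= c [[|n]|n] // aQ /=; rewrite lez_nat => nM.
rewrite -big_mkcond /= (eq_bigl (fun i => i == n)).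
  by rewrite big_nat1_eq /= nM.
by move=> i; rewrite eqz_nat eqSS eq_sym.
Qed.

(** m^q = m^(q-1) m, and m <= s^(k+1) gives m^(q-1) <= s^(k+2), since (k+1)(q-1) >= k+2 by the
    condition on q. *)
Lemma powR_flat (s T q : R) (m : nat -> R) k M : 0 < s <= 1 -> 2 + k.+1%:R^-1 <= q ->
  (forall i, 0 <= m i <= s ^+ k.+1) -> \sum_(0 <= i < M) m i <= T ->
  \sum_(0 <= i < M) (m i) `^ q <= s ^+ k.+2 * T.
Proof.
move=> /andP[s0 s1] hq hm hT.
have k0 : 0 < k.+1%:R^-1 :> R by rewrite invr_gt0.
have q1 : 0 <= q - 1 by move: k0 hq; move: (_^-1) => w; lra.
apply: (@le_trans _ _ (\sum_(0 <= i < M) s ^+ k.+2 * m i)); last first.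
  by rewrite -mulr_sumr ler_wpM2l// exprn_ge0// ltW.
apply: ler_sum => i _; have /andP[m0 ms] := hm i.
have [->|mN] := eqVneq (m i) 0.
  by rewrite mulr0 powR0//; apply/eqP => q0; move: q1; rewrite q0; lra.
have mp : 0 < m i by rewrite lt_neqAle eq_sym mN.
rewrite -{1}(subrK 1 q) powRD ?mN ?implybT// powRr1// ler_wpM2r//.
apply: (@le_trans _ _ ((s ^+ k.+1) `^ (q - 1))).
  by apply: ge0_ler_powR => //; rewrite nnegrE exprn_ge0// ltW.
rewrite -!powR_mulrn ?(ltW s0)// -powRrM ger_powR ?s0//.
rewrite -ler_pdivrMl//.
have -> : k.+1%:R^-1 * k.+2%:R = 1 + k.+1%:R^-1 :> R.
  by rewrite -[k.+2%:R]natr1 mulrDr mulVf// mulr1.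
by move: hq; move: (k.+1%:R^-1) => w; lra.
Qed.

Lemma approximable_translate (r : rat) :
  approximable_class g lambda (fun t => g (t - ratr r)).
Proof.
split; first by apply: measurable_shift; exact: measurable_limit_fun.
move=> q e b q2 e0 b0; set s : R := ratr r.
have eb0 : 0 < Num.min (e / 2) b by rewrite lt_min b0 divr_gt0.
have [|n1 hn1] := @small_pow R (1 / 2) (Num.min (e / 2) b) _ eb0; first by apply/andP; split; lra.
have [n2 [n20 hn2]] := large_nat (q - 2)^-1.
(* A large k makes (1/2)^k at most e/2 and b, and 2 + 1/(k+1) at most q. *)
have [k kn rk] := target_infinitely_often r (n1 + n2).
have hk : (1 / 2 : R) ^+ k <= Num.min (e / 2) b.
  apply: le_trans hn1; rewrite (_ : 1 - 1 / 2 = 1 / 2); last by field.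
  by apply: ler_wiXn2l; [lra|lra|exact: leq_trans (leq_addr _ _) kn].
have kq : 2 + k.+1%:R^-1 <= q.
  have : k.+1%:R^-1 <= q - 2.
    rewrite -[q - 2]invrK lef_pV2 ?posrE ?invr_gt0 ?subr_gt0//.
    by apply: (le_trans hn2); rewrite ler_nat (leq_trans (leq_addl n1 n2))// ltnW.
  by move: (_^-1) => w; lra.
have [Q [d [K [L' [LE K0 HQ [s' [T [s1 cQ lQ sT]]] nQ]]]]] := st_block k.
rewrite rk -/s in LE nQ.
pose off := size (L k ++ L').
(* Entries of Q with the same frequency are added up, as each point of Lambda is listed once;
   outside the block all coefficients vanish. *)
pose c n := if (off <= n)%N then \sum_(a <- Q | a.2 == (n - off).+1%:Z) a.1 else 0.
have lamE i : (i < K)%N -> lambda (off + i) = s + d%:R * i.+1%:R.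
  move=> iK; have si : (off + i < size (L k.+1))%N.
    by rewrite LE size_cat size_map size_iota ltn_add2l.
  rewrite (lambdaE si) LE nth_cat -/off ltnNge leq_addr /= addKn.
  by rewrite (nth_map 0%N) ?size_iota// nth_iota// add0n.
have sum_off (G : nat -> R) M : (off + K <= M)%N -> (forall n, (n < off)%N -> G n = 0) ->
    \sum_(0 <= n < M) G n = \sum_(0 <= i < M - off) G (off + i)%N.
  move=> hM G0; have oM : (off <= M)%N by rewrite (leq_trans _ hM)// leq_addr.
  rewrite (big_cat_nat (n := off))//= big_nat big1 ?add0r; last by move=> n /andP[_ /G0].
  by rewrite -{1}[off]add0n big_addn; apply: eq_bigr => i _; rewrite addnC.
exists (off + K)%N, c => M hM.
have KM : (K <= M - off)%N by rewrite leq_subRL// (leq_trans _ hM)// leq_addr.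
have HQM a : a \in Q -> 0 < a.2 <= (M - off)%N%:Z.
  by move=> /HQ/andP[-> /le_trans]; apply; rewrite lez_nat.
have cE i : c (off + i)%N = \sum_(a <- Q | a.2 == i.+1%:Z) a.1 by rewrite /c leq_addr addKn.
split.
  pose x := lmul [:: (1, s)] (lcompl (emb d Q)).
  rewrite (_ : (fun t => _) = act x g).
    apply: (@le_lt_trans _ _ ((1 / 2) ^+ k)%:E).
      apply: (le_trans (N2_act_limit x k.+1)); rewrite lee_fin; apply: le_trans nQ.
      rewrite -(nrm2_translate s (lmul (lcompl _) (p k.+1))).
      by rewrite [X in _ <= X](nrm2_eqv _ (lmulA _ _ _)).
    rewrite lte_fin; apply: (le_lt_trans hk); rewrite gt_min; apply/orP; left; lra.
  apply/funext => t; rewrite act_mul /act [in RHS]/lsum big_seq1 mul1r /=.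
  rewrite -/(lsum (lcompl (emb d Q)) (fun u => g (t - s - u))).
  rewrite lsum_compl subr0; congr (_ - _).
  rewrite /comb (sum_off (fun n => c n * g (t - lambda n)))//; last first.
    by move=> n; rewrite /c ltnNge => /negbTE ->; rewrite mul0r.
  rewrite /lsum /emb big_map -(big_pos_int _ HQM); apply: eq_bigr => i _.
  rewrite cE mulr_suml big_seq_cond [RHS]big_seq_cond; apply: eq_bigr => a /andP[aQ /eqP ai] /=.
  have iK : (i < K)%N by have /andP[_] := HQ a aQ; rewrite ai lez_nat.
  by rewrite lamE// ai opprD addrA.
rewrite (sum_off (fun n => `|c n| `^ q))//; last first.
  move=> n; rewrite /c ltnNge => /negbTE ->; rewrite normr0 powR0//.
  by apply/eqP; lra.
apply: (@le_trans _ _ (s' ^+ k.+2 * T)); last first.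
  by apply: (le_trans sT); apply: (le_trans hk); rewrite ge_min lexx orbT.
apply: (@le_trans _ _ (\sum_(0 <= i < M - off) (\sum_(a <- Q | a.2 == i.+1%:Z) `|a.1|) `^ q)).
  apply: ler_sum => i _; rewrite cE; apply: ge0_ler_powR; rewrite ?nnegrE//; first lra.
    by rewrite sumr_ge0.
  exact: ler_norm_sum.
apply: powR_flat => //; first by move=> i; rewrite sumr_ge0//= cQ.
by rewrite (big_pos_int _ HQM).
Qed.

Lemma approximable_L2 f : measurable_fun setT f -> (N2 f < +oo)%E ->
  approximable_class g lambda f.
Proof.
have mg := measurable_limit_fun.
apply: gauss_translates_dense.
- by move=> u [].
- by move=> a u v; exact: approximable_lin.
- exact: approximable_closed.
move=> r; apply: approximable_closed => //.
  by apply: measurable_shift; exact: measurable_gam.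
move=> e e0; have [S hS SP] := gauss_approx (ratr r) e0.
exists (act (lmul [:: (1, ratr r)] S) g) => //.
apply: approximable_act => //; first exact: approximable0.
(* The shifts are r plus an integer, hence rational, and [approximable_translate] applies to each of
   them. *)
move=> a /allpairsP[[u v] /= [+ /hS vi ->]]; rewrite inE => /eqP -> /=.
have [m ->] := intrP vi.
have -> : ratr r + m%:~R = ratr (r + m%:~R) :> R by rewrite rmorphD /= ratr_int.
exact: approximable_translate.
Qed.

Lemma lambda_discrete : uniformly_discrete lambda.
Proof.
apply: (@lt_le_trans _ _ 1) => //; apply: lb_le_inf.
  by exists `|lambda 0 - lambda 1|, 0%N, 1%N.
move=> x [n [m [nm ->]]]; apply: le_trans (lambda_dist n m).
by rewrite ler1n lt0n distn_eq0.
Qed.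

Lemma lambda_neq0 n : lambda n != 0.
Proof. by rewrite gt_eqF// (lt_le_trans _ (lambda_ge1 n)). Qed.

Lemma lambda_ratio n : 1 + eps n < lambda n.+1 / lambda n.
Proof.
by rewrite ltr_pdivlMr ?(lt_le_trans _ (lambda_ge1 n))//; have [] := lambda_step n.
Qed.

Local Notation gC := (fun t => (limit_fun t)%:C%C).

Lemma N2_limit_translate s : (N2 (fun t => g (t - s)%R) < +oo)%E.
Proof.
rewrite (_ : (fun t => _) = act [:: (1, s)] g); last first.
  by apply/funext => t; rewrite /act /lsum big_seq1 mul1r.
by apply: le_lt_trans (N2_act_limit _ 0) (ltry _).
Qed.

Lemma inL2_limit_fun : inL2 gC.
Proof.
have := @inL2_translates _ _ (fun=> 0) measurable_limit_fun 0 (N2_limit_translate 0).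
by rewrite /translates; under eq_fun do rewrite subr0.
Qed.

Lemma QF_limit_fun : QF_system (translates gC lambda).
Proof.
have mg := measurable_limit_fun; split.
- by move=> n; apply: inL2_translates => //; exact: N2_limit_translate.
- by apply: QF_approximation_real => //; exact: approximable_L2.
apply: (Bessel_real mg gap_const_gt0); last exact: N2_separated.
by move=> n; exact: N2_limit_translate.
Qed.

Lemma smooth_limit_fun : smooth gC.
Proof. by apply: smooth_gauss_psum; exact: rapid_coefs. Qed.

Lemma entire_limit_fun : entire_on_reals gC.
Proof. by apply: entire_gauss_psum; exact: rapid_coefs. Qed.

End limit.

Theorem proposition1 (R : realType) :
  (forall eps : nat -> R,
     (forall n, 0 < eps n) ->
     eps n @[n --> \oo] --> (0 : R) ->
     exists (lam : nat -> R) (g : R -> R[i]),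
       [/\ uniformly_discrete lam,
           forall n, lam n != 0,
           forall n, 1 + eps n < lam n.+1 / lam n &
           [/\ inL2 g, smooth g, entire_on_reals g &
               QF_system (translates g lam)]]) /\
  (exists (lam : nat -> R) (g : R -> R[i]),
     [/\ uniformly_discrete lam, inL2 g, entire_on_reals g &
         QF_system (translates g lam)]).
Proof.
have main : forall eps : nat -> R, (forall n, 0 < eps n) ->
     eps n @[n --> \oo] --> (0 : R) ->
     exists (lam : nat -> R) (g : R -> R[i]),
       [/\ uniformly_discrete lam,
           forall n, lam n != 0,
           forall n, 1 + eps n < lam n.+1 / lam n &
           [/\ inL2 g, smooth g, entire_on_reals g &
               QF_system (translates g lam)]].
  move=> eps eps0 eps_cvg.
  have [st [st0 inv H]] := construction_exists eps0 eps_cvg.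
  have hb k : step_block k (ratr (target k)) (st k) (st k.+1) by case: (H k).
  have hf k : step_filter k (st k) (st k.+1) by case: (H k).
  have hi k : step_inverse k (st k) (st k.+1) by case: (H k).
  exists (lambda st), (fun t => (limit_fun st t)%:C%C); split.
  - exact: (lambda_discrete st0 inv hb).
  - exact: (lambda_neq0 st0 inv hb).
  - exact: (lambda_ratio st0 inv hb).
  split.
  - exact: inL2_limit_fun.
  - exact: smooth_limit_fun.
  - exact: entire_limit_fun.
  - exact: (QF_limit_fun st0 inv hb hf hi).
split; first exact: main.
(* Any positive null sequence yields the second assertion; the harmonic one is taken. *)
have [//|lam [g [? ? ? [? ? ? ?]]]] := main (@harmonic R) _ (@cvg_harmonic R).
  by move=> n; rewrite /harmonic /= invr_gt0.
by exists lam, g; split.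
Qed.
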